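(* Let $0<\gamma<1$ and set $b=\frac{\gamma}{1-\gamma}$, $a=(1-\gamma)\gamma^{\frac{\gamma}{1-\gamma}}$, $c=\frac b2+1$, $A=\sqrt{2\pi(b+1)}\,(ab)^{-\frac1{b+1}(\frac12-c)}$. Let $\theta_n=[z^{n-1}]\bigl(A(1-z)^{-c}\exp(a(1-z)^{-b})\bigr)$ for $n\ge1$. Then, under $\mathbb{P}_n$ as $n\to\infty$: (a) $\dfrac{L_1}{(\log n)^{1/\gamma}}$ converges in distribution to the constant $(1-\gamma)^{-1/\gamma}$; (b) $R_1,R_2,\dots$ converge weakly to independent Poisson random variables with respective means $\theta_1,\frac{\theta_2}{2},\frac{\theta_3}{3},\dots$.
   Context: For $\sigma\in\mathcal{S}_n$ (permutations of $\{1,\dots,n\}$), $R_j(\sigma)$ is the number of cycles of length $j$ and $L_1(\sigma)$ the length of the cycle containing $1$. Given parameters $\theta_j\ge0$, $h_n=\frac1{n!}\sum_{\sigma\in\mathcal{S}_n}\prod_j\theta_j^{R_j(\sigma)}$ and $\mathbb{P}_n(\sigma)=\frac1{n!h_n}\prod_j\theta_j^{R_j(\sigma)}$. $[z^m]G(z)$ denotes the $m$-th Taylor coefficient of $G$ at $0$. *)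

(* Defs.v *)
From mathcomp Require Import all_boot all_fingroup.
From Stdlib Require Import Reals.
Set Implicit Arguments. Unset Strict Implicit. Unset Printing Implicit Defensive.

Definition Rsum (T : Type) (s : seq T) (f : T -> R) : R :=
  foldr (fun x acc => (f x + acc)%R) 0%R s.

(* We work with permutations of 'I_N, N = n.+1; the point "1" of the paper is ord0. *)
Definition Rcyc (N : nat) (j : nat) (s : {perm 'I_N}) : nat :=
  #|[set C in porbits s | #|C| == j]|.

Definition L1 (n : nat) (s : {perm 'I_n.+1}) : nat := #|porbit s ord0|.

(* weight prod_j theta_j^{R_j(sigma)}; R_j = 0 for j > N, j = 0 *)
Definition weight (theta : nat -> R) (N : nat) (s : {perm 'I_N}) : R :=
  foldr (fun j acc => (theta j ^ Rcyc j s * acc)%R) 1%R (iota 1 N).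

Definition hn (theta : nat -> R) (N : nat) : R :=
  (/ INR (N`!) * Rsum (enum {perm 'I_N}) (weight theta (N:=N)))%R.

Definition Pn (theta : nat -> R) (N : nat) (s : {perm 'I_N}) : R :=
  (weight theta s / (INR (N`!) * hn theta N))%R.

Definition Prob (theta : nat -> R) (N : nat) (E : pred {perm 'I_N}) : R :=
  Rsum [seq s <- enum {perm 'I_N} | E s] (Pn theta (N:=N)).

Definition bpar (g : R) : R := (g / (1 - g))%R.
Definition apar (g : R) : R := ((1 - g) * Rpower g (g / (1 - g)))%R.
Definition cpar (g : R) : R := (bpar g / 2 + 1)%R.
Definition Apar (g : R) : R :=
  (sqrt (2 * PI * (bpar g + 1)) *
   Rpower (apar g * bpar g) (- (/ (bpar g + 1)) * (/ 2 - cpar g)))%R.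

Definition Gfun (g : R) (x : R) : R :=
  (Apar g * Rpower (1 - x) (- cpar g) * exp (apar g * Rpower (1 - x) (- bpar g)))%R.

Definition poisson_pmf (lam : R) (m : nat) : R :=
  (exp (- lam) * lam ^ m / INR (m`!))%R.

(* Main.v *)
(* Write t_n = [z^n] G(z) = theta_{n+1}.  Expanding the exponential, t_n is a mixture over k
   of the coefficients of (1-z)^(-c-bk).  The quotient of consecutive k-terms is explicit, so
   a Stein identity bounds the variance of k under the mixture, which makes t_n eventually
   log-concave.  Changing finitely many theta_j therefore turns 1, theta_1, theta_2, ... into
   a log-concave sequence, to which the Bender-Canfield theorem applies: the corresponding
   p_n are log-concave, with p_{n-1}/p_n increasing to 1.  The original h_n is obtained from
   p_n by convolution with the coefficients of an entire function, so h_n/p_n has a positive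
   limit, as does the same quotient when small cycles are forbidden; this gives (b).

   For (a), P(L_1 = k) = theta_k h_{n-k} / (n h_n) <= (C/n) theta_k rho^k with
   rho = p_{n-1}/p_n.  Log-concavity and n p_n = sum_k Z_k p_{n-k} (Z the modified weights)
   give rho <= 1 - (1-o(1)) delta, where delta = (a / log n)^(1/b) is the scale on which
   exp(a (1-x)^(-b)) = n, and comparing with G(1 - lambda delta) for lambda near 1 yields
   Chernoff bounds on both tails of L_1 around b log n / delta. *)
From HB Require Import structures.
From mathcomp Require Import zify.
From Coquelicot Require Import Coquelicot.
Require Import Defs.
From mathcomp Require Import all_boot all_fingroup.
From Stdlib Require Import Reals Lra Lia FunctionalExtensionality.
Delimit Scope nat_scope with N.
Set Implicit Arguments. Unset Strict Implicit. Unset Printing Implicit Defensive.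

(** Log-concavity of [t] holds with a constant factor to spare. The quotient of consecutive k-terms
    passes 1 at a mode [m] that tends to infinity with n, and its logarithm falls there at rate
    about (1 + b)/m; so k has variance about m/(1 + b), while b Var(k) <= E(k) + 1/2 is required.
    The obstacle is that [phi] is known to fall at this rate only up to slightly above [m]; further
    out only monotonicity is used, and a term of degree 4 has to be carried to cover the loss.

    For (a), an upper bound on rho alone serves both tails. On the event of interest rho^k is at
    most X (1 - lambda delta)^k for a suitable factor X, with lambda > 1 for short cycles and lambda
    < 1 for long ones. If the threshold is kap b log n / delta, the resulting bound is a power of n
    with exponent close to lambda^(-b) - 1 + kap b (lambda - 1). This vanishes at lambda = 1 with
    slope b (kap - 1), so every kap other than 1 leaves room for a negative exponent. *)

HB.instance Definition _ := Monoid.isComLaw.Build R 0%R Rplus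
  (fun x y z => esym (Rplus_assoc x y z)) Rplus_comm Rplus_0_l.
HB.instance Definition _ := Monoid.isComLaw.Build R 1%R Rmult
  (fun x y z => esym (Rmult_assoc x y z)) Rmult_comm Rmult_1_l.
HB.instance Definition _ := Monoid.isMulLaw.Build R 0%R Rmult Rmult_0_l Rmult_0_r.
HB.instance Definition _ := Monoid.isAddLaw.Build R Rmult Rplus
  Rmult_plus_distr_r Rmult_plus_distr_l.

Notation "\rsum_ ( i < n ) F" := (\big[Rplus/0%R]_(i < n) F%R)
  (at level 34, F at level 41, i, n at level 50).
Notation "\rprod_ ( i < n ) F" := (\big[Rmult/1%R]_(i < n) F%R)
  (at level 36, F at level 36, i, n at level 50).

Open Scope R_scope.

(** * Finite sums and products of reals *)

Lemma rsum_ge0 n (F : 'I_n -> R) : (forall i, 0 <= F i) -> 0 <= \rsum_(i < n) F i.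
Proof. by move=> H; elim/big_ind: _ => [|x y|i _]; try lra; apply: H. Qed.

Lemma rsum_le n (F G : 'I_n -> R) : (forall i, F i <= G i) ->
  \rsum_(i < n) F i <= \rsum_(i < n) G i.
Proof. by move=> H; elim/big_ind2: _ => [|x1 x2 y1 y2|i _]; try lra; apply: H. Qed.

Lemma rsumMl n (F : 'I_n -> R) (x : R) : x * \rsum_(i < n) F i = \rsum_(i < n) (x * F i).
Proof. by rewrite big_distrr. Qed.

Lemma rsumMr n (F : 'I_n -> R) (x : R) : (\rsum_(i < n) F i) * x = \rsum_(i < n) (F i * x).
Proof. by rewrite big_distrl. Qed.

Lemma rsumD n (F G : 'I_n -> R) :
  \rsum_(i < n) (F i + G i) = \rsum_(i < n) F i + \rsum_(i < n) G i.
Proof. by rewrite big_split. Qed.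

Lemma rsumB n (F G : 'I_n -> R) :
  \rsum_(i < n) (F i - G i) = \rsum_(i < n) F i - \rsum_(i < n) G i.
Proof.
rewrite /Rminus rsumD; congr (_ + _).
by elim/big_rec2: _ => [|i x y _ ->]; ring.
Qed.

Lemma rsum0 n (F : 'I_n -> R) : (forall i, F i = 0) -> \rsum_(i < n) F i = 0.
Proof. by move=> H; rewrite big1. Qed.

Lemma rsum_abs n (F : 'I_n -> R) : Rabs (\rsum_(i < n) F i) <= \rsum_(i < n) Rabs (F i).
Proof.
elim/big_ind2: _ => [|x1 x2 y1 y2 h1 h2|i _]; first by rewrite Rabs_R0; lra.
  by apply: Rle_trans (Rabs_triang _ _) _; lra.
lra.
Qed.

Lemma rsum_const n (x : R) : \rsum_(i < n) x = INR n * x.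
Proof.
elim: n => [|n IH]; first by rewrite big_ord0 /=; ring.
by rewrite S_INR big_ord_recr /= IH; ring.
Qed.

Lemma rprod_gt0 n (F : 'I_n -> R) : (forall i, 0 < F i) -> 0 < \rprod_(i < n) F i.
Proof. by move=> H; elim/big_ind: _ => [|x y|i _]; [lra|apply: Rmult_lt_0_compat|apply: H]. Qed.

Lemma rprod_ge_sum n (F : 'I_n -> R) : (forall i, 0 <= F i) ->
  1 + \rsum_(i < n) F i <= \rprod_(i < n) (1 + F i).
Proof.
elim: n F => [|n IH] F H; first by rewrite !big_ord0; lra.
rewrite !big_ord_recr.
move: (IH (fun i => F (widen_ord (leqnSn n) i)) (fun i => H _)).
move: (rsum_ge0 (fun i : 'I_n => H (widen_ord (leqnSn n) i))) (H ord_max) => /=.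
move: (\big[Rplus/_]_(i < n) _) (\big[Rmult/_]_(i < n) _) (F _) => S P x *.
have h5 : (1 + S) * (1 + x) <= P * (1 + x) by apply: Rmult_le_compat_r; lra.
by have h6 : 0 <= S * x; [exact: Rmult_le_pos|lra].
Qed.

Lemma sum_n_rsum (f : nat -> R) n : sum_n f n = \rsum_(i < n.+1) f i.
Proof.
elim: n => [|n IH]; first by rewrite sum_O big_ord1.
by rewrite sum_Sn big_ord_recr /= IH.
Qed.

Lemma leR (m n : nat) : (m <= n)%N -> INR m <= INR n.
Proof. by move=> h; apply: le_INR; lia. Qed.

Lemma ltR (m n : nat) : (m < n)%N -> INR m < INR n.
Proof. by move=> h; apply: lt_INR; lia. Qed.

Lemma exp_le_compat x y : x <= y -> exp x <= exp y.
Proof. by case=> [h|->]; [exact/Rlt_le/exp_increasing|exact: Rle_refl]. Qed.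

(* Elaboration may leave the index type of a sum as [Finite.sort _], which is
   convertible but not syntactically equal to ['I_n] and so confuses [lra]. *)
Ltac lra_sum := repeat match goal with
  | H : context [Finite.sort (fintype_ordinal__canonical__fintype_Finite ?n)] |- _ =>
    change (Finite.sort (fintype_ordinal__canonical__fintype_Finite n)) with (ordinal n) in H
  | |- context [Finite.sort (fintype_ordinal__canonical__fintype_Finite ?n)] =>
    change (Finite.sort (fintype_ordinal__canonical__fintype_Finite n)) with (ordinal n)
  end; lra.

(** * Weights and their quotients *)

Section Coefficients.
Variables a b : R.
Hypotheses (a0 : 0 < a) (b0 : 0 < b).

Definition shp (k : nat) : R := b / 2 + 1 + b * INR k.

(** The coefficient of z^n in a^k/k! (1 - z)^(-[shp k]), the k-th term of the expanded
    exponential. *)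
Definition wgt (n k : nat) : R :=
  a ^ k / INR k`! * \rprod_(i < n) ((shp k + INR i) / (INR i + 1)).

(** The product of ([shp k.+1] + i)/([shp k] + i): the quotient of [wgt n k.+1] by [wgt n k], apart
    from the factor a/(k+1). *)
Definition phi (n k : nat) : R := \rprod_(i < n) (1 + b / (shp k + INR i)).

Lemma shp_gt1 k : 1 < shp k.
Proof. by rewrite /shp; have := Rmult_le_pos _ _ (Rlt_le _ _ b0) (pos_INR k); lra. Qed.

Lemma shpS k : shp k.+1 = shp k + b.
Proof. by rewrite /shp S_INR; ring. Qed.

Lemma fact_gt0R k : 0 < INR k`!.
Proof. by apply: lt_0_INR; have := fact_gt0 k; lia. Qed.

Lemma wgt_gt0 n k : 0 < wgt n k.
Proof.
apply: Rmult_lt_0_compat.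
  by apply: Rdiv_lt_0_compat; [exact: pow_lt|exact: fact_gt0R].
apply: rprod_gt0 => i; have := pos_INR i; have := shp_gt1 k => *.
by apply: Rdiv_lt_0_compat; lra.
Qed.

Lemma phi_gt0 n k : 0 < phi n k.
Proof.
apply: rprod_gt0 => i; have := pos_INR i; have := shp_gt1 k => *.
have : 0 < b / (shp k + INR i) by apply: Rdiv_lt_0_compat; lra.
lra.
Qed.

Lemma wgt_row n k : wgt n.+1 k = wgt n k * ((shp k + INR n) / (INR n + 1)).
Proof. by rewrite /wgt big_ord_recr /= Rmult_assoc. Qed.

Lemma wgt_col n k : (INR k + 1) * wgt n k.+1 = a * phi n k * wgt n k.
Proof.
elim: n => [|n IH].
  rewrite /wgt /phi !big_ord0 factS mult_INR S_INR /=.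
  have := fact_gt0R k; have := pos_INR k => *; field; lra.
rewrite !wgt_row -Rmult_assoc IH /phi big_ord_recr /= -/(phi n k) shpS.
have := pos_INR n; have := shp_gt1 k => *; field; lra.
Qed.

(* The boundary term that truncation leaves in Stein's identity has a sign. *)
Lemma stein K n (f : nat -> R) :
  \rsum_(k < K) ((INR k * f k - a * phi n k * f k.+1) * wgt n k)
  = - (INR K * f K * wgt n K).
Proof.
elim: K => [|K IH]; first by rewrite big_ord0 /=; ring.
rewrite big_ord_recr /= IH -/(INR K.+1) S_INR.
have -> : (INR K + 1) * f K.+1 * wgt n K.+1 = f K.+1 * ((INR K + 1) * wgt n K.+1) by ring.
by rewrite wgt_col; ring.
Qed.

(** Factor by factor: (1 + b/u)/(1 + b/v) = 1 + b (v - u)/(u (v + b)), and here v - u = b (k -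
    m). *)
Lemma phi_ratio n m k : phi n m = phi n k * \rprod_(i < n)
  (1 + b ^ 2 * (INR k - INR m) / ((shp m + INR i) * (shp k + b + INR i))).
Proof.
elim: n => [|n IH]; first by rewrite /phi !big_ord0; ring.
rewrite {1}/phi big_ord_recr /= -/(phi n m) IH {2}/phi !big_ord_recr /= -/(phi n k).
set P := \big[_/_]_(i < n) _.
have := pos_INR n; have := shp_gt1 k; have := shp_gt1 m => h1 h2 h3.
rewrite !Rmult_assoc; congr (_ * _); rewrite -Rmult_assoc (Rmult_comm _ P) Rmult_assoc; congr (_ * _).
have -> : INR k = (shp k - shp m) / b + INR m by rewrite /shp; field; lra.
field; lra.
Qed.

Lemma telescope n x : 0 < x ->
  \rsum_(i < n) (/ ((x + INR i) * (x + INR i + 1))) = / x - / (x + INR n).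
Proof.
move=> x0; elim: n => [|n IH]; first by rewrite big_ord0 /= Rplus_0_r; ring.
rewrite big_ord_recr /= IH -/(INR n.+1) S_INR; have := pos_INR n => ?; field; lra.
Qed.

(** A product of 1 + F_i is at least 1 + sum F_i. Since [shp m <= shp k], each denominator is at
    most (x + i)(x + i + 1) with x = [shp k + b], and the sum telescopes. *)
Lemma phi_ratio_lb n m k : (m <= k)%N ->
  phi n k * (1 + b ^ 2 * (INR k - INR m) * (/ (shp k + b) - / (shp k + b + INR n)))
  <= phi n m.
Proof.
move=> mk; rewrite (phi_ratio n m k); apply: Rmult_le_compat_l; first exact/Rlt_le/phi_gt0.
have hk := shp_gt1 k; have hm := shp_gt1 m; have hmk := leR mk.
have hh : shp m <= shp k by rewrite /shp; nra.
have hb : 0 <= b ^ 2 * (INR k - INR m) by nra.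
apply: Rle_trans (rprod_ge_sum _) => [|i]; last first.
  have := pos_INR i => ?; apply: Rmult_le_pos => //.
  by apply/Rlt_le/Rinv_0_lt_compat; apply: Rmult_lt_0_compat; lra.
rewrite -telescope; last lra.
rewrite rsumMl; apply: Rplus_le_compat_l; apply: rsum_le => i.
have := pos_INR i => ?; apply: Rmult_le_compat_l => //.
by apply: Rinv_le_contravar; [apply: Rmult_lt_0_compat; lra|nra].
Qed.

Lemma phi_decr n m k : (m <= k)%N -> phi n k <= phi n m.
Proof.
move=> mk; apply: Rle_trans (phi_ratio_lb n mk).
have hk := shp_gt1 k; have hmk := leR mk; have hn := pos_INR n; have hp := phi_gt0 n k.
have h1 : / (shp k + b + INR n) <= / (shp k + b) by apply: Rinv_le_contravar; lra.
have h2 : 0 <= b ^ 2 * (INR k - INR m) by nra.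
have h3 : 0 <= b ^ 2 * (INR k - INR m) * (/ (shp k + b) - / (shp k + b + INR n)).
  by apply: Rmult_le_pos; lra.
nra.
Qed.

(** Since [shp k] >= b k, every factor is at most 1 + 1/k <= exp(1/k). This will keep the mode small
    compared with n. *)
Lemma phi_ub n k : (0 < k)%N -> phi n k <= exp (INR n / INR k).
Proof.
move=> k0; have hk : 0 < INR k by apply: lt_0_INR; lia.
elim: n => [|n IH].
  by rewrite /phi big_ord0 /Rdiv Rmult_0_l exp_0; lra.
rewrite /phi big_ord_recr /= -/(phi n k) -/(INR n.+1).
have -> : INR n.+1 / INR k = INR n / INR k + / INR k by rewrite S_INR; field; lra.
rewrite exp_plus; have hn := pos_INR n.
have h0 : 0 < shp k + INR n by have := shp_gt1 k; lra.
have h1 : b / (shp k + INR n) <= / INR k.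
  apply: (Rmult_le_reg_r (shp k + INR n)) => //; apply: (Rmult_le_reg_r (INR k)) => //.
  have -> : b / (shp k + INR n) * (shp k + INR n) * INR k = b * INR k by field; lra.
  have -> : / INR k * (shp k + INR n) * INR k = shp k + INR n by field; lra.
  by rewrite /shp; lra.
have h2 : 0 < b / (shp k + INR n) by apply: Rdiv_lt_0_compat.
apply: Rmult_le_compat => //; [exact/Rlt_le/phi_gt0|lra|].
by have := exp_ineq1_le (/ INR k); lra.
Qed.

Lemma rprod_inv_bound n (F : nat -> R) : (forall i, 0 <= F i) ->
  \rsum_(i < n) F i <= 1 -> (\rprod_(i < n) (1 + F i)) * (1 - \rsum_(i < n) F i) <= 1.
Proof.
move=> F0; elim: n => [|n IH]; first by rewrite !big_ord0; lra.
rewrite !big_ord_recr /=; move: IH (rprod_gt0 (n := n) (F := fun i => 1 + F i)).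
move: (rsum_ge0 (n := n) (F := fun i => F i)) => /=.
move: (\big[Rplus/_]_(i < n) _) (\big[Rmult/_]_(i < n) _) => S P h1 h2 h3 h4.
have {}h1 : 0 <= S by apply: h1 => i; exact: F0.
have {}h3 : 0 < P by apply: h3 => i; have := F0 i; lra.
have fn := F0 n; have {}h2 : P * (1 - S) <= 1 by apply: h2; lra.
have : (1 + F n) * (1 - (S + F n)) <= 1 - S by nra.
move=> h; have := Rmult_le_compat_l _ _ _ (Rlt_le _ _ h3) h; lra.
Qed.

(** Bounding a product from above by the reciprocal of 1 - sum, where the sum telescopes to at most
    b/m, limits the drop of [phi] in one step. At the mode this keeps [a * phi n m - m] bounded. *)
Lemma phi_consec n m : b < INR m -> phi n m * (1 - b / INR m) <= phi n m.+1.
Proof.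
move=> bm; rewrite (phi_ratio n m m.+1) Rmult_assoc.
have m0 : 0 < INR m by lra.
set F := fun i : nat => b ^ 2 * (INR m.+1 - INR m) / ((shp m + INR i) * (shp m.+1 + b + INR i)).
have hm := shp_gt1 m; have hm' : shp m - 1 = b / 2 + b * INR m by rewrite /shp; lra.
have F0 i : 0 <= F i.
  rewrite /F S_INR; have := pos_INR i => ?; apply: Rmult_le_pos; first nra.
  by apply/Rlt_le/Rinv_0_lt_compat; rewrite shpS; nra.
have hS : \rsum_(i < n) F i <= b / INR m.
  apply: (Rle_trans _ (b ^ 2 * \rsum_(i < n) (/ ((shp m - 1 + INR i) * (shp m - 1 + INR i + 1))))).
    rewrite rsumMl; apply: rsum_le => i; rewrite /F S_INR; have := pos_INR i => hi.
    rewrite (_ : b ^ 2 * (INR m + 1 - INR m) = b ^ 2); last ring.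
    apply: Rmult_le_compat_l; first nra.
    apply: Rinv_le_contravar; first by apply: Rmult_lt_0_compat; nra.
    by rewrite shpS; apply: Rle_trans (Rmult_le_compat _ _ _ _ _ _ _ _) (Rle_refl _); try nra.
  have hx : 0 < shp m - 1 by nra.
  rewrite telescope //.
  have h1 : 0 < / (shp m - 1 + INR n) by apply: Rinv_0_lt_compat; have := pos_INR n; lra.
  have h2 : / (shp m - 1) <= / (b * INR m) by apply: Rinv_le_contravar; nra.
  have -> : b / INR m = b ^ 2 * / (b * INR m) by field; lra.
  by apply: Rmult_le_compat_l; nra.
have bm1 : b / INR m <= 1 by apply: (Rmult_le_reg_r (INR m)) => //; field_simplify; lra.
have := rprod_inv_bound F0 (Rle_trans _ _ _ hS bm1).
have := rprod_gt0 (n := n) (F := fun i => 1 + F i).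
move: hS; rewrite /F; move: (\big[Rplus/_]_(i < n) _) (\big[Rmult/_]_(i < n) _) => S P hS.
move=> h; have {}h : 0 < P by apply: h => i; have := F0 i; rewrite /F; lra.
move=> h2; rewrite -[X in _ <= X]Rmult_1_r; apply: Rmult_le_compat_l; first exact/Rlt_le/phi_gt0.
by apply: Rle_trans h2; apply: Rmult_le_compat_l; lra.
Qed.

End Coefficients.

(** * Drift of the mixing index *)

Section Drift.
Variables a b : R.
Hypotheses (a0 : 0 < a) (b0 : 0 < b).
Variables (n m : nat) (eps : R).
Let lam := a * phi b n m.
(** An upper bound for [shp b k + b] on the window k <= (1 + eps) m; [tau] below is the relative
    slope of [phi] guaranteed there. *)
Let X := b * INR m * (1 + 2 * eps).
Hypotheses (e0 : 0 < eps) (e1 : 12 * (b + 1) * (b + 3) * eps = 1).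
Hypotheses (mlam : INR m <= lam) (mbig : 3 * b / 2 + 1 <= b * eps * INR m).
Hypothesis nbig : X <= eps * INR n.

Let m0 : 0 < INR m.
Proof.
have be : 0 < b * eps by apply: Rmult_lt_0_compat.
by apply: (Rmult_lt_reg_l (b * eps)) => //; lra.
Qed.

Let tau := b * (1 - eps) / (INR m * (1 + 2 * eps)).

Let esmall : eps <= 1 / 36.
Proof.
have h : 36 <= 12 * (b + 1) * (b + 3) by have := Rmult_lt_0_compat _ _ b0 b0; lra.
have : 36 * eps <= 12 * (b + 1) * (b + 3) * eps by apply: Rmult_le_compat_r; lra.
lra.
Qed.

Lemma gap_lb k : shp b k + b <= X ->
  tau <= b ^ 2 * (/ (shp b k + b) - / (shp b k + b + INR n)).
Proof.
move=> hX; set x := _ + b in hX *; have x0 : 0 < x by have := shp_gt1 b0 k; rewrite /x; lra.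
have X0 : 0 < X by lra.
have n0 : 0 < INR n by nra.
have -> : tau = b ^ 2 * ((1 - eps) / X) by rewrite /tau /X; field; split; lra.
apply: Rmult_le_compat_l; first nra.
have -> : / x - / (x + INR n) = INR n / (x * (x + INR n)) by field; split; lra.
apply: (Rmult_le_reg_r (X * (x * (x + INR n)))).
  by apply: Rmult_lt_0_compat => //; apply: Rmult_lt_0_compat; lra.
have -> : (1 - eps) / X * (X * (x * (x + INR n))) = x * ((1 - eps) * (x + INR n)) by field; lra.
have -> : INR n / (x * (x + INR n)) * (X * (x * (x + INR n))) = X * INR n by field; split; lra.
apply: Rmult_le_compat; try nra.
Qed.

Let D (k : nat) := INR k - INR m.

(** The right side is [b] less about b (b + 3) eps, and the normalisation [e1] of [eps] makes this
    at most 1/12. The divisor 1 + b eps is the loss from inverting 1 + tau D in [drift_above]. *)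
Let btau : b - 1 / 12 <= INR m * tau / (1 + b * eps).
Proof.
have -> : INR m * tau / (1 + b * eps) = b * (1 - eps) / ((1 + 2 * eps) * (1 + b * eps)).
  by rewrite /tau; field; split; nra.
apply: (Rmult_le_reg_r ((1 + 2 * eps) * (1 + b * eps))); first nra.
have -> : b * (1 - eps) / ((1 + 2 * eps) * (1 + b * eps)) * ((1 + 2 * eps) * (1 + b * eps)) = b * (1 - eps).
  by field; split; nra.
have h : b * (b + 3) * eps <= 1 / 12 by nra.
have h2 : 0 < (b + 3) * eps by nra.
have : (b - b * (b + 3) * eps) * ((1 + 2 * eps) * (1 + b * eps)) <= b * (1 - eps).
  have -> : (b - b * (b + 3) * eps) * ((1 + 2 * eps) * (1 + b * eps)) =
     b * (1 - eps - eps * eps * (b * b + 3 * b + 6) - 2 * b * (b + 3) * eps * eps * eps) by ring.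
  apply: Rmult_le_compat_l; first lra.
  have : 0 <= eps * eps * (b * b + 3 * b + 6) by nra.
  have : 0 <= 2 * b * (b + 3) * eps * eps * eps.
    by repeat apply: Rmult_le_pos; lra.
  lra.
have : 0 < (1 + 2 * eps) * (1 + b * eps) by nra.
nra.
Qed.

Let mtau : b - 1 / 12 <= INR m * tau.
Proof.
have t0 : 0 < tau by rewrite /tau; apply: Rdiv_lt_0_compat; nra.
apply: Rle_trans btau _.
have h : 0 < INR m * tau by nra.
apply: (Rmult_le_reg_r (1 + b * eps)); first nra.
have -> : INR m * tau / (1 + b * eps) * (1 + b * eps) = INR m * tau by field; nra.
nra.
Qed.

Lemma drift_below k : (k < m)%N -> (b - 1 / 12) * - D k <= a * phi b n k - lam.
Proof.
move=> km; have hm : INR k < INR m by apply: ltR.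
have hX : shp b m + b <= X by rewrite /shp /X; nra.
have := phi_ratio_lb b0 n (ltnW km); have := gap_lb hX.
move: (_ - / (shp b m + b + INR n)) => g hg h; rewrite /lam.
have hp := phi_gt0 b0 n m.
have h1 : INR m * tau * - D k <= a * phi b n m * (b ^ 2 * g) * - D k.
  apply: Rmult_le_compat_r; first by rewrite /D; lra.
  apply: Rmult_le_compat => //; [lra|].
  by rewrite /tau; apply/Rlt_le/Rdiv_lt_0_compat; nra.
have h2 : (b - 1 / 12) * - D k <= INR m * tau * - D k.
  by apply: Rmult_le_compat_r => //; rewrite /D; lra.
have : a * (phi b n m * (1 + b ^ 2 * (INR m - INR k) * g)) <= a * phi b n k.
  by apply: Rmult_le_compat_l; lra.
by move: h1 h2; rewrite /D => *; lra.
Qed.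

(** Here the slope bound is applied at k, not at [m]: this needs k inside the window and yields
    lam/(1 + tau D) instead of a linear bound; tau D <= b eps restores linearity. *)
Lemma drift_above k : (m < k)%N -> D k <= eps * INR m ->
  (b - 1 / 12) * D k <= lam - a * phi b n k.
Proof.
move=> km hD; have hm : INR m < INR k by apply: ltR.
have hX : shp b k + b <= X by move: hD; rewrite /D /shp /X; nra.
have := phi_ratio_lb b0 n (ltnW km); have := gap_lb hX.
move: (_ - / (shp b k + b + INR n)) => g hg h.
have hp := phi_gt0 b0 n k.
have t0 : 0 < tau by rewrite /tau; apply: Rdiv_lt_0_compat; nra.
have D0 : 0 < D k by rewrite /D; lra.
have tD : tau * D k <= b * eps.
  apply: Rle_trans (Rmult_le_compat_l _ _ _ (Rlt_le _ _ t0) hD) _.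
  have -> : tau * (eps * INR m) = b * eps * ((1 - eps) / (1 + 2 * eps)) by rewrite /tau; field; lra.
  rewrite -[X in _ <= X]Rmult_1_r; apply: Rmult_le_compat_l; first nra.
  by apply: (Rmult_le_reg_r (1 + 2 * eps)); first lra; field_simplify; lra.
have h1 : a * phi b n k * (1 + tau * D k) <= lam.
  rewrite /lam; apply: (Rle_trans _ (a * (phi b n k * (1 + b ^ 2 * (INR k - INR m) * g)))).
    rewrite Rmult_assoc; apply: Rmult_le_compat_l; first lra.
    apply: Rmult_le_compat_l; first lra.
    by rewrite -/(D k); nra.
  by apply: Rmult_le_compat_l; lra.
have td0 : 0 < tau * D k by nra.
have h2 : a * phi b n k <= lam / (1 + tau * D k).
  apply: (Rmult_le_reg_r (1 + tau * D k)); first lra.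
  by have -> : lam / (1 + tau * D k) * (1 + tau * D k) = lam by field; lra.
have h3 : INR m * (tau * D k) / (1 + b * eps) <= lam * (tau * D k) / (1 + tau * D k).
  apply: Rmult_le_compat; try nra.
    by apply/Rlt_le/Rinv_0_lt_compat; nra.
  by apply: Rinv_le_contravar; lra.
have h6 : INR m * (tau * D k) / (1 + b * eps) = (INR m * tau / (1 + b * eps)) * D k.
  by field; nra.
have h4 : (b - 1 / 12) * D k <= (INR m * tau / (1 + b * eps)) * D k.
  by apply: Rmult_le_compat_r; lra.
have h5 : lam / (1 + tau * D k) = lam - lam * (tau * D k) / (1 + tau * D k) by field; lra.
lra.
Qed.

Lemma drift_signed k : 0 <= (lam - a * phi b n k) * D k.
Proof.
case: (leqP k m) => km.
  have := phi_decr b0 n km; have := leR km; rewrite /lam /D => h1 h2.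
  have : a * phi b n m <= a * phi b n k by apply: Rmult_le_compat_l; lra.
  nra.
have := phi_decr b0 n (ltnW km); have := ltR km; rewrite /lam /D => h1 h2.
have : a * phi b n k <= a * phi b n m by apply: Rmult_le_compat_l; lra.
nra.
Qed.

(** The term of Stein's identity for f = D, where f(k+1) = D + 1. Below [m] and inside the window
    the slope b - 1/12 is available, and giving up another 1/12 pays for the linear term. Past the
    window only the sign is known, but there D^2 <= D^4 / (eps m)^2. *)
Lemma drift k : (a * phi b n k - lam) * (D k + 1) <=
  - (b - 1 / 6) * D k ^ 2 + 3 * (b + 1) ^ 2 + b * (D k ^ 4 / (eps * INR m) ^ 2).
Proof.
have em : 0 < eps * INR m by nra.
have q0 : 0 <= b * (D k ^ 4 / (eps * INR m) ^ 2).
  apply: Rmult_le_pos; first lra.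
  by apply: Rmult_le_pos; [nra|apply/Rlt_le/Rinv_0_lt_compat; nra].
case: (ltngtP k m) => km.
- have hb := drift_below km.
  have h : D k <= -1 by have := leR km; rewrite S_INR /D; lra.
  move: q0; set q := b * (D k ^ 4 / _); move: q => q q0.
  move: (a * phi b n k - lam) (D k) hb h => A d hb h.
  have h1 : A * (d + 1) <= (b - 1 / 12) * - d * (d + 1) by nra.
  have h2 : - (b - 1 / 12) * d <= 1 / 12 * d ^ 2 + 3 * (b - 1 / 12) ^ 2.
    by have := pow2_ge_0 (d / 6 + (b - 1 / 12)); nra.
  by have h3 : (b - 1 / 12) ^ 2 <= (b + 1) ^ 2; nra.
- have h0 : 1 <= D k by have := leR km; rewrite S_INR /D; lra.
  case: (Rle_lt_dec (D k) (eps * INR m)) => hD.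
    have := drift_above km hD; nra.
  have h := drift_signed k.
  have h1 : (a * phi b n k - lam) * (D k + 1) <= 0.
    have : 0 <= lam - a * phi b n k by apply: (Rmult_le_reg_r (D k)); lra.
    nra.
  have h2 : D k ^ 2 <= D k ^ 4 / (eps * INR m) ^ 2.
    apply: (Rmult_le_reg_r ((eps * INR m) ^ 2)); first nra.
    have -> : D k ^ 4 / (eps * INR m) ^ 2 * (eps * INR m) ^ 2 = D k ^ 2 * D k ^ 2 by field; nra.
    by apply: Rmult_le_compat_l; nra.
  nra.
- rewrite km -/lam in q0 *; have -> : D m = 0 by rewrite /D; ring.
  have -> : 0 ^ 4 = 0 by ring.
  rewrite /Rdiv !Rmult_0_l Rmult_0_r; nra.
Qed.

(** The same term for f = D^3, of which only the sign is needed: D is an integer, so (D + 1)^3 is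
    nonpositive below [m] and positive above it. *)
Lemma drift3 k : (a * phi b n k - lam) * (D k + 1) ^ 3 <= 0.
Proof.
have h := drift_signed k.
case: (ltngtP k m) => km.
- have h0 : D k <= -1 by have := leR km; rewrite S_INR /D; lra.
  have : 0 <= a * phi b n k - lam by nra.
  have : (D k + 1) ^ 3 <= 0.
    have -> : (D k + 1) ^ 3 = - ((- D k - 1) ^ 3) by ring.
    by have := pow_le (- D k - 1) 3; lra.
  nra.
- have h0 : 1 <= D k by have := leR km; rewrite S_INR /D; lra.
  have : 0 <= lam - a * phi b n k by nra.
  have := pow_le (D k + 1) 3; nra.
- by rewrite km -/lam; lra.
Qed.

End Drift.

(** * Log-concavity of the rows truncated in k *)

Section TruncatedLogConcavity.
Variables a b : R.
Hypotheses (a0 : 0 < a) (b0 : 0 < b).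

(** [L0] will bound [lam - m] at the mode. The factor [A1] of the test function lies strictly
    between b/(1 + b) and 1: above the former, so that the Stein bound covers b D^2 despite the
    losses in slope; below 1, so that (1 - A1) m is left to absorb all constants. *)
Let L0 := 2 * (1 + b).
Let eps := / (12 * (b + 1) * (b + 3)).
Let A1 := (b + 1 / 2) / (1 + b).

Let den0 : 0 < 12 * (b + 1) * (b + 3).
Proof. by apply: Rmult_lt_0_compat; lra. Qed.

Let eps0 : 0 < eps.
Proof. exact: Rinv_0_lt_compat. Qed.

Let epsE : 12 * (b + 1) * (b + 3) * eps = 1.
Proof. by rewrite /eps; field; split; lra. Qed.

Let A1b : 0 < A1 < 1 /\ b + 1 / 4 <= A1 * (b + 3 / 4).
Proof.
have h : A1 * (1 + b) = b + 1 / 2 by rewrite /A1; field; lra.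
have h0 : 0 < A1 by apply: Rdiv_lt_0_compat; lra.
split; first by split => //; nra.
nra.
Qed.

(* The Stein test function will be [A1 * D + A1 * q * D ^ 3]; its cubic part absorbs the
   quartic loss in [drift] far from the mode. *)
Lemma quartic_bound (q L lam m D : R) : 0 <= q -> 0 <= L <= L0 -> 0 <= lam -> lam = m + L ->
  q * (L ^ 2 / 2 + 5 * lam) <= 1 / 12 -> 3 * q * lam <= 1 ->
  (1 + L0) ^ 2 + 3 * (b + 1) ^ 2 + L0 + 1 <= m * (1 - A1) ->
  b * D ^ 2 - (m + D) - 1 / 2 <=
  A1 * (D ^ 2 - L * D + (b - 1 / 6) * D ^ 2 - 3 * (b + 1) ^ 2 - q / 2 * D ^ 4 - lam)
  + A1 * q * (D ^ 4 - L * D ^ 3 - lam * (3 * D ^ 2 + 3 * D + 1)).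
Proof.
move=> q0 hL lam0 lamE hq1 hq2 hm; have [hA1 hA2] := A1b.
have h1 : L * D ^ 3 <= D ^ 4 / 2 + L ^ 2 / 2 * D ^ 2 by have := pow2_ge_0 (D ^ 2 - L * D); nra.
have h2 : lam * (3 * D ^ 2 + 3 * D + 1) <= lam * (5 * D ^ 2 + 3).
  by apply: Rmult_le_compat_l => //; have := pow2_ge_0 (D - 1); nra.
have h3 : q * (L ^ 2 / 2 * D ^ 2 + lam * (5 * D ^ 2 + 3)) <= 1 / 12 * D ^ 2 + 1.
  have -> : q * (L ^ 2 / 2 * D ^ 2 + lam * (5 * D ^ 2 + 3)) =
    q * (L ^ 2 / 2 + 5 * lam) * D ^ 2 + 3 * q * lam by ring.
  by have := Rmult_le_compat_r (D ^ 2) _ _ (pow2_ge_0 D) hq1; lra.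
have h4 : - (q * (L ^ 2 / 2 * D ^ 2 + lam * (5 * D ^ 2 + 3))) <=
    - (q / 2 * D ^ 4) + q * (D ^ 4 - L * D ^ 3 - lam * (3 * D ^ 2 + 3 * D + 1)).
  have := Rmult_le_compat_l _ _ _ q0 h1; have := Rmult_le_compat_l _ _ _ q0 h2; lra.
have h5 : (b + 3 / 4) * D ^ 2 - L * D - 3 * (b + 1) ^ 2 - 1 - lam <=
   (D ^ 2 - L * D + (b - 1 / 6) * D ^ 2 - 3 * (b + 1) ^ 2 - q / 2 * D ^ 4 - lam)
  + q * (D ^ 4 - L * D ^ 3 - lam * (3 * D ^ 2 + 3 * D + 1)) by lra.
have {}h5 := Rmult_le_compat_l A1 _ _ (Rlt_le _ _ hA1.1) h5.
rewrite Rmult_assoc -Rmult_plus_distr_l.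
apply: Rle_trans h5.
have h6 : 0 <= (A1 * (b + 3 / 4) - b - 1 / 4) * D ^ 2 by apply: Rmult_le_pos; [lra|exact: pow2_ge_0].
have hAL : -(1 + L0) <= 1 - A1 * L <= 1 + L0 by split; nra.
have h7 : - (D ^ 2 / 4) - (1 + L0) ^ 2 <= (1 - A1 * L) * D.
  have : (1 - A1 * L) ^ 2 <= (1 + L0) ^ 2 by nra.
  have := pow2_ge_0 (D / 2 + (1 - A1 * L)); nra.
have h8 : A1 * (3 * (b + 1) ^ 2 + 1 + L) <= 3 * (b + 1) ^ 2 + 1 + L0.
  rewrite -[X in _ <= X]Rmult_1_l; apply: Rmult_le_compat; try lra; have := pow2_ge_0 (b + 1); lra.
rewrite lamE; lra.
Qed.

Definition row (K n : nat) : R := \rsum_(k < K) wgt a b n k.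

Lemma row_gt0 K n : (0 < K)%N -> 0 < row K n.
Proof.
case: K => // K _; rewrite /row big_ord_recr; apply: Rplus_le_lt_0_compat; last exact: wgt_gt0.
by apply: rsum_ge0 => i; apply/Rlt_le/wgt_gt0.
Qed.

(* Log-concavity at [n] amounts to [b * Var(k) <= E(k) + 1/2] under the weights [wgt n]. *)
Lemma row_log_concave K n m :
  \rsum_(k < K) ((b * (INR k - INR m) ^ 2 - INR k - 1 / 2) * wgt a b n k) <= 0 ->
  row K n * row K n.+2 <= row K n.+1 ^ 2.
Proof.
move=> hV.
set S0 := row K n; set S1 := \rsum_(k < K) ((INR k - INR m) * wgt a b n k).
set S2 := \rsum_(k < K) ((INR k - INR m) ^ 2 * wgt a b n k).
have w0 k := Rlt_le _ _ (wgt_gt0 a0 b0 n k).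
have S00 : 0 <= S0 by apply: rsum_ge0 => i.
have S20 : 0 <= S2 by apply: rsum_ge0 => i; apply: Rmult_le_pos => //; exact: pow2_ge_0.
have hn := pos_INR n.
(* [y + b * (k - m)] is [shp b k + n], so the next two rows are combinations of [S0], [S1], [S2]. *)
set y := b / 2 + 1 + b * INR m + INR n.
have {}hV : b * S2 <= INR m * S0 + S1 + S0 / 2.
  suff : b * S2 + (-1) * S1 + (- (INR m + 1 / 2)) * S0 <= 0 by lra.
  rewrite /S0 /S1 /S2 /row !rsumMl -!rsumD; apply: Rle_trans (Req_le _ _ _) hV.
  by apply: eq_bigr => k _ /=; ring.
have T1 : row K n.+1 = (y * S0 + b * S1) / (INR n + 1).
  rewrite /Rdiv /S0 /S1 /row !rsumMl -!rsumD rsumMr; apply: eq_bigr => k _.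
  by rewrite wgt_row /y /shp; field; lra.
have T2 : row K n.+2 = (y * (y + 1) * S0 + b * (2 * y + 1) * S1 + b ^ 2 * S2)
    / ((INR n + 1) * (INR n + 2)).
  rewrite /Rdiv /S0 /S1 /S2 /row !rsumMl -!rsumD rsumMr; apply: eq_bigr => k _.
  by rewrite !wgt_row S_INR /y /shp; field; lra.
rewrite T1 T2.
set U := y * S0 + b * S1.
(* As y - (n + 1) = b/2 + b m, the shift b/2 + 1 in [shp] is what produces the 1/2 of the variance
   condition. *)
have hU : U - (INR n + 1) * S0 = b * (INR m * S0 + S1 + S0 / 2) by rewrite /U /y; field.
apply: (Rmult_le_reg_r ((INR n + 1) ^ 2 * (INR n + 2))).
  by apply: Rmult_lt_0_compat; nra.
set Z := (_ + b ^ 2 * S2).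
have -> : S0 * (Z / ((INR n + 1) * (INR n + 2))) * ((INR n + 1) ^ 2 * (INR n + 2)) =
   (INR n + 1) * (S0 * Z) by field; lra.
have -> : (U / (INR n + 1)) ^ 2 * ((INR n + 1) ^ 2 * (INR n + 2)) = (INR n + 2) * U ^ 2.
  by field; lra.
have -> : S0 * Z = U ^ 2 + S0 * U + b ^ 2 * (S0 * S2 - S1 ^ 2) by rewrite /Z /U; ring.
have h1 : b * (b * S2) <= U - (INR n + 1) * S0 by rewrite hU; apply: Rmult_le_compat_l; lra.
have bS : 0 <= b * (b * S2) by repeat apply: Rmult_le_pos; lra.
have h2 : (INR n + 1) * S0 * (b * (b * S2)) <= U * (U - (INR n + 1) * S0).
  have p0 : 0 <= (INR n + 1) * S0 by apply: Rmult_le_pos; lra.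
  by apply: Rmult_le_compat; lra.
have h3 : 0 <= (INR n + 1) * b ^ 2 * S1 ^ 2.
  apply: Rmult_le_pos; last exact: pow2_ge_0.
  by apply: Rmult_le_pos; [lra|exact: pow2_ge_0].
lra.
Qed.

(** For fixed k the product dominates b times a harmonic sum, hence grows at least like b ln n. So
    the mode passes any given [M]. *)
Lemma phi_unbounded M : exists N, forall n, (N <= n)%N -> INR M <= a * phi b n M.
Proof.
set s := shp b M; have s1 : 1 < s by apply: shp_gt1.
pose x := s * exp (INR M / (a * b)).
have [N hN] := INR_unbounded x; exists N => n Nn.
have hx : x < INR n by have := leR Nn; lra.
have harm j : ln (s + INR j) - ln s <= \rsum_(i < j) (/ (s + INR i)).
  elim: j => [|j IH]; first by rewrite big_ord0 /= Rplus_0_r; lra.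
  rewrite big_ord_recr /= -/(INR j.+1) S_INR; have hj := pos_INR j.
  have h : ln (s + (INR j + 1)) - ln (s + INR j) <= / (s + INR j).
    rewrite -ln_div; [|lra|lra].
    have -> : (s + (INR j + 1)) / (s + INR j) = 1 + / (s + INR j) by field; lra.
    have p : 0 < / (s + INR j) by apply: Rinv_0_lt_compat; lra.
    rewrite -[X in _ <= X]ln_exp; apply: ln_le; first lra.
    exact: exp_ineq1_le.
  by apply: Rle_trans (Rplus_le_compat _ _ _ _ IH h); lra.
have hl : INR M / (a * b) <= ln (s + INR n) - ln s.
  have xs : ln x = ln s + INR M / (a * b).
    by rewrite /x ln_mult ?ln_exp //; [lra|exact: exp_pos].
  have : ln x <= ln (s + INR n).
    by apply: ln_le; [apply: Rmult_lt_0_compat; [lra|exact: exp_pos]|lra].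
  lra.
have h : 1 + \rsum_(i < n) (b / (s + INR i)) <= phi b n M.
  apply: rprod_ge_sum => i; apply/Rlt_le/Rdiv_lt_0_compat => //; have := pos_INR i; lra.
have h2 : b * (INR M / (a * b)) <= \rsum_(i < n) (b / (s + INR i)).
  rewrite -rsumMl; apply: Rmult_le_compat_l; first lra.
  by apply: Rle_trans hl (harm n).
have -> : INR M = a * (b * (INR M / (a * b))) by field; lra.
by apply: Rmult_le_compat_l; lra.
Qed.

(** Take the last k with k <= a phi(k); since [phi] decreases in k, such k are bounded. *)
Lemma mode_exists M n : INR M <= a * phi b n M ->
  exists m, [/\ (M <= m)%N, INR m <= a * phi b n m & a * phi b n m.+1 <= INR m.+1].
Proof.
move=> hM; pose P k := if Rle_dec (INR k) (a * phi b n k) then true else false.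
have exP : exists k, P k by exists M; rewrite /P; case: Rle_dec.
have [B hB] := INR_unbounded (a * phi b n 0).
have bnd k : P k -> (k <= B)%N.
  rewrite /P; case: Rle_dec => // h _; apply/ltnW; apply/ltP; apply: INR_lt.
  have : a * phi b n k <= a * phi b n 0.
    by apply: Rmult_le_compat_l; [lra|exact: phi_decr].
  lra.
case: (ex_maxnP exP bnd) => m Pm hmax; exists m; split.
- by apply: hmax; rewrite /P; case: Rle_dec.
- by move: Pm; rewrite /P; case: Rle_dec.
- case: (Rle_lt_dec (a * phi b n m.+1) (INR m.+1)) => // h.
  have : P m.+1 by rewrite /P; case: Rle_dec => // *; lra.
  by move/hmax; rewrite ltnn.
Qed.

Lemma row_eventually_log_concave : exists N, forall n, (N <= n)%N ->
  exists K0, forall K, (K0 <= K)%N -> row K n * row K n.+2 <= row K n.+1 ^ 2.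
Proof.
have [hA1 hA2] := A1b.
(* These thresholds make [m] large enough for, in this order, [mbig], the smallness of [q], and the
   slack required by [quartic_bound]. *)
pose c1 := (3 * b / 2 + 1) / (b * eps).
pose c2 := 24 * b * (L0 / 2 + 10) / eps ^ 2.
pose c3 := ((1 + L0) ^ 2 + 3 * (b + 1) ^ 2 + L0 + 1) / (1 - A1).
have L00 : 0 < L0 by rewrite /L0; lra.
have be : 0 < b * eps by nra.
have c10 : 0 < c1 by apply: Rdiv_lt_0_compat; lra.
have c20 : 0 < c2 by apply: Rdiv_lt_0_compat; nra.
have c30 : 0 < c3 by apply: Rdiv_lt_0_compat; nra.
have [M hM] := INR_unbounded (c1 + c2 + c3 + L0 + 2 * b + 1).
have [N1 hN1] := phi_unbounded M.
(* [C] enforces [nbig]: if n were below C m, then phi(m) <= exp C by [phi_ub], so [m], and with it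
   n, would be bounded. *)
pose C := b * (1 + 2 * eps) / eps + 1.
have C0 : 0 < C by have : 0 < b * (1 + 2 * eps) / eps; [apply: Rdiv_lt_0_compat; nra|rewrite /C; lra].
have [N2 hN2] := INR_unbounded (C * (a * exp C)).
exists (maxn N1 N2) => n; rewrite geq_max => /andP[n1 n2].
have [m [Mm mlam mS]] := mode_exists (hN1 n n1).
have hm : c1 + c2 + c3 + L0 + 2 * b + 1 < INR m by have := leR Mm; lra.
have m0 : 0 < INR m by lra.
have mn : (0 < m)%N by apply/ltP/INR_lt.
have nbig : b * INR m * (1 + 2 * eps) <= eps * INR n.
  have hCm : C * INR m <= INR n.
    case: (Rle_lt_dec (C * INR m) (INR n)) => // h; exfalso.
    have h1 : phi b n m <= exp C.
      apply: Rle_trans (phi_ub b0 n mn) _.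
      apply: exp_le_compat; apply: (Rmult_le_reg_r (INR m)) => //.
      have -> : INR n / INR m * INR m = INR n by field; lra.
      lra.
    have h2 : INR m <= a * exp C.
      by apply: Rle_trans mlam _; apply: Rmult_le_compat_l; lra.
    have h3 : C * INR m <= C * (a * exp C) by apply: Rmult_le_compat_l; lra.
    have := leR n2; lra.
  have -> : b * INR m * (1 + 2 * eps) = eps * ((C - 1) * INR m) by rewrite /C; field; lra.
  by apply: Rmult_le_compat_l; lra.
set lam := a * phi b n m in mlam.
(* Maximality of [m] gives a phi(m+1) <= m + 1, and [phi_consec] carries this back to [m] at the
   cost of a factor 1 - b/m. *)
have lamub : lam <= INR m + L0.
  have hb : b < INR m by lra.
  have h := phi_consec b0 n hb.
  have h1 : lam * (1 - b / INR m) <= INR m + 1.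
    move: mS; rewrite S_INR => mS; apply: Rle_trans mS.
    by rewrite /lam Rmult_assoc; apply: Rmult_le_compat_l; lra.
  have h2 : lam * (INR m - b) <= (INR m + 1) * INR m.
    have -> : lam * (INR m - b) = lam * (1 - b / INR m) * INR m by field; lra.
    by apply: Rmult_le_compat_r; lra.
  apply: (Rmult_le_reg_r (INR m - b)); first lra.
  apply: Rle_trans h2 _; rewrite /L0; nra.
have mbig : 3 * b / 2 + 1 <= b * eps * INR m.
  have -> : 3 * b / 2 + 1 = b * eps * c1 by rewrite /c1; field; lra.
  by apply: Rmult_le_compat_l; lra.
(* Chosen so that q/2 D^4 is the quartic loss in [drift]. *)
pose q := 2 * b / (eps * INR m) ^ 2.
have em : 0 < eps * INR m by nra.
have q0 : 0 < q by apply: Rdiv_lt_0_compat; nra.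
have qm : q * INR m * INR m = 2 * b / eps ^ 2 by rewrite /q; field; lra.
have qm' : q * INR m * (12 * (L0 / 2 + 10)) <= 1.
  apply: (Rmult_le_reg_r (INR m)) => //.
  have -> : q * INR m * (12 * (L0 / 2 + 10)) * INR m = c2.
    by rewrite (_ : _ * INR m = q * INR m * INR m * (12 * (L0 / 2 + 10))); [rewrite qm /c2; field; lra|ring].
  lra.
have hc3 : (1 + L0) ^ 2 + 3 * (b + 1) ^ 2 + L0 + 1 <= INR m * (1 - A1).
  have -> : (1 + L0) ^ 2 + 3 * (b + 1) ^ 2 + L0 + 1 = c3 * (1 - A1) by rewrite /c3; field; lra.
  by apply: Rmult_le_compat_r; lra.
exists m.+1 => K mK; apply: (@row_log_concave K n m).
pose D (k : nat) := INR k - INR m.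
pose f (k : nat) := A1 * D k + A1 * q * D k ^ 3.
have Aq : 0 < A1 * q by apply: Rmult_lt_0_compat; lra.
have fK : 0 <= f K.
  have DK : 0 <= D K by have := leR (ltnW mK); rewrite /D; lra.
  by have := pow_le _ 3 DK; rewrite /f; nra.
have : - (INR K * f K * wgt a b n K) <= 0.
  have := wgt_gt0 a0 b0 n K => hw.
  suff : 0 <= INR K * f K * wgt a b n K by lra.
  by apply: Rmult_le_pos; [apply: Rmult_le_pos => //; exact: pos_INR|lra].
rewrite -stein //; apply: Rle_trans; apply: rsum_le => k.
apply: Rmult_le_compat_r; first exact/Rlt_le/wgt_gt0.
have hd := drift a0 b0 eps0 epsE mlam mbig nbig k; rewrite -/lam -/(D k) in hd.
have hd3 := drift3 a0 b0 n m k; rewrite -/lam -/(D k) in hd3.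
have DS : D k.+1 = D k + 1 by rewrite /D S_INR; ring.
have kE : INR k = INR m + D k by rewrite /D; ring.
have hq : b * (D k ^ 4 / (eps * INR m) ^ 2) = q / 2 * D k ^ 4 by rewrite /q; field; lra.
rewrite hq in hd.
have Lb : 0 <= lam - INR m <= L0 by lra.
have hq1 : q * ((lam - INR m) ^ 2 / 2 + 5 * lam) <= 1 / 12.
  apply: (Rle_trans _ (q * INR m * (L0 / 2 + 10))); last lra.
  rewrite Rmult_assoc; apply: Rmult_le_compat_l; first lra.
  have : (lam - INR m) ^ 2 <= INR m * L0.
    by rewrite /= Rmult_1_r; apply: Rmult_le_compat; lra.
  nra.
have hq2 : 3 * q * lam <= 1.
  have : q * INR m * 72 <= q * INR m * (12 * (L0 / 2 + 10)).
    by apply: Rmult_le_compat_l; [apply: Rmult_le_pos; lra|lra].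
  have : q * lam <= q * (2 * INR m) by apply: Rmult_le_compat_l; lra.
  lra.
have lam0 : 0 <= lam by lra.
have lamE : lam = INR m + (lam - INR m) by ring.
have H := quartic_bound (D k) (Rlt_le _ _ q0) Lb lam0 lamE hq1 hq2 hc3.
have h1 := Rmult_le_compat_l A1 _ _ (Rlt_le _ _ hA1.1) hd.
have h2 := Rmult_le_compat_l (A1 * q) _ _ (Rlt_le _ _ Aq) hd3.
rewrite /f DS -/(D k) kE; lra.
Qed.

End TruncatedLogConcavity.

(** * Power series *)

Lemma lim_ext (u v : nat -> R) (l : Rbar) :
  is_lim_seq u l -> (forall n, u n = v n) -> is_lim_seq v l.
Proof. by move=> h e; apply: is_lim_seq_ext h. Qed.

Definition rser (f : nat -> R) (l : R) : Prop :=
  is_lim_seq (fun N => \rsum_(i < N) f i) l.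

Lemma rser_is_series f l : rser f l <-> is_series f l.
Proof.
change (is_series f l) with (is_lim_seq (sum_n f) l); rewrite /rser; split => h.
  have h' := (is_lim_seq_incr_1 _ _).1 h.
  by apply: (is_lim_seq_ext _ _ _ _ h') => n; rewrite sum_n_rsum.
apply/is_lim_seq_incr_1; apply: (is_lim_seq_ext _ _ _ _ h) => n; exact: sum_n_rsum.
Qed.

Lemma rser_le f l N : (forall n, 0 <= f n) -> rser f l -> \rsum_(i < N) f i <= l.
Proof.
move=> f0 h; apply: (is_lim_seq_incr_compare _ _ h) => n.
by rewrite big_ord_recr /=; have := f0 n; lra.
Qed.

Lemma lim_rsum n (F : nat -> nat -> R) (l : nat -> R) :
  (forall i, is_lim_seq (F^~ i) (l i)) ->
  is_lim_seq (fun N => \rsum_(i < n) F N i) (\rsum_(i < n) l i).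
Proof.
move=> h; elim: n => [|n IH].
  by apply: (is_lim_seq_ext (fun=> 0)) => [N|]; rewrite big_ord0 //; apply: is_lim_seq_const.
rewrite big_ord_recr /=; apply: (is_lim_seq_ext _ _ _ _ (is_lim_seq_plus' _ _ _ _ IH (h n))) => N.
by rewrite big_ord_recr.
Qed.

(** Finite rectangles are bounded by [v], so the sums over k converge; and a rectangle close to [v]
    bounds the partial sums of [T] from below. *)
Lemma fubini_nonneg (u : nat -> nat -> R) V v : (forall k n, 0 <= u k n) ->
  (forall k, rser (u k) (V k)) -> rser V v ->
  exists T, (forall n, rser (u^~ n) (T n)) /\ rser T v.
Proof.
move=> u0 hV hv.
have V0 k : 0 <= V k by have := rser_le 0 (u0 k) (hV k); rewrite big_ord0.
have bound K N : \rsum_(n < N) (\rsum_(k < K) u k n) <= v.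
  rewrite exchange_big /=; apply: Rle_trans (rser_le K V0 hv).
  by apply: rsum_le => k; apply: rser_le.
have conv n : { l : R | rser (u^~ n) l }.
  have : ex_finite_lim_seq (fun K => \rsum_(k < K) u k n).
    apply: (ex_finite_lim_seq_incr _ v) => K; first by rewrite big_ord_recr /=; have := u0 K n; lra.
    apply: Rle_trans (bound K n.+1); rewrite big_ord_recr /=.
    set y := \big[_/_]_(i < n) _; suff : 0 <= y by lra.
    by apply: rsum_ge0 => i; apply: rsum_ge0 => j.
  by move=> h; exists (real (Lim_seq (fun K => \rsum_(k < K) u k n))); apply: Lim_seq_correct'.
have [T hT] : exists T, forall n, rser (u^~ n) (T n).
  by exists (fun n => proj1_sig (conv n)) => n; exact: proj2_sig (conv n).
exists T; split => //.
have Tub N : \rsum_(n < N) T n <= v.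
  have h := lim_rsum (n := N) hT.
  by apply: (is_lim_seq_le _ _ (\rsum_(n < N) T n) v _ h (is_lim_seq_const v)) => K; apply: bound.
apply/is_lim_seq_spec => eps /=.
have e2 : 0 < eps / 2 by have := cond_pos eps; lra.
have [K hK] := (is_lim_seq_spec _ _).2 hv (mkposreal _ e2).
have [N hN] := (is_lim_seq_spec _ _).2 (lim_rsum (n := K) hV) (mkposreal _ e2).
exists N => n Nn; have := hK K (Nat.le_refl K); have := hN n Nn => /=.
rewrite exchange_big /= => /Rabs_def2[_ h1] /Rabs_def2[_ h2].
have h3 : \rsum_(i < n) (\rsum_(j < K) u j i) <= \rsum_(i < n) T i.
  by apply: rsum_le => i; apply: rser_le (hT i) => k.
have h4 := Tub n.
have h5 := cond_pos eps.
by apply: Rabs_def1; lra_sum.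
Qed.

(** * The binomial series with negative exponent *)

Section BinomialSeries.
Variable s : R.
Hypothesis s0 : 0 < s.

Let bc (m : nat) := \rprod_(i < m) ((s + INR i) / (INR i + 1)).

Let bcS m : bc m.+1 = bc m * ((s + INR m) / (INR m + 1)).
Proof. by rewrite /bc big_ord_recr. Qed.

Let bc_gt0 m : 0 < bc m.
Proof. by apply: rprod_gt0 => i; have := pos_INR i => ?; apply: Rdiv_lt_0_compat; lra. Qed.

Let bc_radius : CV_radius bc = Rbar.Finite 1.
Proof.
have -> : Rbar.Finite 1 = Rbar.Finite (/ 1) by rewrite Rinv_1.
apply: CV_radius_finite_DAlembert; [|lra|].
  by move=> n; have := bc_gt0 n; lra.
apply: (is_lim_seq_ext (fun n => 1 + (s - 1) * / INR n.+1)) => [n|].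
  rewrite bcS S_INR; have := bc_gt0 n; have := pos_INR n => h1 h2.
  rewrite (_ : bc n * _ / bc n = (s + INR n) / (INR n + 1)); last by field; lra.
  rewrite Rabs_pos_eq; first by field; lra.
  by apply/Rlt_le/Rdiv_lt_0_compat; lra.
have -> : Rbar.Finite 1 = Rbar.Finite (1 + (s - 1) * 0) by congr Rbar.Finite; ring.
apply: is_lim_seq_plus'; first exact: is_lim_seq_const.
apply: is_lim_seq_mult'; first exact: is_lim_seq_const.
apply/(is_lim_seq_incr_1 (fun n => / INR n)).
apply: (is_lim_seq_inv _ p_infty) => //; exact: is_lim_seq_INR.
Qed.

Let bc_derive x : Rabs x < 1 ->
  (1 - x) * PSeries (PS_derive bc) x = s * PSeries bc x.
Proof.
move=> x1.
have r1 : Rbar_lt (Rabs x) (CV_radius bc) by rewrite bc_radius.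
have r2 : Rbar_lt (Rabs x) (CV_radius (PS_derive bc)) by rewrite CV_radius_derive.
have e1 : ex_pseries bc x by apply: CV_radius_inside.
have e2 : ex_pseries (PS_derive bc) x by apply: CV_radius_inside.
suff : PSeries (PS_derive bc) x = s * PSeries bc x + x * PSeries (PS_derive bc) x by lra.
rewrite -PSeries_scal -PSeries_incr_1 -PSeries_plus.
- apply: PSeries_ext => -[|n].
    change (INR 1 * bc 1 = s * bc 0 + 0).
    have b1 : bc 0 = 1 by rewrite /bc big_ord0.
    by rewrite bcS b1 /=; field.
  change (INR n.+2 * bc n.+2 = s * bc n.+1 + INR n.+1 * bc n.+1).
  by rewrite bcS (S_INR n.+1); have := pos_INR n.+1 => ?; field; lra.
- apply: ex_pseries_scal => //; exact: Rmult_comm.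
- exact: ex_pseries_incr_1.
Qed.

(** The recursion of the coefficients says (1 - x) f' = s f, so f(x) (1 - x)^s has derivative zero
    on (-1, 1) and keeps its value 1 at 0. *)
Lemma binomial_series x : Rabs x < 1 ->
  rser (fun m => (\rprod_(i < m) ((s + INR i) / (INR i + 1))) * x ^ m) (Rpower (1 - x) (- s)).
Proof.
move=> x1.
pose h y := PSeries bc y * exp (s * ln (1 - y)).
have hd y : Rabs y < 1 -> is_derive h y 0.
  move=> y1; have y2 := Rabs_def2 _ _ y1.
  have r1 : Rbar_lt (Rabs y) (CV_radius bc) by rewrite bc_radius.
  have d1 := is_derive_PSeries _ _ r1.
  have d2 : is_derive (fun y => exp (s * ln (1 - y))) y (exp (s * ln (1 - y)) * (s * (- / (1 - y)))).
    by auto_derive; first lra; rewrite -/(1 - y); field; lra.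
  have d3 := is_derive_mult _ _ _ _ _ d1 d2 Rmult_comm.
  have hh := bc_derive y1.
  have -> : 0 = PSeries (PS_derive bc) y * exp (s * ln (1 - y))
     + PSeries bc y * (exp (s * ln (1 - y)) * (s * - / (1 - y))).
    have -> : PSeries (PS_derive bc) y = s * PSeries bc y / (1 - y) by rewrite -hh; field; lra.
    field; lra.
  exact: d3.
have h0 : h 0 = 1.
  rewrite /h PSeries_0 Rminus_0_r ln_1 Rmult_0_r exp_0 /bc big_ord0. ring.
have hx : h x = 1.
  have [x2 x3] := Rabs_def2 _ _ x1.
  case: (Rtotal_order x 0) => [x0|[->|x0]] //.
    rewrite -h0; apply: (eq_is_derive h x 0) => // t ht; apply: hd; apply: Rabs_def1; lra.
  by rewrite -h0; apply/esym/(eq_is_derive h 0 x) => // t ht; apply: hd; apply: Rabs_def1; lra.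
have -> : Rpower (1 - x) (- s) = PSeries bc x.
  rewrite /Rpower Ropp_mult_distr_l_reverse exp_Ropp.
  have he := exp_pos (s * ln (1 - x)).
  apply: (Rmult_eq_reg_r (exp (s * ln (1 - x)))); last lra.
  by rewrite Rinv_l; [exact: esym hx|lra].
apply/rser_is_series/is_pseries_R/PSeries_correct/CV_radius_inside.
by rewrite bc_radius.
Qed.

End BinomialSeries.

Lemma fact_factorial k : Factorial.fact k = k`!.
Proof. by elim: k => // k IH; rewrite factS -IH /=; lia. Qed.

Lemma rserM f l c : rser f l -> rser (fun n => c * f n) (c * l).
Proof.
move=> h; apply: (lim_ext (is_lim_seq_mult' _ _ _ _ (is_lim_seq_const c) h)) => N.
by rewrite rsumMl.
Qed.
Arguments rserM [f l] c _.

Lemma rser_exp y : rser (fun k => y ^ k / INR k`!) (exp y).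
Proof.
apply/rser_is_series; apply: (is_series_ext _ _ _ _ ((is_pseries_R _ _ _).1 (is_exp_Reals y))) => n.
by rewrite fact_factorial /Rdiv Rmult_comm.
Qed.
Arguments rser_exp : clear implicits.


(** * The generating function and its coefficients *)

Section GeneratingFunction.
Variables a b : R.
Hypotheses (a0 : 0 < a) (b0 : 0 < b).

Definition gen (x : R) : R :=
  Rpower (1 - x) (- (b / 2 + 1)) * exp (a * Rpower (1 - x) (- b)).

Lemma Rpower_neg_mul y p q : Rpower y (- (p + q)) = Rpower y (- p) * Rpower y (- q).
Proof. by rewrite Ropp_plus_distr Rpower_plus. Qed.

Lemma rser_col k x : Rabs x < 1 ->
  rser (fun n => wgt a b n k * x ^ n) (a ^ k / INR k`! * Rpower (1 - x) (- shp b k)).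
Proof.
move=> x1; have s0 : 0 < shp b k by have := shp_gt1 b0 k; lra.
have h := rserM (a ^ k / INR k`!) (binomial_series s0 x1).
apply: (lim_ext h) => N; apply: eq_bigr => n _; rewrite /wgt; ring.
Qed.
Arguments rser_col k [x] _.

Lemma rser_gen x : Rabs x < 1 ->
  rser (fun k => a ^ k / INR k`! * Rpower (1 - x) (- shp b k)) (gen x).
Proof.
move=> x1; rewrite /gen.
have h := rserM (Rpower (1 - x) (- (b / 2 + 1))) (rser_exp (a * Rpower (1 - x) (- b))).
apply: (lim_ext h) => N; apply: eq_bigr => n _.
rewrite /shp (Rpower_neg_mul _ (b / 2 + 1)) Rpow_mult_distr.
have -> : Rpower (1 - x) (- (b * INR n)) = Rpower (1 - x) (- b) ^ n.
  rewrite -Rpower_pow; last exact: exp_pos.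
  by rewrite Rpower_mult; congr Rpower; ring.
by rewrite /Rdiv; ring.
Qed.
Arguments rser_gen [x] _.

Lemma wgt_pow_ge0 n k x : 0 <= x -> 0 <= wgt a b n k * x ^ n.
Proof. by move=> x0; apply: Rmult_le_pos; [exact/Rlt_le/wgt_gt0|exact: pow_le]. Qed.

(** Convergence in K for every n at once follows from convergence of the double series at a single
    positive point, here 1/2. *)
Lemma row_lim : exists t : nat -> R, forall n, is_lim_seq (fun K => row a b K n) (t n).
Proof.
have h : Rabs (/ 2) < 1 by rewrite Rabs_pos_eq; lra.
have [T [hT _]] := fubini_nonneg (fun k n => wgt_pow_ge0 n k (x := / 2) ltac:(lra))
  (fun k => rser_col k h) (rser_gen h).
exists (fun n => T n * 2 ^ n) => n.
apply: (lim_ext (is_lim_seq_mult' _ _ _ _ (hT n) (is_lim_seq_const (2 ^ n)))) => K.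
rewrite -rsumMr Rmult_assoc -Rpow_mult_distr (_ : / 2 * 2 = 1); last field.
by rewrite pow1 Rmult_1_r.
Qed.

Variable t : nat -> R.
Hypothesis ht : forall n, is_lim_seq (fun K => row a b K n) (t n).
Arguments ht : clear implicits.

Lemma row_le K n : row a b K n <= t n.
Proof.
apply: (is_lim_seq_incr_compare (fun K => row a b K n) _ (ht n)) => k.
by rewrite /row big_ord_recr /=; have := wgt_gt0 a0 b0 n k; lra_sum.
Qed.

Lemma rser_t_nonneg x : 0 <= x < 1 -> rser (fun n => t n * x ^ n) (gen x).
Proof.
move=> [x0 x1]; have h : Rabs x < 1 by rewrite Rabs_pos_eq.
have [T [hT h2]] := fubini_nonneg (fun k n => wgt_pow_ge0 n k x0) (fun k => rser_col k h) (rser_gen h).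
apply: (lim_ext h2) => N; apply: eq_bigr => n _.
have h3 : is_lim_seq (fun K => row a b K n * x ^ n) (t n * x ^ n).
  exact: is_lim_seq_mult' (ht n) (is_lim_seq_const _).
have h4 : is_lim_seq (fun K => row a b K n * x ^ n) (T n).
  by apply: (lim_ext (hT n)) => K; rewrite -rsumMr.
have := is_lim_seq_unique _ _ h3; rewrite (is_lim_seq_unique _ _ h4).
by case.
Qed.

(** For negative x the terms change sign and [fubini_nonneg] does not apply. The error of keeping
    only k < K is dominated by the same error at |x|, which tends to 0. Both signs serve to match
    the given series on a neighbourhood of 0. *)
Lemma rser_t x : Rabs x < 1 -> rser (fun n => t n * x ^ n) (gen x).
Proof.
move=> x1; have ax : 0 <= Rabs x < 1 by split => //; exact: Rabs_pos.
have aax : Rabs (Rabs x) < 1 by rewrite Rabs_Rabsolu.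
pose V y k := a ^ k / INR k`! * Rpower (1 - y) (- shp b k).
have hV y : Rabs y < 1 -> rser (V y) (gen y) := @rser_gen y.
have rowser y K : Rabs y < 1 -> rser (fun n => row a b K n * y ^ n) (\rsum_(k < K) V y k).
  move=> y1; have h := lim_rsum (n := K) (fun k => rser_col k y1).
  apply: (lim_ext h) => N; rewrite exchange_big /=; apply: eq_bigr => n _.
  by rewrite /row rsumMr.
have tail K N : Rabs (\rsum_(n < N) (t n * x ^ n) - \rsum_(n < N) (row a b K n * x ^ n))
    <= gen (Rabs x) - \rsum_(k < K) V (Rabs x) k.
  have -> : \rsum_(n < N) (t n * x ^ n) - \rsum_(n < N) (row a b K n * x ^ n) =
     \rsum_(n < N) ((t n - row a b K n) * x ^ n).
    rewrite -rsumB.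
    by apply: eq_bigr => n _; ring.
  apply: Rle_trans (rsum_abs _) _.
  have hl : rser (fun n => (t n - row a b K n) * Rabs x ^ n) (gen (Rabs x) - \rsum_(k < K) V (Rabs x) k).
    apply: (lim_ext (is_lim_seq_minus' _ _ _ _ (rser_t_nonneg ax) (rowser _ K aax))) => M.
    rewrite -rsumB.
    by apply: eq_bigr => n _; ring.
  apply: Rle_trans (rser_le N _ hl) => [|n]; last first.
    by apply: Rmult_le_pos; [have := row_le K n; lra|exact: pow_le ax.1].
  apply: rsum_le => n; rewrite Rabs_mult RPow_abs Rabs_pos_eq; last by have := row_le K n; lra.
  exact: Rle_refl.
apply/is_lim_seq_spec => eps /=.
have e3 : 0 < eps / 3 by have := cond_pos eps; lra.
have [K1 hK1] := (is_lim_seq_spec _ _).2 (hV _ aax) (mkposreal _ e3).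
have [K2 hK2] := (is_lim_seq_spec _ _).2 (hV _ x1) (mkposreal _ e3).
pose K := maxn K1 K2.
have [N hN] := (is_lim_seq_spec _ _).2 (rowser x K x1) (mkposreal _ e3).
exists N => n Nn.
have h1 := hK1 K ltac:(rewrite /K; lia); have h2 := hK2 K ltac:(rewrite /K; lia).
have h3 := hN n Nn; have h4 := tail K n; rewrite /= in h1 h2 h3.
move/Rabs_def2: h1 => h1; move/Rabs_def2: h2 => h2; move/Rabs_def2: h3 => h3.
have {}h4 : Rabs (\rsum_(n0 < n) (t n0 * x ^ n0) - \rsum_(n0 < n) (row a b K n0 * x ^ n0)) < eps / 3.
  by lra_sum.
move/Rabs_def2: h4 => h4.
by apply: Rabs_def1; lra_sum.
Qed.

Lemma t_gt0 n : 0 < t n.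
Proof. by apply: Rlt_le_trans (row_le 1 n); apply: row_gt0. Qed.

Lemma t_log_concave : exists N, forall n, (N <= n)%N -> t n * t n.+2 <= t n.+1 ^ 2.
Proof.
have [N hN] := row_eventually_log_concave a0 b0; exists N => n Nn.
have [K0 hK] := hN n Nn.
have h1 := is_lim_seq_mult' _ _ _ _ (ht n) (ht n.+2).
have h2 := is_lim_seq_mult' _ _ _ _ (ht n.+1) (ht n.+1).
rewrite /= Rmult_1_r; apply: (is_lim_seq_le_loc _ _ _ _ _ h1 h2).
by exists K0 => K h; have := hK K ltac:(lia); rewrite /= Rmult_1_r.
Qed.

Lemma t_incr n : t n <= t n.+1.
Proof.
apply: (is_lim_seq_le _ _ _ _ _ (ht n) (ht n.+1)) => K; apply: rsum_le => k.
rewrite wgt_row -[X in X <= _]Rmult_1_r; apply: Rmult_le_compat_l; first exact/Rlt_le/wgt_gt0.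
have hn := pos_INR n; apply: (Rmult_le_reg_r (INR n + 1)); first lra.
have -> : (shp b k + INR n) / (INR n + 1) * (INR n + 1) = shp b k + INR n by field; lra.
by have := shp_gt1 b0 k; lra.
Qed.

(* A bounded coefficient sequence would make [gen x * (1 - x)] bounded near 1, but the
   factor [(1 - x)^(-1-b/2)] alone exceeds that. *)
Lemma t_unbounded B : exists n, B < t n.
Proof.
case: (Classical_Prop.classic (exists n, B < t n)) => // hn; exfalso.
have hB n : t n <= B by apply: Rnot_lt_le => h; apply: hn; exists n.
have B0 : 0 < B by have := t_gt0 0; have := hB 0%N; lra.
(* Small enough that y^(-b/2) >= 2 (B + 1). *)
pose y := Rmin (1 / 2) (exp (- (2 / b) * ln (2 * (B + 1)))).
have y0 : 0 < y by apply: Rmin_pos; [lra|exact: exp_pos].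
have y1 : y <= 1 / 2 := Rmin_l _ _.
have hx : 0 <= 1 - y < 1 by lra.
have h1 : gen (1 - y) <= B * / y.
  have hs := rser_t_nonneg hx.
  have hg : rser (fun n => B * (1 - y) ^ n) (B * / y).
    apply: rserM; apply/rser_is_series.
    have -> : / y = / (1 - (1 - y)) by congr Rinv; ring.
    by apply: is_series_geom; rewrite Rabs_pos_eq; lra.
  apply: (is_lim_seq_le _ _ _ _ _ hs hg) => N; apply: rsum_le => n.
  by apply: Rmult_le_compat_r => //; apply: pow_le; lra.
have h2 : / y * (B + 1) <= gen (1 - y).
  rewrite /gen (_ : 1 - (1 - y) = y); last ring.
  have -> : Rpower y (- (b / 2 + 1)) = / y * Rpower y (- (b / 2)).
    rewrite (_ : - (b / 2 + 1) = - (1 + b / 2)); last ring.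
    by rewrite Rpower_neg_mul Rpower_Ropp Rpower_1.
  rewrite Rmult_assoc; apply: Rmult_le_compat_l; first exact/Rlt_le/Rinv_0_lt_compat.
  have h3 : 1 <= exp (a * Rpower y (- b)).
    rewrite -exp_0; apply: exp_le_compat; apply: Rmult_le_pos; [lra|exact/Rlt_le/exp_pos].
  have h4 : 2 * (B + 1) <= Rpower y (- (b / 2)).
    rewrite /Rpower -[X in X <= _]exp_ln; last lra.
    apply: exp_le_compat.
    have : ln y <= - (2 / b) * ln (2 * (B + 1)).
      by rewrite -[X in _ <= X]ln_exp; apply: ln_le => //; exact: Rmin_r.
    move=> h; have : - (b / 2) * (- (2 / b) * ln (2 * (B + 1))) <= - (b / 2) * ln y.
      by apply: Rmult_le_compat_neg_l; lra.
    by rewrite (_ : - (b / 2) * (- (2 / b) * ln (2 * (B + 1))) = ln (2 * (B + 1))) //; field; lra.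
  nra.
have : 0 < / y by apply: Rinv_0_lt_compat.
nra.
Qed.

End GeneratingFunction.

(** * Permutations and cycles *)

Section Porbits.
Local Open Scope nat_scope.

Lemma porbit_sub (T : finType) (s : {perm T}) (A : {set T}) x :
  x \in A -> (forall y, y \in A -> s y \in A) -> porbit s x \subset A.
Proof.
move=> xA sA; apply/subsetP => y /porbitP[k ->]; rewrite permX.
by elim: k => //= k IH; apply: sA.
Qed.

Lemma porbit_stable (T : finType) (s : {perm T}) x y : y \in porbit s x -> s y \in porbit s x.
Proof. by case/porbitP => k ->; apply/porbitP; exists k.+1; rewrite !permX. Qed.

Lemma porbit_morph (T T' : finType) (f : T -> T') (s : {perm T}) (s' : {perm T'}) x :
  (forall y, y \in porbit s x -> s' (f y) = f (s y)) -> porbit s' (f x) = f @: porbit s x.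
Proof.
move=> H; have it k : (s' ^+ k)%g (f x) = f ((s ^+ k)%g x).
  rewrite !permX; elim: k => //= k ->; rewrite H // -permX.
  exact: mem_porbit.
apply/setP => y; apply/porbitP/imsetP => [[k ->]|[z /porbitP[k ->] ->]].
  by exists ((s ^+ k)%g x); rewrite ?it ?mem_porbit.
by exists k; rewrite it.
Qed.

(* Relabels [p] so as to avoid [i], then inserts [i] right after [ord0] in its cycle. *)
Definition ins n (u : 'I_n.+1 * {perm 'I_n}) : {perm 'I_n.+1} :=
  (tperm ord0 u.1 * lift_perm u.1 u.1 u.2)%g.

Lemma ins0 n (u : 'I_n.+1 * {perm 'I_n}) : ins u ord0 = u.1.
Proof. by rewrite /ins permM tpermL lift_perm_id. Qed.

Lemma ins_inj n : injective (@ins n).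
Proof.
move=> [i p] [j q] /= e.
have ij : i = j by rewrite -[i](ins0 (i, p)) e ins0.
move: e; rewrite ij /ins /= => /mulgI e; congr (_, _); apply/permP => k.
by apply: (@lift_inj _ j); rewrite -!(lift_perm_lift j) e.
Qed.

Lemma ins_bij n : bijective (@ins n).
Proof. by apply: inj_card_bij (@ins_inj n) _; rewrite card_prod !card_Sn card_ord factS. Qed.

(** Inserting a point into the cycle of [ord0] leaves these counts unchanged, which is why that
    cycle is set apart. *)
Definition others n (s : {perm 'I_n.+1}) (j : nat) : nat :=
  #|[set C in porbits s | (ord0 \notin C) && (#|C| == j)]|.

Lemma card_imset_set (T T' : finType) (f : T -> T') (A : {set {set T}}) (B : {set {set T'}}) :
  injective f -> B = [set f @: C | C : {set T} in A] -> #|B| = #|A|.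
Proof. by move=> fi ->; rewrite card_imset //; apply: imset_inj. Qed.

Lemma ins_fixed n (p : {perm 'I_n}) :
  L1 (ins (ord0, p)) = 1 /\ others (ins (ord0, p)) =1 (fun j => Rcyc j p).
Proof.
set s := ins _.
have sE : s = lift_perm ord0 ord0 p by rewrite /s /ins tperm1 mul1g.
have s0 : porbit s ord0 = [set ord0].
  apply/eqP; rewrite eqEsubset sub1set porbit_id andbT; apply: porbit_sub; rewrite ?set11 // => y.
  by rewrite !inE => /eqP ->; rewrite sE lift_perm_id.
have sl x : porbit s (lift ord0 x) = lift ord0 @: porbit p x.
  by apply: porbit_morph => y _; rewrite sE lift_perm_lift.
split; first by rewrite /L1 s0 cards1.
move=> j; apply: (card_imset_set (@lift_inj _ ord0)).
apply/setP => C; rewrite inE; apply/idP/imsetP.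
- case/and3P => /imsetP[z _ ->]; case: (unliftP ord0 z) => [x ->|->]; last by rewrite porbit_id.
  rewrite sl => _ hj; exists (porbit p x) => //; rewrite inE; apply/andP; split; first exact: imset_f.
  by rewrite -(card_imset _ (@lift_inj _ ord0)).
- case=> D; rewrite inE => /andP[/imsetP[x _ ->] hj] ->; rewrite -sl; apply/and3P; split.
  + exact: imset_f.
  + by rewrite sl; apply/imsetP => -[y _ e]; have := neq_lift ord0 y; rewrite -e eqxx.
  + by rewrite sl card_imset //; exact: lift_inj.
Qed.

(** As [i] is not [ord0], relabelling by [lift i] fixes [ord0]. The new point sits between [ord0]
    and its former image, and all other cycles are merely relabelled. *)
Lemma ins_moved n (i : 'I_n.+2) (p : {perm 'I_n.+1}) : i != ord0 ->
  L1 (ins (i, p)) = (L1 p).+1 /\ others (ins (i, p)) =1 others p.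
Proof.
move=> i0; set s := ins _; have f0 : lift i ord0 = ord0.
  by apply: val_inj; rewrite /= /bump leqn0 (negbTE (_ : val i != 0)) //.
have fi := @lift_inj _ i.
have si : s i = lift i (p ord0) by rewrite /s /ins permM tpermR -{1}f0 lift_perm_lift.
have s0 : s ord0 = i by rewrite /s ins0.
have sf y : y != ord0 -> s (lift i y) = lift i (p y).
  move=> y0; rewrite /s /ins permM tpermD ?lift_perm_lift ?neq_lift //.
  by rewrite -f0 (inj_eq fi) eq_sym.
have S0 : porbit s ord0 = i |: lift i @: porbit p ord0.
  apply/eqP; rewrite eqEsubset; apply/andP; split.
    apply: porbit_sub => [|y].
      by rewrite -f0 in_setU1 imset_f ?porbit_id // orbT.
    case/setU1P => [->|/imsetP[z zp ->]].
      by rewrite si in_setU1 imset_f ?orbT // porbit_stable ?porbit_id.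
    case: (eqVneq z ord0) => [->|z0]; first by rewrite f0 s0 setU11.
    by rewrite sf // in_setU1 imset_f ?orbT // porbit_stable.
  have iS : i \in porbit s ord0 by rewrite -{1}s0 porbit_stable ?porbit_id.
  rewrite subUset sub1set iS /=; apply/subsetP => y /imsetP[z /porbitP[k ->] ->].
  rewrite permX; elim: k => [|k IH] /=; first by rewrite f0 porbit_id.
  case: (eqVneq (iter k p ord0) ord0) => [->|z0]; first by rewrite -si porbit_stable.
  by rewrite -sf // porbit_stable.
have sl x : x \notin porbit p ord0 -> porbit s (lift i x) = lift i @: porbit p x.
  move=> xp; apply: porbit_morph => y yx; apply: sf; apply: contraNneq xp => y0.
  by rewrite porbit_sym -y0.
have iN A : i \notin lift i @: A.
  by apply/imsetP => -[y _ e]; have := neq_lift i y; rewrite -e eqxx.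
split; first by rewrite /L1 S0 cardsU1 iN card_imset.
move=> j; apply: (card_imset_set fi).
apply/setP => C; rewrite inE; apply/idP/imsetP.
- case/and3P => /imsetP[z _ ->]; rewrite porbit_sym => hz hj.
  case: (unliftP i z) hz hj => [x ->|->]; last by rewrite S0 setU11.
  rewrite S0 in_setU1 negb_or => /andP[_ hx].
  have {}hx : x \notin porbit p ord0 by apply: contra hx => h; apply: imset_f.
  rewrite sl // => hj; exists (porbit p x) => //; rewrite inE; apply/and3P; split.
  + exact: imset_f.
  + by rewrite porbit_sym.
  + by rewrite -(card_imset _ fi).
- case=> D; rewrite inE => /and3P[/imsetP[x _ ->]]; rewrite porbit_sym => hx hj ->.
  rewrite -sl //; apply/and3P; split.
  + exact: imset_f.
  + rewrite sl // -f0; apply/imsetP => -[y yx /fi e]; move: hx; rewrite porbit_sym e.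
    by rewrite yx.
  + by rewrite sl // card_imset.
Qed.

Lemma Rcyc_others n (s : {perm 'I_n.+1}) j : Rcyc j s = others s j + (j == L1 s).
Proof.
rewrite /Rcyc -(cardsID [set C : {set 'I_n.+1} | ord0 \notin C]); congr (_ + _).
  by apply: eq_card => C; rewrite !inE; case: (_ \in _); rewrite //= andbC.
have e (C : {set 'I_n.+1}) : (C \in porbits s) && (ord0 \in C) = (C == porbit s ord0).
  apply/andP/eqP => [[/imsetP[x _ ->] h]|->]; last by rewrite imset_f ?porbit_id.
  by apply/eqP; rewrite eq_porbit_mem porbit_sym.
case: (eqVneq j (L1 s)) => [->|hj].
  rewrite (_ : _ :\: _ = [set porbit s ord0]) ?cards1 //; apply/setP => C.
  rewrite !inE negbK; case: (eqVneq C (porbit s ord0)) (e C) => [->|_] h; last first.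
    by apply/negbTE; apply: contraFN h => /and3P[-> -> _].
  by rewrite porbit_id imset_f //= eqxx.
apply: eq_card0 => C; rewrite !inE negbK; apply/negP => /and3P[h1 h2 h3].
have := e C; rewrite h1 h2 => /esym/eqP hC; move: hj; rewrite -(eqP h3) hC /L1 eqxx.
by [].
Qed.

End Porbits.

(** A statistic is a function of all cycle counts that does not mention n, so it can be averaged
    over symmetric groups of different sizes. *)
Definition avg (n : nat) (g : (nat -> nat) -> R) : R :=
  / INR n`! * \big[Rplus/0]_(s : {perm 'I_n}) g (fun j => Rcyc j s).

Definition bump_at (k : nat) (c : nat -> nat) : nat -> nat := fun j => (c j + (j == k))%N.

Lemma Rcyc_bump n (s : {perm 'I_n.+1}) : (fun j => Rcyc j s) = bump_at (L1 s) (others s).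
Proof. by apply: functional_extensionality => j; rewrite Rcyc_others. Qed.

(** The cycle of [ord0] in a uniform permutation has uniform length, and given it the rest is
    uniform on the n - k points left; dividing by n! rather than (n+1)! removes the probability
    1/(n+1). In the induction the inserted point [ord0] gives k = 0, and all other choices
    contribute equal sums with lengths raised by one. *)
Lemma sum_by_cycle n (G : nat -> (nat -> nat) -> R) :
  / INR n`! * \big[Rplus/0]_(s : {perm 'I_n.+1}) G (L1 s) (others s) =
  \rsum_(k < n.+1) avg (n - k) (G k.+1).
Proof.
elim: n G => [|n IH] G.
all: rewrite (reindex (@ins _)); last by apply/onW_bij/ins_bij.
all: rewrite -(pair_bigA _ (fun i p => G (L1 (ins (i, p))) (others (ins (i, p))))) big_ord_recl /=.
all: rewrite big_ord_recl [in RHS]/= subn0 Rmult_plus_distr_l.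
all: congr (_ + _).
- by rewrite /avg; congr (_ * _); apply: eq_bigr => p _; have [-> /functional_extensionality ->] := ins_fixed p.
- by rewrite !big_ord0 Rmult_0_r.
- by rewrite /avg; congr (_ * _); apply: eq_bigr => p _; have [-> /functional_extensionality ->] := ins_fixed p.
rewrite [in LHS](eq_bigr (fun=> \big[Rplus/0]_(p : {perm 'I_n.+1}) G (L1 p).+1 (others p))) => [|i _]; last first.
  apply: eq_bigr => p _ /=; have [|-> /functional_extensionality ->] // := @ins_moved n (lift ord0 i) p.
rewrite rsum_const factS mult_INR.
set X := \big[_/_]_(p : {perm _}) _.
have -> : / (INR n.+1 * INR n`!) * (INR n.+1 * X) = / INR n`! * X.
  have h1 : 0 < INR n.+1 by apply: lt_0_INR; lia.
  have h2 : 0 < INR n`! by apply: lt_0_INR; have := fact_gt0 n; lia.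
  by field; lra.
rewrite (IH (fun k => G k.+1)); apply: eq_bigr => k _.
by rewrite /bump /= subSS.
Qed.

Lemma sum_by_L1 n (G : nat -> (nat -> nat) -> R) :
  INR n.+1 * (/ INR (n.+1)`! * \big[Rplus/0]_(s : {perm 'I_n.+1}) G (L1 s) (fun j => Rcyc j s)) =
  \rsum_(k < n.+1) avg (n - k) (fun c => G k.+1 (bump_at k.+1 c)).
Proof.
rewrite -(sum_by_cycle n (fun k c => G k (bump_at k c))) factS mult_INR.
rewrite [in LHS](eq_bigr (fun s => G (L1 s) (bump_at (L1 s) (others s)))) => [|s _]; last by rewrite Rcyc_bump.
set X := \big[_/_]_(s : {perm _}) _.
have h1 : 0 < INR n.+1 by apply: lt_0_INR; lia.
have h2 : 0 < INR n`! by apply: lt_0_INR; have := fact_gt0 n; lia.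
rewrite /X; move: (\big[_/_]_s _) => Y; field; lra.
Qed.

Lemma avgS n g : INR n.+1 * avg n.+1 g = \rsum_(k < n.+1) avg (n - k) (fun c => g (bump_at k.+1 c)).
Proof. exact: (sum_by_L1 n (fun _ => g)). Qed.

(** * Weighted counts of permutations *)

Lemma Rsum_big (T : Type) (s : seq T) (f : T -> R) : Rsum s f = \big[Rplus/0]_(x <- s) f x.
Proof. by elim: s => [|x s IH]; rewrite ?big_nil ?big_cons //= IH. Qed.

Lemma Rsum_perm n (E : pred {perm 'I_n}) (f : {perm 'I_n} -> R) :
  Rsum [seq s <- enum {perm 'I_n} | E s] f = \big[Rplus/0]_(s | E s) f s.
Proof. by rewrite Rsum_big big_filter big_enum_cond. Qed.

Section Weights.
Variable tau : nat -> R.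

(** The cut-off [M] is independent of the size of the permutation, so that one weight can be carried
    through [avgS]. *)
Definition wt (M : nat) (c : nat -> nat) : R := \rprod_(i < M) (tau i.+1 ^ c i.+1).

Lemma foldr_prod (F : nat -> R) M :
  foldr (fun j acc => F j * acc) 1 (iota 1 M) = \rprod_(i < M) F i.+1.
Proof.
rewrite (eq_bigr (fun i : 'I_M => F (1 + i)%N)) //.
elim: M 1%N => [|M IH] m /=; first by rewrite big_ord0.
rewrite big_ord_recl /= addn0 IH; congr (_ * _).
by apply: eq_bigr => i _; rewrite /bump addSn addnA addn1.
Qed.

Lemma weight_wt n (s : {perm 'I_n}) : weight tau s = wt n (fun j => Rcyc j s).
Proof. exact: foldr_prod. Qed.

Lemma Rcyc_large n (s : {perm 'I_n}) j : (n < j)%N -> Rcyc j s = 0%N.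
Proof.
move=> nj; apply: eq_card0 => C; rewrite !inE; apply/negP => /andP[_ /eqP h].
by have := max_card (mem C); rewrite h card_ord leqNgt nj.
Qed.

Lemma wt_stable M n (s : {perm 'I_n}) : (n <= M)%N ->
  wt M (fun j => Rcyc j s) = wt n (fun j => Rcyc j s).
Proof.
move=> /subnK <-; elim: (M - n)%N => // d IH; rewrite addSn {1}/wt big_ord_recr /=.
by rewrite -/(wt (d + n) (fun j => Rcyc j s)) IH Rcyc_large ?Rmult_1_r //; lia.
Qed.

Lemma wt_bump M k c : (k < M)%N -> wt M (bump_at k.+1 c) = tau k.+1 * wt M c.
Proof.
move=> kM; rewrite /wt /bump_at; under eq_bigr => i _ do rewrite pow_add.
rewrite big_split /= Rmult_comm; congr (_ * _).
rewrite (bigD1 (Ordinal kM)) //= eqxx big1 => [|i]; first by rewrite /=; ring.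
by move=> h; rewrite eqSS -[k]/(val (Ordinal kM)) val_eqE (negbTE h).
Qed.

Lemma avg_wt M n : (n <= M)%N -> avg n (wt M) = hn tau n.
Proof.
move=> nM; rewrite /avg /hn Rsum_big big_enum /=; congr (_ * _).
by apply: eq_bigr => s _; rewrite weight_wt wt_stable.
Qed.

Lemma hn0 : hn tau 0 = 1.
Proof.
rewrite -(avg_wt (leqnn 0)) /avg (eq_bigr (fun=> 1)) => [|s _]; last by rewrite /wt big_ord0.
by rewrite big_const card_Sn /=; field.
Qed.

(** The coefficient form of z H'(z) = H(z) sum_k tau_k z^k, obtained by sorting permutations by the
    cycle of [ord0]. *)
Lemma hnS n : INR n.+1 * hn tau n.+1 = \rsum_(k < n.+1) (tau k.+1 * hn tau (n - k)).
Proof.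
rewrite -(avg_wt (leqnn n.+1)) avgS; apply: eq_bigr => k _.
rewrite -(@avg_wt n.+1); last by lia.
rewrite /avg (eq_bigr (fun s => tau k.+1 * wt n.+1 (fun j => Rcyc j s))) => [|s _].
  by rewrite -big_distrr /= -!Rmult_assoc (Rmult_comm (/ _)).
by rewrite wt_bump.
Qed.

(** Identities between generating functions are proved below by checking this recursion, which
    stands in for the formal series exp(sum_k tau_k z^k / k). *)
Lemma hn_unique (v : nat -> R) : v 0%N = 1 ->
  (forall n, INR n.+1 * v n.+1 = \rsum_(k < n.+1) (tau k.+1 * v (n - k)%N)) ->
  forall n, v n = hn tau n.
Proof.
move=> v0 vS n; elim: n {-2}n (leqnn n) => [|n IH] [|k] // kn; rewrite ?v0 ?hn0 //.
have h1 : 0 < INR k.+1 by apply: lt_0_INR; lia.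
apply: (Rmult_eq_reg_l (INR k.+1)); last lra.
by rewrite vS hnS; apply: eq_bigr => i _; rewrite IH //; lia.
Qed.

Lemma hn_gt0 n : (forall j, 0 < tau j.+1) -> 0 < hn tau n.
Proof.
move=> t0; elim: n {-2}n (leqnn n) => [|n IH] [|k] // kn; rewrite ?hn0; try lra.
have h1 : 0 < INR k.+1 by apply: lt_0_INR; lia.
apply: (Rmult_lt_reg_l (INR k.+1)) => //; rewrite Rmult_0_r hnS big_ord_recl.
apply: Rplus_lt_le_0_compat; first by apply: Rmult_lt_0_compat => //; apply: IH; lia.
by apply: rsum_ge0 => i; apply/Rlt_le/Rmult_lt_0_compat => //; apply: IH; lia.
Qed.

(** The coefficients of z^S H(z), with H the generating function of [hn tau]; the zeros below [S]
    let sums run over a common range. *)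
Definition hz (S n : nat) : R := if (S <= n)%N then hn tau (n - S) else 0.

Lemma rsum_trunc (p N : nat) (f : nat -> R) : (p <= N)%N ->
  \rsum_(k < N) (if (k < p)%N then f k else 0) = \rsum_(k < p) f k.
Proof. by move=> pN; rewrite (big_ord_widen _ _ pN) [in RHS]big_mkcond. Qed.

Lemma hzS S n : (INR n.+1 - INR S) * hz S n.+1 = \rsum_(k < n.+1) (tau k.+1 * hz S (n - k)).
Proof.
case: (leqP S n.+1) => h; last first.
  rewrite /hz leqNgt h /= Rmult_0_r rsum0 // => k; rewrite ifF ?Rmult_0_r //.
  by apply/negbTE; rewrite -ltnNge; lia.
rewrite (eq_bigr (fun k : 'I_n.+1 => if (k < n.+1 - S)%N then tau k.+1 * hn tau (n - S - k) else 0)).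
  rewrite (rsum_trunc (fun k => tau k.+1 * hn tau (n - S - k))); last by lia.
  rewrite /hz h -minus_INR; last by apply/leP.
  rewrite -[(_ - _)%coq_nat]/(n.+1 - S)%N.
  case E : (n.+1 - S)%N => [|p]; first by rewrite big_ord0 /= Rmult_0_l.
  rewrite hnS (_ : (n - S)%N = p) //; lia.
move=> k _; rewrite /hz; case: ltnP => hk.
  rewrite ifT; last by lia.
  by congr (_ * hn _ _); lia.
by rewrite ifF ?Rmult_0_r //; apply/negbTE; rewrite -ltnNge; have := ltn_ord k; lia.
Qed.

End Weights.

Section ExponentialFactor.
Variables (tau : nat -> R) (j : nat) (e : R).
Hypothesis j0 : (0 < j)%N.

Definition shift_at : nat -> R := fun k => tau k + (if k == j then e else 0).

Let x := e / INR j.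
Let v Q n := \rsum_(q < Q) (x ^ q / INR q`! * hz tau (q * j) n).

Let vstable Q n : (n < Q)%N -> v Q n = v n.+1 n.
Proof.
move=> /subnK <-; elim: (Q - n.+1)%N => // d IH; rewrite addSn {1}/v big_ord_recr /= -/(v (d + n.+1)%N n) IH.
rewrite /hz ifF; first by ring.
by apply/negbTE; rewrite -ltnNge; nia.
Qed.

Let INRj : 0 < INR j.
Proof. by apply: lt_0_INR; lia. Qed.

Let factpos q : 0 < INR q`!.
Proof. by apply: lt_0_INR; have := fact_gt0 q; lia. Qed.

(* Multiplication of the generating function by [exp (e z^j / j)]. *)
Lemma hn_shift n : hn shift_at n = \rsum_(q < n.+1) (x ^ q / INR q`! * hz tau (q * j) n).
Proof.
rewrite -/(v n.+1 n); symmetry; move: n; apply: hn_unique => [|n].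
  by rewrite /v big_ord1 /hz /= mul0n /= hn0; field.
have -> : v n.+2 n.+1 = v n.+3 n.+1 by rewrite (vstable (Q := n.+3)).
(* Writing n + 1 = (n + 1 - q j) + q j is the product rule: the first part differentiates H, the
   second the exponential factor. *)
have -> : INR n.+1 * v n.+3 n.+1 =
   \rsum_(q < n.+3) (x ^ q / INR q`! * ((INR n.+1 - INR (q * j)) * hz tau (q * j) n.+1)) +
   \rsum_(q < n.+3) (x ^ q / INR q`! * (INR (q * j) * hz tau (q * j) n.+1)).
  by rewrite -rsumD rsumMl; apply: eq_bigr => q _; ring.
have -> : \rsum_(q < n.+3) (x ^ q / INR q`! * ((INR n.+1 - INR (q * j)) * hz tau (q * j) n.+1)) =
   \rsum_(k < n.+1) (tau k.+1 * v (n - k).+1 (n - k)).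
  under eq_bigr => q _ do rewrite hzS rsumMl.
  rewrite exchange_big /=; apply: eq_bigr => k _.
  rewrite -(vstable (Q := n.+3)); last by lia.
  by rewrite /v rsumMl; apply: eq_bigr => q _; ring.
have -> : \rsum_(q < n.+3) (x ^ q / INR q`! * (INR (q * j) * hz tau (q * j) n.+1)) =
   if (j <= n.+1)%N then e * v (n.+1 - j).+1 (n.+1 - j) else 0.
  rewrite big_ord_recl mul0n Rmult_0_l Rmult_0_r Rplus_0_l.
  have hzz q : hz tau (q.+1 * j) n.+1 = if (j <= n.+1)%N then hz tau (q * j) (n.+1 - j) else 0.
    rewrite /hz mulSn; case: (leqP j n.+1) => h2; last first.
      by rewrite ifF //; apply/negbTE; rewrite -ltnNge; lia.
    rewrite subnDA (_ : (j + q * j <= n.+1)%N = (q * j <= n.+1 - j)%N) //; lia.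
  case: ifP => h; last first.
    by rewrite rsum0 // => q; rewrite -[nat_of_ord _]/(q.+1) hzz h; ring.
  rewrite -(vstable (Q := n.+2)); last by lia.
  rewrite /v rsumMl; apply: eq_bigr => q _; rewrite -[nat_of_ord _]/(q.+1) hzz h.
  rewrite factS !mult_INR /x; have := factpos q.
  have : 0 < INR q.+1 by apply: lt_0_INR; lia.
  rewrite -tech_pow_Rmult; move: (INR q.+1) (INR q`!) ((e / INR j) ^ q) => N F y h1 h2.
  by field; lra.
have -> : \rsum_(k < n.+1) (shift_at k.+1 * v (n - k).+1 (n - k)) =
  \rsum_(k < n.+1) (tau k.+1 * v (n - k).+1 (n - k)) +
  \rsum_(k < n.+1) (if k.+1 == j then e * v (n - k).+1 (n - k) else 0).
  rewrite -rsumD; apply: eq_bigr => k _; rewrite /shift_at; case: eqP => _; ring.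
congr (_ + _); case: ifP => h.
  have kn : (j.-1 < n.+1)%N by lia.
  rewrite (bigD1 (Ordinal kn)) //= prednK // eqxx big1 => [|i].
    by rewrite (_ : (n - j.-1)%N = (n.+1 - j)%N); [ring|lia].
  move=> hi; case: eqP => // hj; case/eqP: hi; apply: val_inj => /=; lia.
rewrite rsum0 // => k; case: eqP => // hj; have := ltn_ord k; lia.
Qed.

End ExponentialFactor.

(** * Log-concavity *)

Lemma log_concave_ratio (p : nat -> R) u v : (u <= v)%N -> (forall i, 0 < p i) ->
  (forall i, (u <= i < v)%N -> p i * p i.+2 <= p i.+1 ^ 2) ->
  p u * p v.+1 <= p u.+1 * p v.
Proof.
move=> /subnK <-; elim: (v - u)%N => [|d IH] p0 H; first by rewrite add0n; lra.
have {}IH := IH p0 (fun i hi => H i ltac:(lia)).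
have h := H (d + u)%N ltac:(lia); rewrite addSn.
apply: (Rmult_le_reg_r (p (d + u)%N)); first exact: p0.
have h1 := Rmult_le_compat_l _ _ _ (Rlt_le _ _ (p0 u)) h.
have h2 := Rmult_le_compat_r _ _ _ (Rlt_le _ _ (p0 (d + u).+1)) IH.
by lra.
Qed.

(* Bender and Canfield: the difference [p_{n+1}^2 - p_n p_{n+2}] is a double sum of products
   of two antisymmetric expressions of the same sign. *)
Lemma hn_log_concave (Z : nat -> R) : Z 0%N = 1 -> (forall i, 0 < Z i) ->
  (forall i, Z i * Z i.+2 <= Z i.+1 ^ 2) ->
  forall n, hn Z n * hn Z n.+2 <= hn Z n.+1 ^ 2.
Proof.
move=> Z0 Zp Zlc; set p := hn Z; have pp n : 0 < p n by apply: hn_gt0.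
have hS n : INR n.+1 * p n.+1 = \rsum_(k < n.+1) (Z k.+1 * p (n - k)%N) := hnS Z n.
elim/ltn_ind => n IH.
pose P1 (j : nat) := p (n.+1 - j)%N.
(* The value 0 at j = n + 1 keeps the four sums below on one range. *)
pose P0 (j : nat) := if (j <= n)%N then p (n - j)%N else 0.
pose f i j := P1 j * P0 i - P0 j * P1 i.
have E1 : \rsum_(i < n.+2) (Z i.+1 * P0 i) = INR n.+1 * p n.+1.
  rewrite big_ord_recr /= {2}/P0 ltnn Rmult_0_r Rplus_0_r hS; apply: eq_bigr => i _ /=.
  by rewrite /P0 -ltnS ltn_ord.
have E2 : \rsum_(i < n.+2) (Z i * P1 i) = INR n.+2 * p n.+1.
  have -> : INR n.+2 * p n.+1 = 1 * p n.+1 + \rsum_(i < n.+1) (Z i.+1 * p (n - i)%N).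
    by rewrite -hS S_INR; ring.
  by rewrite big_ord_recl /= Z0 /P1 subn0.
have E3 : \rsum_(i < n.+2) (Z i * P0 i) = INR n.+1 * p n.
  have -> : INR n.+1 * p n = 1 * p n + \rsum_(i < n) (Z i.+1 * p (n - i.+1)%N).
    rewrite S_INR Rmult_plus_distr_r Rplus_comm; congr (_ + _).
    case: {+}n => [|n']; first by rewrite big_ord0 /= Rmult_0_l.
    by rewrite hS.
  rewrite big_ord_recl big_ord_recr /= Z0 {1}/P0 leq0n subn0; congr (_ + _).
  rewrite {2}/P0 /bump /= add1n ltnn Rmult_0_r Rplus_0_r.
  by apply: eq_bigr => i _; rewrite /P0 add1n ltn_ord.
have E4 : \rsum_(i < n.+2) (Z i.+1 * P1 i) = INR n.+2 * p n.+2 by rewrite hS.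
have E : \rsum_(i < n.+2) (\rsum_(j < n.+2) (Z i.+1 * Z j * f i j)) =
   INR n.+1 * INR n.+2 * (p n.+1 ^ 2 - p n * p n.+2).
  transitivity ((\rsum_(i < n.+2) (Z i.+1 * P0 i)) * (\rsum_(i < n.+2) (Z i * P1 i))
     - (\rsum_(i < n.+2) (Z i * P0 i)) * (\rsum_(i < n.+2) (Z i.+1 * P1 i))).
    rewrite (Rmult_comm (\rsum_(i < n.+2) (Z i * P0 i))) !rsumMr -rsumB.
    apply: eq_bigr => i _; rewrite !rsumMl -rsumB; apply: eq_bigr => j _; rewrite /f; ring.
  by rewrite E1 E2 E3 E4; ring.
suff : 0 <= \rsum_(i < n.+2) (\rsum_(j < n.+2) (Z i.+1 * Z j * f i j)).
  rewrite E => h; have h1 : 0 < INR n.+1 by apply: lt_0_INR; lia.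
  have h2 : 0 < INR n.+2 by apply: lt_0_INR; lia.
  have h3 : 0 < INR n.+1 * INR n.+2 by apply: Rmult_lt_0_compat.
  by apply: Rnot_lt_le => h4; have := Rmult_lt_compat_l _ _ _ h3 h4; lra.
set S := \big[_/_]_(_ < _) _.
have S2 : S + S = \rsum_(i < n.+2) (\rsum_(j < n.+2) ((Z i.+1 * Z j - Z j.+1 * Z i) * f i j)).
  rewrite {2}/S exchange_big -rsumD; apply: eq_bigr => i _; rewrite -rsumD.
  by apply: eq_bigr => j _; rewrite /f; ring.
suff : 0 <= S + S by lra.
rewrite S2; apply: rsum_ge0 => i; apply: rsum_ge0 => j.
have P0p k : 0 <= P0 k by rewrite /P0; case: ifP => _; [exact/Rlt_le|lra].
(* Log-concavity of [p] enters only at indices below [n], where the induction hypothesis provides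
   it. *)
have key (k l : nat) : (k <= l < n.+2)%N -> P1 k * P0 l <= P0 k * P1 l.
  move=> /andP[kl ln]; case: (leqP l n) => h; last first.
    rewrite {1}/P0 leqNgt h Rmult_0_r; apply: Rmult_le_pos => //; exact/Rlt_le/pp.
  rewrite /P1 /P0 h ifT; last by lia.
  rewrite (_ : (n.+1 - k)%N = (n - k).+1); last by lia.
  rewrite (_ : (n.+1 - l)%N = (n - l).+1); last by lia.
  rewrite Rmult_comm (Rmult_comm (p (n - k)%N)); apply: log_concave_ratio => //; first by lia.
  by move=> k' hk; apply: IH; lia.
have keyZ (k l : nat) : (k <= l)%N -> Z k * Z l.+1 <= Z k.+1 * Z l.
  by move=> kl; apply: log_concave_ratio.
case: (leqP i j) => ij.
  have := key i j ltac:(have := ltn_ord j; lia); have := keyZ i j ij; rewrite /f => h1 h2.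
  by apply: Rmult_le_pos; lra.
have := key j i ltac:(have := ltn_ord i; lia); have := keyZ j i (ltnW ij); rewrite /f => h1 h2.
rewrite -Rmult_opp_opp; apply: Rmult_le_pos; lra.
Qed.

Lemma bernoulli_le n x : 0 <= x <= 1 -> 1 - INR n * x <= (1 - x) ^ n.
Proof.
move=> hx; elim: n => [|n IH]; first by rewrite /=; lra.
rewrite S_INR -tech_pow_Rmult.
have h := Rmult_le_compat_l (1 - x) _ _ ltac:(lra) IH.
by have := pos_INR n; nra.
Qed.

Definition summable_inside (z : nat -> R) : Prop :=
  forall x, 0 <= x < 1 -> exists B, forall M, \rsum_(k < M) (z k.+1 * x ^ k) <= B.

(** * A log-concave modification of the parameters *)

Section Majorant.
Variable z : nat -> R.
Hypotheses (zpos : forall j, 0 < z j.+1) (zmono : forall j, z j.+1 <= z j.+2).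
Hypothesis zunb : forall B, exists j, B < z j.+1.
Variable N : nat.
Hypothesis zlc : forall j, (N < j)%N -> z j * z j.+2 <= z j.+1 ^ 2.
Hypothesis zsum : summable_inside z.

Let zmono_le i j : (0 < i)%N -> (i <= j)%N -> z i <= z j.
Proof.
move=> i0 /subnK <-; elim: (j - i)%N => [|d IH]; first by rewrite add0n; lra.
apply: Rle_trans IH _; rewrite addSn; case: (d + i)%N (leq_addl d i) => [h|k _]; last exact: zmono.
by exfalso; lia.
Qed.

(** Otherwise [z] grows at least like (1 + e)^j from [s] on, and its power series diverges at 1/(1 +
    e). *)
Lemma ratio_near_one s e : (0 < s)%N -> 0 < e -> exists J, (s <= J)%N /\ z J.+1 <= (1 + e) * z J.
Proof.
move=> s0 e0; case: (Classical_Prop.classic (exists J, (s <= J)%N /\ z J.+1 <= (1 + e) * z J)) => // H.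
exfalso; have zs : 0 < z s by case: s s0 {H} => // s _.
have grow d : (1 + e) ^ d * z s <= z (d + s)%N.
  elim: d => [|d IH]; first by rewrite add0n /=; lra.
  rewrite -tech_pow_Rmult addSn Rmult_assoc.
  apply: (Rle_trans _ ((1 + e) * z (d + s)%N)); first by apply: Rmult_le_compat_l; lra.
  by apply: Rnot_lt_le => h; apply: H; exists (d + s)%N; split; [lia|lra].
pose x := / (1 + e); have xe : x * (1 + e) = 1 by rewrite /x; field; lra.
have x0 : 0 < x by apply: Rinv_0_lt_compat; lra.
have [B hB] := zsum (x := x) ltac:(nra).
pose c := x ^ s.-1 * z s; have c0 : 0 < c by apply: Rmult_lt_0_compat => //; exact: pow_lt.
have term d : c <= z (d + s.-1).+1 * x ^ (d + s.-1).
  rewrite pow_add -addnS prednK // /c.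
  have h : 1 * z s <= x ^ d * z (d + s)%N.
    rewrite -(pow1 d) -xe Rpow_mult_distr Rmult_assoc; apply: Rmult_le_compat_l => //.
    exact/Rlt_le/pow_lt.
  have hp := pow_lt _ s.-1 x0.
  have := Rmult_le_compat_l _ _ _ (Rlt_le _ _ hp) h; lra.
have sums d : INR d * c <= \rsum_(k < d + s.-1) (z k.+1 * x ^ k).
  elim: d => [|d IH].
    rewrite Rmult_0_l; apply: rsum_ge0 => k; apply/Rlt_le/Rmult_lt_0_compat => //; exact: pow_lt.
  by rewrite S_INR Rmult_plus_distr_r addSn big_ord_recr; apply: Rplus_le_compat => //; rewrite Rmult_1_l; exact: term.
have [d hd] := INR_unbounded (B / c).
have := Rle_trans _ _ _ (sums d) (hB _).
have : B < INR d * c.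
  have e1 : B = B / c * c by field; lra.
  by rewrite e1; apply: Rmult_lt_compat_r.
by lra.
Qed.

(** Below a suitable [J] the sequence is continued downwards geometrically with ratio y = z_J /
    z_(J+1), which satisfies log-concavity with equality; index 0 is then reset to 1. Lowering the
    value at 0 preserves log-concavity, so what has to be shown is that the continuation is at least
    1 there. *)
Lemma log_concave_modification : exists (Z : nat -> R) (J : nat) (C : R),
  [/\ Z 0%N = 1, (forall i, 0 < Z i), (forall i, Z i * Z i.+2 <= Z i.+1 ^ 2),
      (forall j, (J <= j)%N -> Z j = z j) & (forall j, Z j.+1 <= C * z j.+1)].
Proof.
have [s [s0 sN zs2]] : exists s, [/\ (0 < s)%N, (N < s)%N & 2 <= z s].
  have [j hj] := zunb 2; exists (maxn j.+1 N.+1); split; try lia.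
  by apply: Rle_trans (Rlt_le _ _ hj) (zmono_le _ _); lia.
have INRs : 0 < INR s by apply: lt_0_INR; lia.
(* This gives (1 - e)^s >= 1/2, to be played against z_s >= 2. *)
pose e := / (2 * INR s).
have e0 : 0 < e by apply: Rinv_0_lt_compat; lra.
have es : INR s * e = 1 / 2 by rewrite /e; field; lra.
have e1 : e <= 1.
  have : 1 <= INR s by rewrite -[1]/(INR 1); apply: leR.
  by nra.
have [J [sJ hJ]] := ratio_near_one s0 e0.
have J0 : (0 < J)%N by lia.
have zj j : (0 < j)%N -> 0 < z j by case: j.
have zJ := zj _ J0.
pose y := z J / z J.+1.
have yq : z J.+1 * y = z J by rewrite /y; field; have := zj J.+1 isT; lra.
have y0 : 0 < y by apply: Rdiv_lt_0_compat => //; exact: zj.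
have zJ1 := zmono_le J0 (leqnSn J).
have y1 : y <= 1.
  by apply: (Rmult_le_reg_l (z J.+1)); [exact: zj|rewrite yq; lra].
have ye : 1 - e <= y.
  apply: (Rmult_le_reg_l (z J.+1)); first exact: zj.
  have h1 := Rmult_le_compat_l (1 - e) _ _ ltac:(lra) hJ; nra.
pose Y j := if (j < J)%N then z J * y ^ (J - j) else z j.
have Ypos i : 0 < Y i.
  by rewrite /Y; case: ltnP => h; [apply: Rmult_lt_0_compat => //; exact: pow_lt|apply: zj; lia].
have Yz j : (J <= j)%N -> Y j = z j by move=> h; rewrite /Y ltnNge h.
have YS j : (j < J)%N -> Y j = y * Y j.+1.
  move=> h; rewrite {1}/Y h (_ : (J - j)%N = (J - j.+1).+1); last by lia.
  rewrite -tech_pow_Rmult; case: (ltnP j.+1 J) => h1; first by rewrite /Y h1; ring.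
  by rewrite Yz // (_ : j.+1 = J) ?subnn /=; [ring|lia].
have Ylc i : Y i * Y i.+2 <= Y i.+1 ^ 2.
  case: (ltnP i.+1 J) => h1; last case: (ltnP i J) => h2.
  - by rewrite (YS i) ?(YS i.+1) //; [apply: Req_le; ring|lia].
  - rewrite (YS i) // !Yz; try lia.
    by rewrite (_ : i.+1 = J) -?yq; [apply: Req_le; ring|lia].
  - by rewrite !Yz; try lia; apply: zlc; lia.
(* From [J] down to [s] log-concavity keeps the continuation above [z], so it is at least 2 at [s];
   the remaining [s] steps cost a factor y^s >= 1/2. *)
have Y0 : 1 <= Y 0%N.
  rewrite /Y J0 subn0.
  have h : forall d, (d + s <= J)%N -> z s <= z (d + s)%N * y ^ d.
    elim=> [|d IH] hd; first by rewrite add0n /=; lra.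
    apply: Rle_trans (IH ltac:(lia)) _.
    rewrite -tech_pow_Rmult -Rmult_assoc; apply: Rmult_le_compat_r; first exact/Rlt_le/pow_lt.
    have h1 : z (d + s)%N * z J.+1 <= z (d + s).+1 * z J.
      pose w i := z (i + s)%N.
      have wp i : 0 < w i by apply: zj; lia.
      have := @log_concave_ratio w d (J - s)%N ltac:(lia) wp.
      rewrite /w subnK // !addSn subnK //; apply=> i hi.
      by rewrite !addSn; apply: zlc; lia.
    apply: (Rmult_le_reg_r (z J.+1)); first exact: zj.
    by apply: Rle_trans h1 _; rewrite addSn -yq; lra.
  have := h (J - s)%N; rewrite subnK // => /(_ (leqnn J)) hs.
  have -> : y ^ J = y ^ (J - s) * y ^ s by rewrite -pow_add; congr (y ^ _); lia.
  rewrite -Rmult_assoc.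
  have hb := bernoulli_le s (x := e).
  have h2 : (1 - e) ^ s <= y ^ s by apply: pow_incr; lra.
  have : 1 / 2 <= y ^ s by have := hb ltac:(lra); lra.
  move=> h3; have : 2 * (1 / 2) <= z J * y ^ (J - s) * y ^ s.
    by apply: Rmult_le_compat => //; [lra|lra|exact: Rle_trans zs2 hs].
  lra.
exists (fun j => if j is 0%N then 1 else Y j), J, (z J / z 1%N); split.
- by [].
- by case=> [|i] //; lra.
- case=> [|i]; last exact: Ylc.
  by apply: Rle_trans (Ylc 0%N); apply: Rmult_le_compat_r => //; exact/Rlt_le/Ypos.
- by case=> [|j] Jj; [lia|rewrite /Y ltnNge Jj].
move=> j; have z1 := zj 1%N isT.
have hC : z J <= z J / z 1%N * z j.+1.
  have -> : z J / z 1%N * z j.+1 = z J * (z j.+1 / z 1%N) by field; lra.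
  rewrite -{1}[z J]Rmult_1_r; apply: Rmult_le_compat_l; first lra.
  apply: (Rmult_le_reg_r (z 1%N)) => //; have -> : z j.+1 / z 1%N * z 1%N = z j.+1 by field; lra.
  by rewrite Rmult_1_l; apply: zmono_le.
rewrite /Y; case: ltnP => h.
  apply: Rle_trans hC; rewrite -[X in _ <= X]Rmult_1_r; apply: Rmult_le_compat_l; first lra.
  rewrite -(pow1 (J - j.+1)); apply: pow_incr; lra.
rewrite -{1}[z j.+1]Rmult_1_l; apply: Rmult_le_compat_r; first exact/Rlt_le.
apply: (Rmult_le_reg_r (z 1%N)) => //; have -> : z J / z 1%N * z 1%N = z J by field; lra.
by rewrite Rmult_1_l; apply: zmono_le.
Qed.

End Majorant.

(** * Monotonicity and ratio limit for the modified model *)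

Section RatioLimit.
Variable Z : nat -> R.
Hypotheses (Z0 : Z 0%N = 1) (Zpos : forall i, 0 < Z i).
Hypothesis Zlc : forall i, Z i * Z i.+2 <= Z i.+1 ^ 2.
Hypothesis Zunb : forall B, exists n, forall j, (n <= j)%N -> B < Z j.
Hypothesis Zsum : summable_inside Z.
Let p := hn Z.
Let ppos n : 0 < p n.
Proof. by apply: hn_gt0. Qed.
Let plc n : p n * p n.+2 <= p n.+1 ^ 2.
Proof. exact: hn_log_concave. Qed.

(** The ratios p_i / p_(i+1) increase with i, so a bound at [n] holds at all smaller indices. *)
Lemma hn_ratio_pow n k x : (k <= n)%N -> 0 < x -> p n <= x * p n.+1 ->
  p (n - k) <= x ^ k.+1 * p n.+1.
Proof.
move=> kn x0 h; elim: k kn => [|k IH] kn; first by rewrite subn0 pow_1.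
have {}IH := IH (ltnW kn).
have h1 : p (n - k.+1) * p n.+1 <= p (n - k.+1).+1 * p n.
  by apply: log_concave_ratio => //; lia.
move: h1; rewrite (_ : (n - k.+1).+1 = (n - k)%N); last by lia.
move=> h1; have pn := ppos n.+1.
have h2 : p (n - k.+1) * p n.+1 <= x * p (n - k)%N * p n.+1.
  by apply: Rle_trans h1 _; have := Rmult_le_compat_l _ _ _ (Rlt_le _ _ (ppos (n - k)%N)) h; lra.
have h3 : p (n - k.+1) <= x * p (n - k)%N by apply: (Rmult_le_reg_r (p n.+1)).
apply: Rle_trans h3 _; rewrite -(tech_pow_Rmult x k.+1) Rmult_assoc.
by apply: Rmult_le_compat_l; lra.
Qed.

(** A single descent would force geometric decay from there on and keep m p_m bounded; but m p_m >=
    Z_m, which is unbounded. *)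
Lemma hn_nondecreasing n : p n <= p n.+1.
Proof.
apply: Rnot_lt_le => h.
pose r := p n.+1 / p n.
have r0 : 0 < r by apply: Rdiv_lt_0_compat.
have rn : r * p n = p n.+1 by rewrite /r; field; have := ppos n; lra.
have r1 : r < 1 by apply: (Rmult_lt_reg_r (p n)) => //; lra.
have geo d : p (d + n)%N <= r ^ d * p n.
  elim: d => [|d IH]; first by rewrite add0n /=; lra.
  have h1 : p n * p (d + n).+1 <= p n.+1 * p (d + n)%N by apply: log_concave_ratio => //; lia.
  have h2 : p (d + n).+1 <= r * p (d + n)%N.
    by apply: (Rmult_le_reg_l (p n)) => //; rewrite -rn in h1; lra.
  rewrite addSn -tech_pow_Rmult Rmult_assoc; apply: Rle_trans h2 _.
  by apply: Rmult_le_compat_l; lra.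
have dr d : INR d * r ^ d <= / (1 - r).
  have hs : (1 - r) * (INR d * r ^ d) <= 1 - r ^ d.
    elim: d => [|d IH]; first by rewrite /=; lra.
    rewrite S_INR -tech_pow_Rmult.
    have := pow_lt _ d r0; have := pos_INR d => hd hp.
    have : r * ((1 - r) * (INR d * r ^ d)) <= 1 * ((1 - r) * (INR d * r ^ d)).
      apply: Rmult_le_compat_r; last lra.
      by apply: Rmult_le_pos; [lra|apply: Rmult_le_pos; lra].
    have : r ^ d * ((1 - r) * r) <= r ^ d * ((1 - r) * 1) by apply: Rmult_le_compat_l; nra.
    lra.
  apply: (Rmult_le_reg_l (1 - r)); first lra.
  by rewrite Rinv_r; [have := pow_lt _ d r0; lra|lra].
have [M hM] := Zunb ((/ (1 - r) + INR n) * p n).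
have hZ k : Z k.+1 <= INR k.+1 * p k.+1.
  rewrite /p hnS big_ord_recr /= subnn hn0 Rmult_1_r.
  set X := \big[_/_]_(_ < _) _; suff : 0 <= X by lra.
  by apply: rsum_ge0 => i; apply/Rlt_le/Rmult_lt_0_compat => //; exact: ppos.
pose d := M.+1; pose m := (d + n)%N.
have hm : INR m * p m <= (/ (1 - r) + INR n) * p n.
  rewrite /m plus_INR; apply: (Rle_trans _ ((INR d + INR n) * (r ^ d * p n))).
    by apply: Rmult_le_compat_l => //; have := pos_INR d; have := pos_INR n; lra.
  rewrite -Rmult_assoc; apply: Rmult_le_compat_r; first exact/Rlt_le.
  have hr : r ^ d <= 1 by rewrite -(pow1 d); apply: pow_incr; lra.
  have := dr d; have := Rmult_le_compat_l _ _ _ (pos_INR n) hr; lra.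
have := hM m ltac:(rewrite /m /d; lia); have := hZ (M + n)%N; rewrite -[(M + n).+1]/m; lra.
Qed.

(** The ratios increase, so one index suffices. If all stayed below x, the recursion would bound n +
    1 by the sum of Z_(k+1) x^k over k <= n, which is bounded. *)
Lemma hn_ratio_to_one x : x < 1 -> exists n0, forall n, (n0 <= n)%N -> x * p n.+1 <= p n.
Proof.
move=> x1; case: (Rle_lt_dec x 0) => x0.
  exists 0%N => n _; have := ppos n; have := ppos n.+1; nra.
case: (Classical_Prop.classic (exists n, x * p n.+1 <= p n)) => [[n hn]|H].
  exists n => m /subnK <-; elim: (m - n)%N => [|d IH]; first by rewrite add0n.
  rewrite addSn; have h := plc (d + n)%N.
  apply: (Rmult_le_reg_l (p (d + n).+1)); first exact: ppos.
  have := Rmult_le_compat_r _ _ _ (Rlt_le _ _ (ppos (d + n).+2)) IH; lra.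
exfalso; have [B hB] := Zsum (x := x) ltac:(lra).
have [n hn] := INR_unbounded B.
have hn1 : p n <= x * p n.+1 by apply: Rnot_lt_le => h; apply: H; exists n; lra.
have pn := ppos n.+1.
have : INR n.+1 * p n.+1 <= B * p n.+1.
  rewrite hnS; apply: (Rle_trans _ ((\rsum_(k < n.+1) (Z k.+1 * x ^ k)) * p n.+1)); last first.
    by apply: Rmult_le_compat_r; [lra|exact: hB].
  rewrite rsumMr; apply: rsum_le => k.
  rewrite Rmult_assoc; apply: Rmult_le_compat_l; first exact/Rlt_le.
  have kn : (k <= n)%N by have := ltn_ord k; lia.
  apply: Rle_trans (hn_ratio_pow kn x0 hn1) _; apply: Rmult_le_compat_r; first lra.
  by rewrite -tech_pow_Rmult; have := pow_lt _ k x0; nra.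
move/(Rmult_le_reg_r _ _ _ pn); rewrite S_INR; lra.
Qed.

End RatioLimit.

(** * Permutations with prescribed numbers of short cycles *)

Section CycleCounts.
Variables (tau : nat -> R) (K : nat).

Definition cut : nat -> R := fun j => if (j <= K)%N then 0 else tau j.

Definition matches (m c : nat -> nat) : R :=
  if all (fun j => c j == m j) (iota 1 K) then 1 else 0.

Definition lower (k : nat) (m : nat -> nat) : nat -> nat := fun j => (m j - (j == k))%N.

Definition total (m : nat -> nat) : nat := (\sum_(j < K) j.+1 * m j.+1)%N.

(** The product of the Poisson masses without their exponential factors. *)
Definition poisson_weight (m : nat -> nat) : R :=
  \rprod_(j < K) ((tau j.+1 / INR j.+1) ^ m j.+1 / INR (m j.+1)`!).

Lemma matches_bump m c k : matches m (bump_at k.+1 c) =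
  if (k < K)%N then (if m k.+1 == 0%N then 0 else matches (lower k.+1 m) c) else matches m c.
Proof.
rewrite /matches /bump_at /lower; case: ltnP => kK; last first.
  congr (if _ then _ else _); apply: eq_in_all => j; rewrite mem_iota => hj.
  by rewrite (_ : (j == k.+1) = false) ?addn0 //; apply/eqP; lia.
case: eqP => m0.
  rewrite ifF //; apply/negbTE/allPn; exists k.+1; first by rewrite mem_iota; lia.
  by rewrite m0 eqxx addn1.
congr (if _ then _ else _); apply: eq_in_all => j _; case: (j =P k.+1) => [->|_].
  by apply/eqP/eqP; lia.
by rewrite addn0 subn0.
Qed.

Definition constrained (n : nat) (m : nat -> nat) : R := avg n (fun c => wt tau n c * matches m c).

Lemma constrainedS n m : INR n.+1 * constrained n.+1 m = \rsum_(k < n.+1) (tau k.+1 *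
  (if (k < K)%N then (if m k.+1 == 0%N then 0 else constrained (n - k) (lower k.+1 m))
   else constrained (n - k) m)).
Proof.
rewrite avgS; apply: eq_bigr => k _.
have h m' : avg (n - k) (fun c => wt tau n.+1 (bump_at k.+1 c) * matches m' c) =
   tau k.+1 * constrained (n - k) m'.
  rewrite /constrained /avg -Rmult_assoc (Rmult_comm (tau _)) Rmult_assoc; congr (_ * _).
  rewrite big_distrr /=; apply: eq_bigr => s _.
  by rewrite wt_bump // (@wt_stable tau n.+1) ?Rmult_assoc //; lia.
have e m' : (forall c, matches m (bump_at k.+1 c) = matches m' c) ->
   avg (n - k) (fun c => wt tau n.+1 (bump_at k.+1 c) * matches m (bump_at k.+1 c)) =
   tau k.+1 * constrained (n - k) m'.
  by move=> H; rewrite -h /avg; congr (_ * _); apply: eq_bigr => s _; rewrite H.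
case: ifP => kK; last by apply: e => c; rewrite matches_bump kK.
case: ifP => m0; last by apply: e => c; rewrite matches_bump kK m0.
by rewrite /avg big1 => [|s _]; rewrite ?matches_bump ?kK ?m0; ring.
Qed.

Lemma poisson_weight_lower k m : (k < K)%N -> m k.+1 <> 0%N ->
  INR (k.+1 * m k.+1) * poisson_weight m = tau k.+1 * poisson_weight (lower k.+1 m).
Proof.
move=> kK mk; rewrite /poisson_weight (bigD1 (Ordinal kK)) //= [in RHS](bigD1 (Ordinal kK)) //= /lower eqxx.
rewrite [in RHS](eq_bigr (fun j : 'I_K => (tau j.+1 / INR j.+1) ^ m j.+1 / INR (m j.+1)`!)); last first.
  move=> j hj; rewrite (_ : (j.+1 == k.+1) = false) ?subn0 //.
  by apply/negbTE; apply: contra hj => /eqP[e]; apply/eqP/val_inj.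
move: (\big[_/_]_(_ < _ | _) _) => P.
case: (m k.+1) mk => // d _; rewrite -/(INR k.+1) subSS subn0 factS !mult_INR -tech_pow_Rmult.
have : 0 < INR k.+1 by apply: lt_0_INR; lia.
have : 0 < INR d.+1 by apply: lt_0_INR; lia.
have : 0 < INR d`! by apply: lt_0_INR; have := fact_gt0 d; lia.
move: (INR k.+1) (INR d.+1) (INR d`!) => x y z hz hy hx.
by move: (_ ^ d) => u; field; lra.
Qed.

Lemma total_lower k m : (k < K)%N -> m k.+1 <> 0%N -> (total (lower k.+1 m) + k.+1 = total m)%N.
Proof.
move=> kK mk; rewrite /total (bigD1 (Ordinal kK)) //= [in RHS](bigD1 (Ordinal kK)) //= /lower eqxx.
rewrite (eq_bigr (fun j : 'I_K => j.+1 * m j.+1)%N); last first.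
  move=> j hj; rewrite (_ : (j.+1 == k.+1) = false) ?subn0 //.
  by apply/negbTE; apply: contra hj => /eqP[e]; apply/eqP/val_inj.
by case: (m k.+1) mk => // d _; rewrite subSS subn0 mulnS; lia.
Qed.

Lemma INR_total m : INR (total m) = \rsum_(k < K) INR (k.+1 * m k.+1).
Proof. by rewrite /total; elim/big_rec2: _ => // i x y _ <-; rewrite plus_INR. Qed.

Lemma total_ge m k : (k < K)%N -> (k.+1 * m k.+1 <= total m)%N.
Proof. by move=> kK; rewrite /total (bigD1 (Ordinal kK)) //= leq_addr. Qed.

Lemma total_trunc n m : (total m <= n.+1)%N ->
  INR (total m) = \rsum_(k < n.+1) (if (k < K)%N then INR (k.+1 * m k.+1) else 0).
Proof.
move=> h; rewrite INR_total.
rewrite -(rsum_trunc (fun k => INR (k.+1 * m k.+1)) (leq_addr n.+1 K)).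
rewrite -(rsum_trunc (fun k => if (k < K)%N then INR (k.+1 * m k.+1) else 0) (leq_addl K n.+1)).
apply: eq_bigr => k _; case: (ltnP k K) => kK; last by case: ifP.
case: ltnP => // nk; have := total_ge m kK.
by case: (m k.+1) => [|d]; [rewrite muln0|rewrite mulnS; lia].
Qed.

Lemma constrained0 m : constrained 0 m = poisson_weight m * hz cut (total m) 0.
Proof.
rewrite /constrained /avg (eq_bigr (fun=> matches m (fun=> 0%N))) => [|s _]; last first.
  rewrite /wt big_ord0 Rmult_1_l; congr matches; apply: functional_extensionality => j.
  by apply: eq_card0 => C; rewrite !inE; apply/negP => /andP[/imsetP[[]]].
rewrite big_const card_Sn /= Rinv_1 Rplus_0_r Rmult_1_l /matches.
case: ifP => [/allP h|/negbT/allPn[j]].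
  have m0 j : (j < K)%N -> m j.+1 = 0%N by move=> jK; apply/esym/eqP/h; rewrite mem_iota; lia.
  rewrite /poisson_weight big1 => [|j _]; last by rewrite m0 //= /Rdiv Rinv_1 Rmult_1_r.
  by rewrite /total big1 => [|j _]; rewrite ?m0 ?muln0 // /hz /= hn0; ring.
rewrite mem_iota => /andP[j1 jK] m0; have jK' : (j.-1 < K)%N by lia.
have mj : (0 < m j)%N by rewrite lt0n eq_sym.
rewrite /hz ifF ?Rmult_0_r //; apply/negbTE; rewrite -ltnNge.
by apply: leq_trans (total_ge m jK'); rewrite prednK // muln_gt0 j1.
Qed.

(** In generating functions: from exp(tau_j z^j / j) with j <= K only the term of exponent m_j is
    kept, and [cut] supplies all longer cycles. Both sides satisfy the recursion [constrainedS]. *)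
Lemma constrainedE n m : constrained n m = poisson_weight m * hz cut (total m) n.
Proof.
elim: n {-2}n (leqnn n) m => [|N IH] [|n] // nN m; try exact: constrained0.
have h1 : 0 < INR n.+1 by apply: lt_0_INR; lia.
apply: (Rmult_eq_reg_l (INR n.+1)); last lra.
rewrite constrainedS; set S := total m.
(* The part n + 1 - S accounts for [ord0] in a long cycle, the part S = sum j m_j for [ord0] in a
   short one. *)
have -> : INR n.+1 * (poisson_weight m * hz cut S n.+1) =
  poisson_weight m * ((INR n.+1 - INR S) * hz cut S n.+1) +
  INR S * (poisson_weight m * hz cut S n.+1) by ring.
have -> : INR S * (poisson_weight m * hz cut S n.+1) =
   \rsum_(k < n.+1) ((if (k < K)%N then INR (k.+1 * m k.+1) else 0) * (poisson_weight m * hz cut S n.+1)).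
  rewrite -rsumMr; case: (leqP S n.+1) => hS; first by rewrite -total_trunc.
  by rewrite /hz (leqNgt S) hS /= !Rmult_0_r.
rewrite hzS rsumMl -rsumD; apply: eq_bigr => k _; have kn := ltn_ord k.
have -> : cut k.+1 = if (k < K)%N then 0 else tau k.+1 by [].
case: ifP => kK; last by rewrite IH -/S; [ring|lia].
rewrite Rmult_0_l Rmult_0_r Rplus_0_l.
case: eqP => m0; first by rewrite m0 muln0 /=; ring.
rewrite IH; last by lia.
rewrite -!Rmult_assoc poisson_weight_lower //; congr (_ * _).
have := total_lower kK m0; rewrite -/S => <-; rewrite /hz.
have -> : (total (lower k.+1 m) + k.+1 <= n.+1)%N = (total (lower k.+1 m) <= n - k)%N by lia.
by case: ifP => // _; congr hn; lia.
Qed.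

End CycleCounts.

Lemma Prob_avg tau n (E : pred {perm 'I_n}) :
  Prob tau E = / INR n`! * \big[Rplus/0]_(s : {perm 'I_n}) (if E s then weight tau s else 0) / hn tau n.
Proof.
rewrite /Prob Rsum_perm -big_mkcond /= /Rdiv Rmult_comm -Rmult_assoc big_distrr /=.
apply: eq_bigr => s _; rewrite /Pn /Rdiv Rinv_mult; ring.
Qed.

Lemma Prob_counts tau n K (m : nat -> nat) :
  Prob tau (fun s : {perm 'I_n} => all (fun j => Rcyc j s == m j) (iota 1 K)) =
  poisson_weight tau K m * hz (cut tau K) (total K m) n / hn tau n.
Proof.
rewrite Prob_avg -constrainedE /constrained /avg; congr (_ * _ / _).
by apply: eq_bigr => s _; rewrite weight_wt /matches; case: ifP; rewrite ?Rmult_1_r ?Rmult_0_r.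
Qed.

Lemma Prob_L1 tau n (P : pred nat) :
  Prob tau (fun s : {perm 'I_n.+1} => P (L1 s)) =
  (\rsum_(k < n.+1) (if P k.+1 then tau k.+1 * hn tau (n - k) else 0)) / (INR n.+1 * hn tau n.+1).
Proof.
have h1 : 0 < INR n.+1 by apply: lt_0_INR; lia.
rewrite Prob_avg /Rdiv Rinv_mult -!Rmult_assoc; congr (_ * _).
apply: (Rmult_eq_reg_l (INR n.+1)); last lra.
rewrite (Rmult_comm _ (/ INR n.+1)) -!(Rmult_assoc (INR n.+1)) Rinv_r; last lra.
rewrite Rmult_1_l.
have := sum_by_L1 n (fun k c => if P k then wt tau n.+1 c else 0); rewrite Rmult_assoc.
rewrite (eq_bigr (fun s : {perm 'I_n.+1} => if P (L1 s) then weight tau s else 0)) => [->|s _]; last first.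
  by rewrite weight_wt.
apply: eq_bigr => k _; rewrite /avg; case: ifP => _; last by rewrite big1 //; ring.
rewrite -(@avg_wt tau n.+1); last by lia.
rewrite /avg (eq_bigr (fun s => tau k.+1 * wt tau n.+1 (fun j => Rcyc j s))) => [|s _].
  by rewrite -big_distrr /= -!Rmult_assoc (Rmult_comm (/ _)).
by rewrite wt_bump.
Qed.

(** * Perturbing finitely many parameters *)

Lemma rsumS (f : nat -> R) n : \rsum_(i < n.+1) f i = \rsum_(i < n) f i + f n.
Proof. exact: big_ord_recr. Qed.

Lemma rsum_tail_bound (f g : nat -> R) Q M : (Q <= M)%N -> (forall q, Rabs (f q) <= g q) ->
  Rabs (\rsum_(q < M) f q - \rsum_(q < Q) f q) <= \rsum_(q < M) g q - \rsum_(q < Q) g q.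
Proof.
move=> /subnK <- fg; elim: (M - Q)%N => [|d IH].
  by rewrite add0n !Rminus_diag Rabs_R0; lra.
rewrite addSn !rsumS; have h := fg (d + Q)%N.
apply: Rle_trans (_ : Rabs (\rsum_(q < d + Q) f q - \rsum_(q < Q) f q) + Rabs (f (d + Q)%N) <= _).
  by apply: Rle_trans (Rabs_triang _ _); apply: Req_le; congr Rabs; ring.
by lra_sum.
Qed.

(** Dominated convergence for series, with a range that grows together with n, as in [hn_shift]. *)
Lemma tannery (a : nat -> R) (w : nat -> nat -> R) (S s B U : R) :
  rser (fun q => Rabs (a q)) S -> rser a s -> (forall q n, Rabs (w q n) <= B) ->
  (forall q, is_lim_seq (w q) U) ->
  is_lim_seq (fun n => \rsum_(q < n.+1) (a q * w q n)) (s * U).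
Proof.
move=> hS hs wB wU; apply/is_lim_seq_spec => eps /=.
have e0 := cond_pos eps.
have B0 : 0 <= B by apply: Rle_trans (wB 0%N 0%N); exact: Rabs_pos.
pose e1 := eps / (3 * (B + 1)); have e10 : 0 < e1 by apply: Rdiv_lt_0_compat; lra.
pose e2 := eps / (3 * (Rabs U + 1)); have U0 := Rabs_pos U.
have e20 : 0 < e2 by apply: Rdiv_lt_0_compat; lra.
have [Q1 hQ1] := (is_lim_seq_spec _ _).2 hS (mkposreal _ e10).
have [Q2 hQ2] := (is_lim_seq_spec _ _).2 hs (mkposreal _ e20).
pose Q := maxn Q1 Q2.
have e30 : 0 < eps / 3 by lra.
have hfin : is_lim_seq (fun n => \rsum_(q < Q) (a q * w q n)) (\rsum_(q < Q) (a q * U)).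
  apply: (lim_rsum (F := fun n q => a q * w q n) (l := fun q => a q * U)) => q.
  by apply: is_lim_seq_mult' (is_lim_seq_const _) (wU q).
have [N hN] := (is_lim_seq_spec _ _).2 hfin (mkposreal _ e30).
exists (maxn N Q) => n Nn.
have h1 := hQ1 Q ltac:(rewrite /Q; lia); have h2 := hQ2 Q ltac:(rewrite /Q; lia).
have h3 := hN n ltac:(lia); rewrite /= in h1 h2 h3.
have h4 := @rsum_tail_bound (fun q => a q * w q n) (fun q => Rabs (a q) * B) Q n.+1 ltac:(lia).

have {}h4 : Rabs (\rsum_(q < n.+1) (a q * w q n) - \rsum_(q < Q) (a q * w q n)) <=
   \rsum_(q < n.+1) (Rabs (a q) * B) - \rsum_(q < Q) (Rabs (a q) * B).
  by apply: h4 => q; rewrite Rabs_mult; apply: Rmult_le_compat_l; [exact: Rabs_pos|].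
rewrite -!rsumMr in h3 h4.
set T := \rsum_(q < n.+1) _ in h4 *; set T' := \rsum_(q < Q) (a q * w q n) in h3 h4.
have hA := rser_le n.+1 (fun q => Rabs_pos (a q)) hS.
move: hA h1 h2 h3 h4.
set A1 := \big[_/_]_(q < n.+1) Rabs _; set A2 := \big[_/_]_(q < Q) Rabs _.
set A3 := \big[_/_]_(q < Q) a q => hA /Rabs_def2 h1 h2 h3 h4.
have h5 : Rabs (T - T') < eps / 3.
  apply: Rle_lt_trans h4 _; apply: (Rle_lt_trans _ (e1 * B)).
    by rewrite -Rmult_minus_distr_r; apply: Rmult_le_compat_r; lra.
  have : e1 * (B + 1) = eps / 3 by rewrite /e1; field; lra.
  lra.
have h6 : Rabs (A3 * U - s * U) < eps / 3.
  rewrite -Rmult_minus_distr_r Rabs_mult; apply: (Rle_lt_trans _ (e2 * Rabs U)).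
    by apply: Rmult_le_compat_r; lra.
  have : e2 * (Rabs U + 1) = eps / 3 by rewrite /e2; field; lra.
  lra.
move/Rabs_def2: h3 => h3; move/Rabs_def2: h5 => h5; move/Rabs_def2: h6 => h6.
by apply: Rabs_def1; lra.
Qed.

Lemma hn_ext (t1 t2 : nat -> R) n : (forall j, t1 j.+1 = t2 j.+1) -> hn t1 n = hn t2 n.
Proof.
move=> e; apply: hn_unique => [|k]; first exact: hn0.
by rewrite hnS; apply: eq_bigr => i _; rewrite e.
Qed.

Section Perturbation.
Variable p : nat -> R.
Hypotheses (ppos : forall n, 0 < p n) (pmono : forall n, p n <= p n.+1).
Hypothesis pratio : forall x, x < 1 -> exists n0, forall n, (n0 <= n)%N -> x * p n.+1 <= p n.

Let pmono_le i j : (i <= j)%N -> p i <= p j.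
Proof.
move=> /subnK <-; elim: (j - i)%N => [|d IH]; first by rewrite add0n; lra.
by apply: Rle_trans IH _; rewrite addSn; exact: pmono.
Qed.

Lemma lim_ratio S : is_lim_seq (fun n => p n / p (n + S)%N) 1.
Proof.
have one : is_lim_seq (fun n => p n / p n.+1) 1.
  apply/is_lim_seq_spec => eps /=.
  have [n0 h] := pratio (x := 1 - eps / 2) ltac:(have := cond_pos eps; lra).
  exists n0 => n hn; have e0 := cond_pos eps.
  have := h n ltac:(lia); have := pmono n; have := ppos n; have := ppos n.+1 => h1 h2 h3 h4.
  have E : p n / p n.+1 * p n.+1 = p n by field; lra.
  have : 1 - eps / 2 <= p n / p n.+1 by apply: (Rmult_le_reg_r (p n.+1)) => //; lra.
  have : p n / p n.+1 <= 1 by apply: (Rmult_le_reg_r (p n.+1)) => //; lra.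
  by move=> h5 h6; apply: Rabs_def1; lra.
elim: S => [|S IH].
  apply: (lim_ext (is_lim_seq_const 1)) => n; rewrite addn0; have := ppos n => ?; field; lra.
have h := is_lim_seq_incr_n _ S 1; have {}h := (h (fun n => p n / p n.+1)).1 one.
rewrite -[1]Rmult_1_r; apply: (lim_ext (is_lim_seq_mult' _ _ _ _ IH h)) => n.
rewrite -[(n + S)%coq_nat]/(n + S)%N addnS.
have := ppos (n + S)%N; have := ppos (n + S).+1 => ? ?; field; lra.
Qed.

Definition tends (tau : nat -> R) (U : R) : Prop := is_lim_seq (fun n => hn tau n / p n) U.

Lemma tends_hz tau U S : tends tau U -> is_lim_seq (fun n => hz tau S n / p n) U.
Proof.
move=> h; apply/(is_lim_seq_incr_n _ S).
rewrite -[U]Rmult_1_r; apply: (lim_ext (is_lim_seq_mult' _ _ _ _ h (lim_ratio S))) => n.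
rewrite -[(n + S)%coq_nat]/(n + S)%N /hz leq_addl addnK.
have := ppos (n + S)%N; have := ppos n => ? ?; field; lra.
Qed.

Lemma tends_bounded tau U : tends tau U -> exists B, forall n, Rabs (hn tau n) <= B * p n.
Proof.
move=> h; have [n0 h0] := (is_lim_seq_spec _ _).2 h (mkposreal 1 Rlt_0_1).
pose B0 := \rsum_(i < n0) (Rabs (hn tau i) / p i).
have terms i : 0 <= Rabs (hn tau i) / p i.
  by apply: Rmult_le_pos; [exact: Rabs_pos|exact/Rlt_le/Rinv_0_lt_compat].
have B00 : 0 <= B0 by apply: rsum_ge0 => i; exact: terms.
exists (B0 + (Rabs U + 1)) => n; have pn := ppos n; have U0 := Rabs_pos U.
have hE : Rabs (hn tau n) = Rabs (hn tau n) / p n * p n by field; lra.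
rewrite hE; apply: Rmult_le_compat_r; first lra.
case: (ltnP n n0) => hn.
  apply: (Rle_trans _ B0); last lra.
  rewrite /B0 (bigD1 (Ordinal hn)) //=; set X := \big[_/_]_(_ | _) _; suff : 0 <= X by lra.
  by apply: big_ind => [|a b *|i _]; [lra|lra|exact: terms].
have := h0 n ltac:(lia) => /= h1.
have -> : Rabs (Defs.hn tau n) / p n = Rabs (Defs.hn tau n / p n).
  by rewrite Rabs_div ?(Rabs_pos_eq (p n)) //; lra.
by have := Rabs_triang_inv (Defs.hn tau n / p n) U; lra.
Qed.

(** Multiplication by exp(e z^j / j) is convolution with an absolutely summable sequence. Each
    shifted quotient tends to [U], and all are uniformly bounded because [p] is nondecreasing, so
    [tannery] applies. *)
Lemma tends_shift tau U j e : (0 < j)%N -> tends tau U ->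
  tends (shift_at tau j e) (exp (e / INR j) * U).
Proof.
move=> j0 h; have [B hB] := tends_bounded h; set x := e / INR j.
have B0 : 0 <= B.
  by have := hB 0%N; have := Rabs_pos (hn tau 0); have := ppos 0%N => *; nra.
have hS : rser (fun q => Rabs (x ^ q / INR q`!)) (exp (Rabs x)).
  apply: (lim_ext (rser_exp (Rabs x))) => N; apply: eq_bigr => q _.
  by rewrite Rabs_div ?RPow_abs ?(Rabs_pos_eq (INR _)) //; [exact: pos_INR|have := fact_gt0R q; lra].
have hw q n : Rabs (hz tau (q * j) n / p n) <= B.
  rewrite Rabs_div; last by have := ppos n; lra.
  rewrite (Rabs_pos_eq (p n)); last exact/Rlt_le.
  apply: (Rmult_le_reg_r (p n)) => //.
  have -> : Rabs (hz tau (q * j) n) / p n * p n = Rabs (hz tau (q * j) n).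
    by field; have := ppos n; lra.
  rewrite /hz; case: ifP => _; last by rewrite Rabs_R0; apply: Rmult_le_pos => //; exact/Rlt_le.
  apply: Rle_trans (hB _) _; apply: Rmult_le_compat_l => //; apply: pmono_le; lia.
have := tannery hS (rser_exp x) hw (fun q => tends_hz (q * j) h).
move=> H; apply: (lim_ext H) => n; rewrite hn_shift // -/x /Rdiv rsumMr.
by apply: eq_bigr => q _; ring.
Qed.

Lemma tends_change t1 t2 M U : (forall j, (M < j)%N -> t1 j = t2 j) -> tends t1 U ->
  tends t2 (exp (\rsum_(j < M) ((t2 j.+1 - t1 j.+1) / INR j.+1)) * U).
Proof.
move=> e h.
(* Interpolates between [t1] and [t2], one parameter at a time. *)
pose mix k j := if (j <= k)%N then t2 j else t1 j.
have H k : tends (mix k) (exp (\rsum_(j < k) ((t2 j.+1 - t1 j.+1) / INR j.+1)) * U).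
  elim: k => [|k IH].
    rewrite big_ord0 exp_0 Rmult_1_l; apply: (lim_ext h) => n; congr (_ / _); exact: hn_ext.
  rewrite big_ord_recr /= -/(INR k.+1) exp_plus Rmult_comm -Rmult_assoc.
  rewrite (Rmult_comm U) Rmult_assoc (Rmult_comm U) -Rmult_assoc.
  have := tends_shift (e := t2 k.+1 - t1 k.+1) (ltn0Sn k) IH.
  rewrite -Rmult_assoc (Rmult_comm (exp ((t2 k.+1 - t1 k.+1) / INR k.+1))) => h1.
  apply: (lim_ext h1) => n; congr (_ / _); apply: hn_ext => j.
  rewrite /shift_at /mix eqSS !ltnS; case: (ltngtP j k) => hj.
  - by ring.
  - by ring.
  - by rewrite hj; ring.
apply: (lim_ext (H M)) => n; congr (_ / _); apply: hn_ext => j.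
by rewrite /mix; case: leqP => // hj; apply: e.
Qed.

Lemma poisson_limit theta E K m : 0 < E -> tends theta E ->
  is_lim_seq (fun n => Prob theta (fun s : {perm 'I_n} => all (fun j => Rcyc j s == m j) (iota 1 K)))
    (foldr (fun j acc => poisson_pmf (theta j / INR j) (m j) * acc) 1 (iota 1 K)).
Proof.
move=> E0 h.
(* Forbidding cycles of length at most K multiplies the limit by exp(-sum theta_j / j), the product
   of the Poisson normalisations. *)
have hc := @tends_change theta (cut theta K) K E _ h.
have {}hc : tends (cut theta K) (exp (\rsum_(j < K) ((cut theta K j.+1 - theta j.+1) / INR j.+1)) * E).
  by apply: hc => j hj; rewrite /cut leqNgt hj.
have h1 := tends_hz (total K m) hc.
have hE : Rbar.Finite E <> Rbar.Finite 0 by case; lra.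
have h2 := is_lim_seq_div' _ _ _ _ h1 h ltac:(lra).
have h3 := is_lim_seq_mult' _ _ _ _ (is_lim_seq_const (poisson_weight theta K m)) h2.
have -> : foldr (fun j acc => poisson_pmf (theta j / INR j) (m j) * acc) 1 (iota 1 K) =
  poisson_weight theta K m *
  (exp (\rsum_(j < K) ((cut theta K j.+1 - theta j.+1) / INR j.+1)) * E / E).
  rewrite foldr_prod (_ : exp _ * E / E = exp (\rsum_(j < K) ((cut theta K j.+1 - theta j.+1) / INR j.+1))); last by field; lra.
  have -> : exp (\rsum_(j < K) ((cut theta K j.+1 - theta j.+1) / INR j.+1)) =
     \rprod_(j < K) exp (- (theta j.+1 / INR j.+1)).
    rewrite (@big_morph _ _ exp 1 Rmult 0 Rplus exp_plus exp_0); apply: eq_bigr => j _.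
    by congr exp; rewrite /cut ltn_ord; field; apply: not_0_INR; lia.
  rewrite /poisson_weight -big_split /=; apply: eq_bigr => j _; rewrite /poisson_pmf.
  by rewrite /Rdiv; ring.
apply: (is_lim_seq_ext_loc _ _ _ _ h3); exists 0%N => n _; rewrite Prob_counts.
move: (ppos n) => pn; rewrite /Rdiv Rinv_mult Rinv_inv.
have -> : hz (cut theta K) (total K m) n * / p n * (/ hn theta n * p n) =
   hz (cut theta K) (total K m) n * / hn theta n * (/ p n * p n) by ring.
by rewrite Rinv_l; [ring|lra].
Qed.

End Perturbation.

(** * Tail estimates for the first cycle *)

(** The variable stands for the logarithm of the size; estimates are made for large real l and moved
    to integers by [ev_nat]. *)
Definition ev (P : R -> Prop) : Prop := exists M, forall l, M <= l -> P l.

Lemma ev_and P Q : ev P -> ev Q -> ev (fun l => P l /\ Q l).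
Proof.
move=> [M hM] [M' hM']; exists (Rmax M M') => l hl; split; [apply: hM|apply: hM'].
  exact: Rle_trans (Rmax_l _ _) hl.
exact: Rle_trans (Rmax_r _ _) hl.
Qed.

Lemma ev_imp P Q : ev P -> (forall l, P l -> Q l) -> ev Q.
Proof. by move=> [M hM] PQ; exists M => l hl; apply/PQ/hM. Qed.

Lemma ev_ge B : ev (fun l => B <= l). Proof. by exists B. Qed.

Lemma ev_ln s e : 0 < e -> ev (fun l => s * ln l <= e * l).
Proof.
move=> e0; have s0 := Rabs_pos s.
have := is_lim_div_ln_p; move/is_lim_spec.
have d0 : 0 < e / (Rabs s + 1) by apply: Rdiv_lt_0_compat; lra.
move/(_ (mkposreal _ d0)) => [M hM]; exists (Rmax (M + 1) 1) => l hl.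
have h1 : M < l by have := Rmax_l (M + 1) 1; lra.
have h2 : 1 <= l by have := Rmax_r (M + 1) 1; lra.
have := hM l h1; rewrite /= Rminus_0_r => h3.
have ln0 : 0 <= ln l by rewrite -ln_1; apply: ln_le; lra.
have h4 : ln l <= e / (Rabs s + 1) * l.
  have := Rle_abs (ln l / l) => h5; apply: (Rmult_le_reg_r (/ l)); first by apply: Rinv_0_lt_compat; lra.
  rewrite Rmult_assoc Rinv_r; last lra.
  by rewrite Rmult_1_r; rewrite /Rdiv in h3 h5 *; lra.
apply: (Rle_trans _ (Rabs s * ln l)); first by apply: Rmult_le_compat_r => //; exact: Rle_abs.
apply: (Rle_trans _ ((Rabs s + 1) * ln l)); first lra.
have -> : e * l = (Rabs s + 1) * (e / (Rabs s + 1) * l) by field; lra.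
by apply: Rmult_le_compat_l; lra.
Qed.

Lemma ev_exp k B : 0 < k -> ev (fun l => B <= exp (k * l)).
Proof.
move=> k0; exists (B / k) => l hl; apply: Rle_trans (_ : k * l <= _).
  have -> : B = k * (B / k) by field; lra.
  by apply: Rmult_le_compat_l; lra.
by have := exp_ineq1_le (k * l); lra.
Qed.

Lemma ev_nat P : ev P -> exists n0, forall n, (n0 <= n)%N -> P (ln (INR n.+1)).
Proof.
move=> [M hM]; have [n0 h0] := INR_unbounded (exp M); exists n0 => n hn; apply: hM.
rewrite -[M]ln_exp; apply: ln_le; first exact: exp_pos.
by have := leR hn; rewrite S_INR; lra.
Qed.

(** * The scale delta and the size of the generating function near 1 *)

Section Scale.
Variables a b : R.
Hypotheses (a0 : 0 < a) (b0 : 0 < b).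

(* At [1 - x = del (ln n)] the exponential factor of [gen x] equals [n]. *)
Definition del (l : R) : R := Rpower (a / l) (/ b).

Lemma del_gt0 l : 0 < del l. Proof. exact: exp_pos. Qed.

Lemma ln_del l : 0 < l -> ln (del l) = (ln a - ln l) / b.
Proof. by move=> l0; rewrite /del /Rpower ln_exp ln_div //; field; lra. Qed.

(** With l = ln n this is n^(lam^(-b)) times a power of lam delta, which is only a power of ln n up
    to a constant. *)
Lemma gen_scale lam l : 0 < lam -> 0 < l ->
  gen a b (1 - lam * del l) = exp (- (b / 2 + 1) * ln (lam * del l)) * exp (Rpower lam (- b) * l).
Proof.
move=> lam0 l0; rewrite /gen (_ : 1 - (1 - lam * del l) = lam * del l); last ring.
have d0 := del_gt0 l.
congr (_ * exp _); rewrite -Rpower_mult_distr // -Rmult_assoc (Rmult_comm a) Rmult_assoc.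
congr (_ * _); rewrite /del Rpower_mult (_ : / b * - b = - 1); last by field; lra.
rewrite Rpower_Ropp Rpower_1; last exact: Rdiv_lt_0_compat.
by field; lra.
Qed.

Lemma ev_del_small lam e : 0 < lam -> 0 < e -> ev (fun l => lam * del l <= e).
Proof.
move=> lam0 e0; exists (a * exp (- b * (ln e - ln lam))) => l hl.
have l0 : 0 < l by apply: Rlt_le_trans hl; apply: Rmult_lt_0_compat => //; exact: exp_pos.
have d0 := del_gt0 l.
rewrite -(exp_ln e) // -(exp_ln (lam * del l)); last exact: Rmult_lt_0_compat.
apply: exp_le_compat; rewrite ln_mult // ln_del //.
have h : ln a - b * (ln e - ln lam) <= ln l.
  have <- : ln (a * exp (- b * (ln e - ln lam))) = ln a - b * (ln e - ln lam).
    by rewrite ln_mult ?ln_exp //; [ring|exact: exp_pos].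
  by apply: ln_le => //; apply: Rmult_lt_0_compat => //; exact: exp_pos.
have -> : ln e = ln lam + b * (ln e - ln lam) / b by field; lra.
apply: Rplus_le_compat_l; apply: Rmult_le_compat_r; first exact/Rlt_le/Rinv_0_lt_compat.
lra.
Qed.

Lemma ev_del_log s e : 0 < e -> ev (fun l => s * ln (del l) <= e * l).
Proof.
move=> e0; have h1 := ev_ln (- s / b) (e := e / 2) ltac:(lra).
have h2 := ev_ge (2 * Rabs (s / b * ln a) / e + 1).
apply: ev_imp (ev_and h1 (ev_and h2 (ev_ge 1))) _ => l [h3 [h4 l1]].
rewrite ln_del; last lra.
have -> : s * ((ln a - ln l) / b) = s / b * ln a + - s / b * ln l by field; lra.
have := Rle_abs (s / b * ln a) => h5.
have : Rabs (s / b * ln a) <= e / 2 * l.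
  have -> : Rabs (s / b * ln a) = e / 2 * (2 * Rabs (s / b * ln a) / e) by field; lra.
  by apply: Rmult_le_compat_l; lra.
lra.
Qed.

Lemma ev_gen_ub lam e : 0 < lam -> 0 < e ->
  ev (fun l => gen a b (1 - lam * del l) <= exp ((Rpower lam (- b) + e) * l)).
Proof.
move=> lam0 e0; have h1 := ev_del_log (- (b / 2 + 1)) (e := e / 2) ltac:(lra).
have h2 := ev_ge (2 * Rabs ((b / 2 + 1) * ln lam) / e + 1).
apply: ev_imp (ev_and h1 (ev_and h2 (ev_ge 1))) _ => l [h3 [h4 l1]].
rewrite gen_scale //; last lra.
rewrite -exp_plus; apply: exp_le_compat; rewrite ln_mult //; last exact: del_gt0.
have h5 := Rle_abs (- ((b / 2 + 1) * ln lam)); rewrite Rabs_Ropp in h5.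
have : Rabs ((b / 2 + 1) * ln lam) <= e / 2 * l.
  have -> : Rabs ((b / 2 + 1) * ln lam) = e / 2 * (2 * Rabs ((b / 2 + 1) * ln lam) / e) by field; lra.
  by apply: Rmult_le_compat_l; lra.
lra.
Qed.

Lemma ev_gen_lb lam : 0 < lam ->
  ev (fun l => exp (Rpower lam (- b) * l) <= gen a b (1 - lam * del l)).
Proof.
move=> lam0; apply: ev_imp (ev_and (ev_del_small lam0 Rlt_0_1) (ev_ge 1)) _ => l [h l1].
rewrite gen_scale //; last lra.
rewrite -[X in X <= _]Rmult_1_l; apply: Rmult_le_compat_r; first exact/Rlt_le/exp_pos.
rewrite -[X in X <= _]exp_0; apply: exp_le_compat.
have p0 : 0 < lam * del l by apply: Rmult_lt_0_compat => //; exact: del_gt0.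
have hL : ln (lam * del l) <= 0 by rewrite -ln_1; apply: ln_le.
by have := Rmult_le_compat_l (b / 2 + 1) _ _ ltac:(lra) hL; lra.
Qed.

(** [del l] decays only like a power of l, so n delta exceeds every multiple of ln n; hence (1 - k
    delta)^n is smaller than any given power of n. *)
Lemma ev_del_big k B : 0 < k -> ev (fun l => B * l <= k * del l * exp l).
Proof.
move=> k0.
have h1 := ev_ln 1 (e := / 4) ltac:(lra); have h2 := ev_del_log (- 1) (e := / 4) ltac:(lra).
have h3 := ev_exp (k := / 2) (Rabs B / k) ltac:(lra).
apply: ev_imp (ev_and h1 (ev_and h2 (ev_and h3 (ev_ge 1)))) _ => l [h4 [h5 [h6 l1]]].
have d0 := del_gt0 l.
have hB : Rabs B <= k * exp (/ 2 * l).
  have -> : Rabs B = k * (Rabs B / k) by field; lra.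
  by apply: Rmult_le_compat_l; lra.
have hl : l <= exp (/ 4 * l) by rewrite -{1}[l]exp_ln; [apply: exp_le_compat|]; lra.
have hd : exp (- (/ 4 * l)) <= del l by rewrite -[del l]exp_ln //; apply: exp_le_compat; lra.
apply: (Rle_trans _ (Rabs B * l)); first by apply: Rmult_le_compat_r; [lra|exact: Rle_abs].
apply: (Rle_trans _ (k * exp (/ 2 * l) * exp (/ 4 * l))).
  by apply: Rmult_le_compat => //; [exact: Rabs_pos|lra].
have -> : k * exp (/ 2 * l) * exp (/ 4 * l) = k * exp (- (/ 4 * l)) * exp l.
  rewrite !Rmult_assoc -!exp_plus; congr (_ * exp _); field.
apply: Rmult_le_compat_r; first exact/Rlt_le/exp_pos.
by apply: Rmult_le_compat_l; lra.
Qed.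

End Scale.

(** * Chernoff bounds for the length of the first cycle *)

Section LargeDeviations.
Variables (a b A : R) (theta Z : nat -> R) (J : nat) (E : R).
Hypotheses (a0 : 0 < a) (b0 : 0 < b) (A0 : 0 < A).
Hypothesis theta_pos : forall j, 0 < theta j.+1.
Hypothesis theta_ser : forall x, 0 <= x < 1 -> rser (fun k => theta k.+1 * x ^ k) (A * gen a b x).
Hypotheses (Z0 : Z 0%N = 1) (Zpos : forall i, 0 < Z i).
Hypothesis Zlc : forall i, Z i * Z i.+2 <= Z i.+1 ^ 2.
Hypothesis Ztheta : forall j, (J <= j)%N -> Z j = theta j.
Let p := hn Z.
Hypotheses (E0 : 0 < E) (thetaE : tends p theta E).
Arguments theta_ser : clear implicits.

Let ppos n : 0 < p n.
Proof. by apply: hn_gt0. Qed.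
Let plc n : p n * p n.+2 <= p n.+1 ^ 2.
Proof. exact: hn_log_concave. Qed.

Lemma theta_partial x M : 0 <= x < 1 -> \rsum_(k < M) (theta k.+1 * x ^ k) <= A * gen a b x.
Proof.
move=> hx; apply: (rser_le (f := fun k => theta k.+1 * x ^ k)) (theta_ser x hx) => k.
by apply: Rmult_le_pos; [exact/Rlt_le|apply: pow_le; lra].
Qed.

(** Past [N] the terms at [x] are at most q^N times those at [y], because x^k <= y^k q^k. *)
Lemma gen_split x y q N : 0 <= x < 1 -> 0 <= y < 1 -> 0 <= q <= 1 -> x <= y * q ->
  A * gen a b x <= \rsum_(k < N) (theta k.+1 * x ^ k) + A * gen a b y * q ^ N.
Proof.
move=> hx hy hq hxy.
apply: (is_lim_seq_le_loc _ _ _ _ _ (theta_ser x hx) (is_lim_seq_const _)).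
exists N => M NM; have {}NM : (N <= M)%N by lia.
have qN : 0 <= q ^ N by apply: pow_le; lra.
apply: Rle_trans (Rplus_le_compat_l _ _ _ (Rmult_le_compat_r _ _ _ qN (theta_partial M hy))).
rewrite rsumMr -(rsum_trunc (fun k => theta k.+1 * x ^ k) NM) -rsumD.
apply: rsum_le => k; have tk := Rlt_le _ _ (theta_pos k).
have yk : 0 <= y ^ k by apply: pow_le; lra.
have t2 : 0 <= theta k.+1 * y ^ k * q ^ N by apply: Rmult_le_pos => //; apply: Rmult_le_pos.
case: ltnP => h; first lra.
rewrite Rplus_0_l Rmult_assoc; apply: Rmult_le_compat_l => //.
apply: (Rle_trans _ ((y * q) ^ k)); first by apply: pow_incr; lra.
rewrite Rpow_mult_distr; apply: Rmult_le_compat_l => //.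
rewrite -(subnK h) pow_add -[X in _ <= X]Rmult_1_l; apply: Rmult_le_compat_r => //.
by rewrite -(pow1 (k - N)); apply: pow_incr.
Qed.

Lemma ratio_lower_pow r n : 0 <= r -> r * p n.+1 <= p n ->
  forall m k, (n <= m)%N -> r ^ k * p (m + k)%N <= p m.
Proof.
move=> r0 h m k nm.
have step i : (n <= i)%N -> r * p i.+1 <= p i.
  move=> /subnK <-; elim: (i - n)%N => [|d IH]; first by rewrite add0n.
  rewrite addSn; have h2 := plc (d + n)%N.
  apply: (Rmult_le_reg_l (p (d + n).+1)); first exact: ppos.
  have := Rmult_le_compat_r _ _ _ (Rlt_le _ _ (ppos (d + n).+2)) IH; lra.
elim: k => [|k IH]; first by rewrite addn0 /=; lra.
apply: Rle_trans IH; rewrite addnS -tech_pow_Rmult (Rmult_comm r) Rmult_assoc.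
by apply: Rmult_le_compat_l; [exact: pow_le|apply: step; lia].
Qed.

(* If the ratio at [n] exceeded [r], all later ratios would, and the recursion at index
   [2(n+1)] would bound [gen r] by a constant times [n]. *)
Lemma ratio_bound_sum r n : 0 < r < 1 -> r * p n.+1 <= p n -> (J <= n)%N ->
  r * \rsum_(k < n.+1) (theta k.+1 * r ^ k) <=
  2 * INR n.+1 + \rsum_(k < J) theta k.+1.
Proof.
move=> hr h Jn; set D := \big[_/_]_(k < J) _.
have hZ : r * \rsum_(k < n.+1) (Z k.+1 * r ^ k) <= 2 * INR n.+1.
  have [m mE] : exists m, m = (n.+1 + n)%N by exists (n.+1 + n)%N.
  apply: (Rmult_le_reg_r (p m.+1)); first exact: ppos.
  have -> : 2 * INR n.+1 = INR m.+1 by rewrite mE -addnS plus_INR; ring.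
  rewrite {2}/p hnS rsumMl rsumMr.
  have mm : (n.+1 <= m.+1)%N by lia.
  rewrite -(rsum_trunc (fun k => r * (Z k.+1 * r ^ k) * p m.+1) mm); apply: rsum_le => k.
  case: ifP => hk; last by apply: Rmult_le_pos; exact: Rlt_le.
  have -> : r * (Z k.+1 * r ^ k) * p m.+1 = Z k.+1 * (r ^ k.+1 * p m.+1) by rewrite -tech_pow_Rmult; ring.
  apply: Rmult_le_compat_l; first exact: Rlt_le.
  have hk' : (n <= m - k)%N by lia.
  have := ratio_lower_pow (Rlt_le _ _ hr.1) h k.+1 hk'.
  by rewrite (_ : (m - k + k.+1)%N = m.+1) //; lia.
have hD : \rsum_(k < n.+1) (theta k.+1 * r ^ k) <= \rsum_(k < n.+1) (Z k.+1 * r ^ k) + D.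
  rewrite /D -(rsum_trunc (fun k => theta k.+1) (leqW Jn)) -rsumD; apply: rsum_le => k.
  have rk : 0 <= r ^ k by apply: pow_le; lra.
  have rk1 : r ^ k <= 1 by rewrite -(pow1 k); apply: pow_incr; lra.
  case: ltnP => hk; last by rewrite Ztheta ?Rplus_0_r //; [lra|lia].
  have := Rmult_le_pos _ _ (Rlt_le _ _ (Zpos k.+1)) rk.
  have := Rmult_le_compat_l _ _ _ (Rlt_le _ _ (theta_pos k)) rk1; lra.
have D0 : 0 <= D by apply: rsum_ge0 => k; exact: Rlt_le.
have := Rmult_le_compat_l _ _ _ (Rlt_le _ _ hr.1) hD; nra.
Qed.

(** If the ratio exceeded r = 1 - lam delta with lam = 1 - eta, then [ratio_bound_sum] would keep
    the partial sum at r of order n. But [gen] at r is at least n^mu with mu = lam^(-b) > 1, and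
    [gen_split] shows that the omitted tail is bounded. *)
Lemma ratio_upper eta : 0 < eta < 1 -> exists n0, forall n, (n0 <= n)%N ->
  p n <= (1 - (1 - eta) * del a b (ln (INR n.+1))) * p n.+1.
Proof.
move=> he; set lam := 1 - eta; have lam0 : 0 < lam by rewrite /lam; lra.
have l2 : 0 < lam / 2 by lra.
(* [mu2] belongs to the auxiliary point q = 1 - lam delta / 2 that controls the tail: [gen] at q is
   at most N^mu2, while q^N <= N^(-mu2), where N = n + 1. *)
set mu := Rpower lam (- b); set mu2 := Rpower (lam / 2) (- b) + 1.
have mu1 : 1 < mu.
  rewrite /mu /Rpower -[X in X < _]exp_0; apply: exp_increasing.
  have : ln lam < 0 by rewrite -ln_1; apply: ln_increasing; rewrite /lam; lra.
  nra.
set D := \rsum_(k < J) theta k.+1.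
have D0 : 0 <= D by apply: rsum_ge0 => k; exact: Rlt_le.
have e1 := ev_del_small a0 b0 lam0 (e := / 2) ltac:(lra).
have e2 := ev_del_big a0 b0 mu2 l2.
have e3 := ev_gen_ub a0 b0 l2 Rlt_0_1.
have e4 := ev_gen_lb a0 b0 lam0.
have e5 := ev_exp (k := mu - 1) ((5 + 2 * D + 2 * A) / A) ltac:(lra).
have [n0 hn0] := ev_nat (ev_and e1 (ev_and e2 (ev_and e3 (ev_and e4 (ev_and e5 (ev_ge 0)))))).
exists (maxn n0 J) => n hn; have [] := hn0 n ltac:(lia).
set l := ln (INR n.+1); set d := del a b l => h1 [h2 [h3 [h4 [h5 h6]]]].
have N0 : 0 < INR n.+1 by apply: lt_0_INR; lia.
have Nl : exp l = INR n.+1 by rewrite /l exp_ln.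
have d0 : 0 < d by exact: del_gt0.
apply: Rnot_lt_le => hc.
set r := 1 - lam * d in hc *.
have ld : 0 < lam * d by apply: Rmult_lt_0_compat.
have hr : 0 < r < 1 by rewrite /r; lra.
have hs := ratio_bound_sum hr (Rlt_le _ _ hc) ltac:(lia); rewrite -/D in hs.
pose q := 1 - lam / 2 * d.
have hq : 0 <= q < 1 by rewrite /q; lra.
have hsp := @gen_split r q q n.+1 ltac:(lra) hq ltac:(lra) ltac:(rewrite /r /q; nra).
move: hs hsp; set S := \big[_/_]_(k < n.+1) _ => hs hsp.
have S0 : 0 <= S.
  by apply: rsum_ge0 => k; apply: Rmult_le_pos; [exact: Rlt_le|apply: pow_le; lra].
have hS : S <= 4 * INR n.+1 + 2 * D.
  have : / 2 * S <= r * S by apply: Rmult_le_compat_r; rewrite // /r; lra.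
  lra.
have hqN : q ^ n.+1 <= exp (- (mu2 * l)).
  apply: (Rle_trans _ (exp (- (lam / 2 * d)) ^ n.+1)).
    by apply: pow_incr; split; [lra|have := exp_ineq1_le (- (lam / 2 * d)); rewrite /q; lra].
  rewrite -Rpower_pow; last exact: exp_pos.
  rewrite /Rpower ln_exp -Nl; apply: exp_le_compat; lra.
have tailb : A * gen a b q * q ^ n.+1 <= A.
  rewrite -[X in _ <= X]Rmult_1_r Rmult_assoc; apply: Rmult_le_compat_l; first lra.
  have -> : 1 = exp (mu2 * l) * exp (- (mu2 * l)).
    by rewrite -exp_plus Rplus_opp_r exp_0.
  apply: Rmult_le_compat => //; last by apply: pow_le; lra.
  by apply: Rmult_le_pos; exact/Rlt_le/exp_pos.
have hA : A * exp (mu * l) <= A * gen a b r by apply: Rmult_le_compat_l; [lra|exact: h4].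
have hE : exp (mu * l) = exp ((mu - 1) * l) * INR n.+1 by rewrite -Nl -exp_plus; congr exp; ring.
have N1 : 1 <= INR n.+1 by rewrite -[1]/(INR 1); apply: leR.
have h7 : 5 + 2 * D + 2 * A <= A * exp ((mu - 1) * l).
  have -> : 5 + 2 * D + 2 * A = A * ((5 + 2 * D + 2 * A) / A) by field; lra.
  by apply: Rmult_le_compat_l; lra.
have h8 : (5 + 2 * D + 2 * A) * INR n.+1 <= A * exp (mu * l).
  by rewrite hE -Rmult_assoc; apply: Rmult_le_compat_r; lra.
have := Rmult_le_compat_l _ _ _ D0 N1; have := Rmult_le_compat_l _ _ _ (Rlt_le _ _ A0) N1.
lra.
Qed.

(** On the event, rho^k is traded for X (1 - lam delta)^k; the sum of theta_k (1 - lam delta)^k is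
    then about n^(lam^(-b)), and the factor 1/n in the law of L_1 gives the exponent. The event is
    left arbitrary so that both tails are covered; [X] is the price of the change of base. *)
Lemma L1_tail eta lam e : 0 < eta < 1 -> 0 < lam -> 0 < e -> exists C n0, forall n, (n0 <= n)%N ->
  let l := ln (INR n.+1) in let d := del a b l in
  forall (P : pred nat) X, 0 <= X ->
  (forall k, P k.+1 -> (1 - (1 - eta) * d) ^ k.+1 <= X * (1 - lam * d) ^ k.+1) ->
  Prob theta (fun s : {perm 'I_n.+1} => P (L1 s)) <= C * exp ((Rpower lam (- b) - 1 + e) * l) * X.
Proof.
move=> he lam0 e0.
have [n1 hn1] := ratio_upper he.
have [B hB] := tends_bounded ppos thetaE.
have B0 : 0 <= B by have := hB 0%N; have := Rabs_pos (hn theta 0); have := ppos 0%N => *; nra.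
have e2 : 0 < E / 2 by lra.
have [n2 hn2] := (is_lim_seq_spec _ _).2 thetaE (mkposreal _ e2).
have f1 := ev_gen_ub a0 b0 lam0 e0.
have f2 := ev_del_small a0 b0 lam0 (e := / 2) ltac:(lra).
have f3 := ev_del_small a0 b0 (lam := 1 - eta) (e := / 2) ltac:(lra) ltac:(lra).
have [n3 hn3] := ev_nat (ev_and f1 (ev_and f2 f3)).
exists (2 * A * B / E), (maxn n1 (maxn n2 n3)) => n hge l d P X X0 HP.
have [g1 [g2 g3]] := hn3 n ltac:(lia); rewrite -/l -/d in g1 g2 g3.
have hr := hn1 n ltac:(lia); rewrite -/l -/d in hr.
have hE : E / 2 * p n.+1 <= hn theta n.+1.
  have := hn2 n.+1 ltac:(lia) => /= /Rabs_def2[_ h].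
  have -> : hn theta n.+1 = hn theta n.+1 / p n.+1 * p n.+1.
    by field; have := ppos n.+1; lra.
  by apply: Rmult_le_compat_r; [exact: Rlt_le|lra].
have d0 : 0 < d by exact: del_gt0.
have ld : 0 < lam * d by apply: Rmult_lt_0_compat.
have N0 : 0 < INR n.+1 by apply: lt_0_INR; lia.
have pN := ppos n.+1.
rewrite Prob_L1.
set x := 1 - lam * d in HP g1 *.
have hx : 0 <= x < 1 by rewrite /x; lra.
have hsum : \rsum_(k < n.+1) (if P k.+1 then theta k.+1 * hn theta (n - k) else 0) <=
   B * X * p n.+1 * (A * gen a b x).
  apply: Rle_trans (_ : _ <= B * X * p n.+1 * \rsum_(k < n.+1) (theta k.+1 * x ^ k)) _; last first.
    apply: Rmult_le_compat_l; last exact: theta_partial.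
    by apply: Rmult_le_pos; [exact: Rmult_le_pos|lra].
  rewrite rsumMl; apply: rsum_le => k; have tk := theta_pos k.
  have xk : 0 <= x ^ k by apply: pow_le; lra.
  case: ifP => hk; last first.
    by apply: Rmult_le_pos; [apply: Rmult_le_pos; [exact: Rmult_le_pos|lra]|apply: Rmult_le_pos; lra].
  have -> : B * X * p n.+1 * (theta k.+1 * x ^ k) = theta k.+1 * (B * (X * x ^ k * p n.+1)) by ring.
  apply: Rmult_le_compat_l; first lra.
  apply: Rle_trans (Rle_abs _) _; apply: Rle_trans (hB _) _; apply: Rmult_le_compat_l => //.
  have kn : (k <= n)%N by have := ltn_ord k; lia.
  apply: Rle_trans (hn_ratio_pow Z0 Zpos Zlc kn _ hr) _; first lra.
  apply: Rmult_le_compat_r; first exact: Rlt_le pN.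
  apply: Rle_trans (HP _ hk) _; apply: Rmult_le_compat_l => //.
  rewrite -tech_pow_Rmult -[X in _ <= X]Rmult_1_l; apply: Rmult_le_compat_r; lra.
have hden : 0 < INR n.+1 * hn theta n.+1 by apply: Rmult_lt_0_compat; nra.
apply: (Rmult_le_reg_r (INR n.+1 * hn theta n.+1)) => //.
rewrite /Rdiv Rmult_assoc Rinv_l ?Rmult_1_r; last lra.
apply: Rle_trans hsum _.
have Nl : INR n.+1 = exp l by rewrite /l exp_ln.
set G := exp ((Rpower lam (- b) - 1 + e) * l).
have G0 : 0 < G by exact: exp_pos.
have hG : G * INR n.+1 = exp ((Rpower lam (- b) + e) * l).
  by rewrite Nl /G -exp_plus; congr exp; ring.
apply: (Rle_trans _ (B * X * p n.+1 * (A * (G * INR n.+1)))).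
  apply: Rmult_le_compat_l; first by apply: Rmult_le_pos; [exact: Rmult_le_pos|lra].
  by apply: Rmult_le_compat_l; [lra|rewrite hG].
have -> : B * X * p n.+1 * (A * (G * INR n.+1)) =
   2 * A * B * / E * G * X * (INR n.+1 * (E / 2 * p n.+1)) by field; lra.
apply: Rmult_le_compat_l; last by apply: Rmult_le_compat_l; lra.
have : 0 < / E by exact: Rinv_0_lt_compat.
by move=> iE; apply: Rmult_le_pos => //; apply: Rmult_le_pos; [apply: Rmult_le_pos; [nra|lra]|lra].
Qed.

(** The last premise puts k on the side of the threshold kap b ln n / delta that favours the change
    of base: below it for lam > 1, above it for lam < 1. There X = n^(sig kap b) is admissible with
    sig close to lam - 1, and the exponents add up to nearly [f]. *)
Lemma chernoff_vanish kap lam (P : nat -> pred nat) : 0 < kap -> 0 < lam -> lam <> 1 ->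
  Rpower lam (- b) - 1 + kap * b * (lam - 1) < 0 ->
  (exists n0, forall n k, (n0 <= n)%N -> P n k ->
     (lam - 1) * (del a b (ln (INR n.+1)) * INR k - kap * b * ln (INR n.+1)) <= 0) ->
  is_lim_seq (fun n => Prob theta (fun s : {perm 'I_n.+1} => P n (L1 s))) 0.
Proof.
move=> k0 lam0 lam1 hf [n0 hP].
set f := _ + _ in hf; have kb : 0 < kap * b by apply: Rmult_lt_0_compat.
have al : 0 < Rabs (lam - 1) by apply: Rabs_pos_lt; lra.
(* The three bounds keep 1 - eta positive, give [sig] the sign of lam - 1, and make the error 2 eta
   kap b at most |f|/4. *)
pose eta := Rmin (1 / 2) (Rmin (Rabs (lam - 1) / 4) (- f / (8 * (kap * b)))).
have f8 : 0 < - f / (8 * (kap * b)) by apply: Rdiv_lt_0_compat; lra.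
have eta0 : 0 < eta by repeat apply: Rmin_pos; lra.
have eta1 : eta <= 1 / 2 := Rmin_l _ _.
have eta2 : eta <= Rabs (lam - 1) / 4 := Rle_trans _ _ _ (Rmin_r _ _) (Rmin_l _ _).
have eta3 : eta <= - f / (8 * (kap * b)) := Rle_trans _ _ _ (Rmin_r _ _) (Rmin_r _ _).
have eta4 : eta * (kap * b) <= - f / 8.
  have -> : - f / 8 = - f / (8 * (kap * b)) * (kap * b) by field; lra.
  by apply: Rmult_le_compat_r; lra.
set sig := lam - 1 + 2 * eta.
have e0 : 0 < - f / 4 by lra.
have [C [n1 hn1]] := L1_tail (eta := eta) (lam := lam) (e := - f / 4) ltac:(lra) lam0 e0.
have pow0 : 0 < lam * (Rabs sig + 1) by apply: Rmult_lt_0_compat => //; have := Rabs_pos sig; lra.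
have f1 := ev_del_small a0 b0 pow0 eta0.
have f2 := ev_del_small a0 b0 lam0 (e := / 2) ltac:(lra).
have f4 := ev_del_small a0 b0 Rlt_0_1 Rlt_0_1.
have [n2 hn2] := ev_nat (ev_and f1 (ev_and f2 (ev_and f4 (ev_ge 0)))).
have bound n : (maxn n0 (maxn n1 n2) <= n)%N ->
   Prob theta (fun s : {perm 'I_n.+1} => P n (L1 s)) <= C * exp (f / 2 * ln (INR n.+1)).
  move=> hn; set l := ln (INR n.+1).
  have [g1 [g2 [g4 g3]]] := hn2 n ltac:(lia); rewrite -/l in g1 g2 g3 g4.
  have := hn1 n ltac:(lia) (P n) (exp (sig * (kap * b) * l)) (Rlt_le _ _ (exp_pos _)).
  rewrite -/l; set d := del a b l in g1 g2 g4 * => H.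
  have d0 : 0 < d by exact: del_gt0.
  have ld : 0 < lam * d by apply: Rmult_lt_0_compat.
  (* By exp s >= 1 + s it suffices that the second-order term sig lam d^2 is at most eta d, which
     uses up one of the two [eta] in [sig]. *)
  have base : 1 - (1 - eta) * d <= exp (sig * d) * (1 - lam * d).
    apply: (Rle_trans _ ((1 + sig * d) * (1 - lam * d))); last first.
      by apply: Rmult_le_compat_r; [lra|exact: exp_ineq1_le].
    have hs : sig * (lam * d) <= eta.
      have h1 : sig * (lam * d) <= (Rabs sig + 1) * (lam * d).
        by apply: Rmult_le_compat_r; [lra|have := Rle_abs sig; lra].
      lra.
    have := Rmult_le_compat_r _ _ _ (Rlt_le _ _ d0) hs; rewrite /sig; nra.
  have HH : forall k, P n k.+1 -> (1 - (1 - eta) * d) ^ k.+1 <=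
      exp (sig * (kap * b) * l) * (1 - lam * d) ^ k.+1.
    move=> k hk; have hk' := hP n k.+1 ltac:(lia) hk; rewrite -/l -/d in hk'.
    have xk : 0 <= (1 - lam * d) ^ k.+1 by apply: pow_le; lra.
    have hd1 : (1 - eta) * d <= 1 by nra.
    apply: (Rle_trans _ ((exp (sig * d) * (1 - lam * d)) ^ k.+1)); first by apply: pow_incr; lra.
    rewrite Rpow_mult_distr; apply: Rmult_le_compat_r => //.
    rewrite -Rpower_pow; last exact: exp_pos.
    rewrite /Rpower ln_exp; apply: exp_le_compat.
    set y := d * INR k.+1 - kap * b * l in hk'.
    have hy : sig * y <= 0.
      case: (Rtotal_order lam 1) => [h|[//|h]].
        have y0 : 0 <= y by nra.
        have : sig <= 0 by rewrite /sig; move: eta2; rewrite Rabs_left; lra.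
        nra.
      have y0 : y <= 0 by nra.
      have : 0 <= sig by rewrite /sig; lra.
      nra.
    by move: hy; rewrite /y; lra.
  have {}H := H HH; apply: Rle_trans H _.
  rewrite Rmult_assoc -exp_plus.
  have C0 : 0 <= C \/ C < 0 by lra.
  have hexp : (Rpower lam (- b) - 1 + - f / 4) * l + sig * (kap * b) * l <= f / 2 * l.
    rewrite -Rmult_plus_distr_r; apply: Rmult_le_compat_r => //.
    by rewrite /sig; rewrite /f in eta4 *; lra.
  case: C0 => C0; first by apply: Rmult_le_compat_l => //; exact: exp_le_compat.
  (* A negative [C] is excluded by the empty event, whose probability is 0. *)
  exfalso; have := hn1 n ltac:(lia) pred0 1 ltac:(lra) ltac:(by []).
  rewrite Prob_L1 (rsum0 (F := fun=> 0)) // /Rdiv Rmult_0_l Rmult_1_r.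
  have := exp_pos ((Rpower lam (- b) - 1 + - f / 4) * ln (INR n.+1)).
  by cbv zeta; move=> h1 h2; nra.
apply/is_lim_seq_spec => eps /=; have ep := cond_pos eps.
have [n3 hn3] := ev_nat (ev_exp (k := - f / 2) ((Rabs C + 1) / eps) ltac:(lra)).
exists (maxn n3 (maxn n0 (maxn n1 n2))) => n hn.
have hb := bound n ltac:(lia); have h3 := hn3 n ltac:(lia).
rewrite Rminus_0_r Rabs_pos_eq; last first.
  rewrite Prob_L1; apply: Rmult_le_pos.
    apply: rsum_ge0 => k; case: ifP => _; last lra.
    by apply: Rmult_le_pos; [exact: Rlt_le|exact/Rlt_le/hn_gt0].
  apply/Rlt_le/Rinv_0_lt_compat/Rmult_lt_0_compat; first by apply: lt_0_INR; lia.
  exact: hn_gt0.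
apply: Rle_lt_trans hb _.
set l := ln _ in h3 *.
have ex : exp (f / 2 * l) * exp (- f / 2 * l) = 1 by rewrite -exp_plus -exp_0; congr exp; field.
have p1 := exp_pos (f / 2 * l); have p2 := exp_pos (- f / 2 * l).
have h4 : Rabs C + 1 <= eps * exp (- f / 2 * l).
  have -> : Rabs C + 1 = eps * ((Rabs C + 1) / eps) by field; lra.
  by apply: Rmult_le_compat_l; lra.
apply: (Rmult_lt_reg_r (exp (- f / 2 * l))) => //.
rewrite Rmult_assoc ex; have := Rle_abs C; lra.
Qed.

End LargeDeviations.

(** At lam = 1 - h, tangent bounds for ln and exp give lam^(-b) <= (1 - h)/(1 - (1 + b) h). The
    choice of [h] makes kap (1 - (1 + b) h) = (kap + 1)/2 > 1, which turns this into the strict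
    inequality. *)
Lemma gap_above b kap : 0 < b -> 1 < kap -> exists lam, [/\ 0 < lam, lam < 1 &
  Rpower lam (- b) - 1 + kap * b * (lam - 1) < 0].
Proof.
move=> b0 k1; pose h := (1 - / kap) / (2 * (1 + b)).
have ik : 0 < / kap < 1.
  split; first by apply: Rinv_0_lt_compat; lra.
  by rewrite -Rinv_1; apply: Rinv_lt_contravar; lra.
have h0 : 0 < h by apply: Rdiv_lt_0_compat; lra.
have hE : (1 + b) * h = (1 - / kap) / 2 by rewrite /h; field; lra.
have hb : 0 < b * h by apply: Rmult_lt_0_compat.
have den : 0 < 1 - (1 + b) * h by rewrite hE; lra.
have lam0 : 0 < 1 - h by lra.
exists (1 - h); split => //; first lra.
have lnb : - ln (1 - h) <= h / (1 - h).
  rewrite -ln_Rinv //; rewrite -[X in _ <= X]ln_exp; apply: ln_le; first exact: Rinv_0_lt_compat.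
  have -> : / (1 - h) = 1 + h / (1 - h) by field; lra.
  exact: exp_ineq1_le.
have hu : Rpower (1 - h) (- b) * (1 - (1 + b) * h) <= 1 - h.
  have h1 : Rpower (1 - h) (- b) <= exp (b * h / (1 - h)).
    apply: exp_le_compat; have -> : b * h / (1 - h) = b * (h / (1 - h)) by rewrite /Rdiv; ring.
    by have := Rmult_le_compat_l _ _ _ (Rlt_le _ _ b0) lnb; lra.
  have h2 : exp (b * h / (1 - h)) * (1 - b * h / (1 - h)) <= 1.
    have e := exp_ineq1_le (- (b * h / (1 - h))); have e1 := exp_pos (b * h / (1 - h)).
    have e2 : exp (b * h / (1 - h)) * exp (- (b * h / (1 - h))) = 1.
      by rewrite -exp_plus Rplus_opp_r exp_0.
    by have := Rmult_le_compat_l _ _ _ (Rlt_le _ _ e1) e; lra.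
  have -> : 1 - (1 + b) * h = (1 - b * h / (1 - h)) * (1 - h) by field; lra.
  have h3 : 0 < 1 - b * h / (1 - h).
    apply: (Rmult_lt_reg_r (1 - h)) => //.
    have -> : (1 - b * h / (1 - h)) * (1 - h) = 1 - (1 + b) * h by field; lra.
  lra.
  rewrite -Rmult_assoc -[X in _ <= X]Rmult_1_l; apply: Rmult_le_compat_r; first lra.
  by apply: Rle_trans h2; apply: Rmult_le_compat_r; lra.
apply: (Rmult_lt_reg_r (1 - (1 + b) * h)) => //.
have kk : kap * / kap = 1 by field; lra.
have : (1 - h) - (1 - (1 + b) * h) - kap * b * h * (1 - (1 + b) * h) < 0.
  have -> : (1 - h) - (1 - (1 + b) * h) - kap * b * h * (1 - (1 + b) * h) =
     b * h * (1 - kap * (1 - (1 + b) * h)) by ring.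
  suff : 1 < kap * (1 - (1 + b) * h) by nra.
  by rewrite hE; lra.
lra.
Qed.

Lemma gap_below b kap : 0 < b -> 0 < kap < 1 -> exists lam, 1 < lam /\
  Rpower lam (- b) - 1 + kap * b * (lam - 1) < 0.
Proof.
move=> b0 k1; pose h := (/ kap - 1) / (2 * (1 + b)).
have ik : 1 < / kap by rewrite -Rinv_1; apply: Rinv_lt_contravar; lra.
have h0 : 0 < h by apply: Rdiv_lt_0_compat; lra.
have hE : (1 + b) * h = (/ kap - 1) / 2 by rewrite /h; field; lra.
have hb : 0 < b * h by apply: Rmult_lt_0_compat.
exists (1 + h); split; first lra.
have lnb : h / (1 + h) <= ln (1 + h).
  have : ln (/ (1 + h)) <= / (1 + h) - 1.
    have := exp_ineq1_le (/ (1 + h) - 1); move=> e1.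
    rewrite -[X in _ <= X]ln_exp; apply: ln_le; first by apply: Rinv_0_lt_compat; lra.
    lra.
  rewrite ln_Rinv; last lra.
  have -> : / (1 + h) - 1 = - (h / (1 + h)) by field; lra.
  lra.
have hu : Rpower (1 + h) (- b) * (1 + (1 + b) * h) <= 1 + h.
  have h1 : Rpower (1 + h) (- b) <= exp (- (b * h / (1 + h))).
    apply: exp_le_compat; have -> : b * h / (1 + h) = b * (h / (1 + h)) by rewrite /Rdiv; ring.
    by have := Rmult_le_compat_l _ _ _ (Rlt_le _ _ b0) lnb; lra.
  have h2 : exp (- (b * h / (1 + h))) * (1 + b * h / (1 + h)) <= 1.
    have e := exp_ineq1_le (b * h / (1 + h)); have e1 := exp_pos (- (b * h / (1 + h))).
    have e2 : exp (- (b * h / (1 + h))) * exp (b * h / (1 + h)) = 1.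
      by rewrite -exp_plus Rplus_opp_l exp_0.
    by have := Rmult_le_compat_l _ _ _ (Rlt_le _ _ e1) e; lra.
  have -> : 1 + (1 + b) * h = (1 + b * h / (1 + h)) * (1 + h) by field; lra.
  have h3 : 0 < b * h / (1 + h) by apply: Rdiv_lt_0_compat; lra.
  rewrite -Rmult_assoc -[X in _ <= X]Rmult_1_l; apply: Rmult_le_compat_r; first lra.
  by apply: Rle_trans h2; apply: Rmult_le_compat_r; lra.
apply: (Rmult_lt_reg_r (1 + (1 + b) * h)); first lra.
have kk : kap * / kap = 1 by field; lra.
have : (1 + h) - (1 + (1 + b) * h) + kap * b * h * (1 + (1 + b) * h) < 0.
  have -> : (1 + h) - (1 + (1 + b) * h) + kap * b * h * (1 + (1 + b) * h) =
     - (b * h * (1 - kap * (1 + (1 + b) * h))) by ring.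
  suff : kap * (1 + (1 + b) * h) < 1 by nra.
  by rewrite hE; lra.
lra.
Qed.

(** * Identification of the parameters and of the typical length *)

Lemma CV_radius_pos (u : nat -> R) x l : 0 < x -> is_pseries u x l -> Rbar_lt 0 (CV_radius u).
Proof.
move=> x0 h; case: (Rbar_lt_le_dec 0 (CV_radius u)) => // h0; exfalso.
apply: (CV_disk_outside u x); last first.
  by apply: ex_series_lim_0; exists l; exact: (is_pseries_R _ _ _).1.
apply: Rbar_le_lt_trans h0 _; rewrite /= Rabs_pos_eq; lra.
Qed.

Lemma Prob_L1_compl theta n (P : pred nat) : (forall j, 0 < theta j.+1) ->
  Prob theta (fun s : {perm 'I_n.+1} => P (L1 s)) =
  1 - Prob theta (fun s : {perm 'I_n.+1} => ~~ P (L1 s)).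
Proof.
move=> tp; rewrite (Prob_L1 theta n P) (Prob_L1 theta n (fun k => ~~ P k)).
have h1 : 0 < INR n.+1 * hn theta n.+1.
  by apply: Rmult_lt_0_compat; [apply: lt_0_INR; lia|exact: hn_gt0].
apply: (Rmult_eq_reg_r (INR n.+1 * hn theta n.+1)); last lra.
rewrite Rmult_minus_distr_r /Rdiv !Rmult_assoc Rinv_l; last lra.
rewrite !Rmult_1_r Rmult_1_l hnS -rsumB; apply: eq_bigr => k _.
by case: (P _); rewrite /=; ring.
Qed.

(** As 1/g - 1/b = 1, the powers of l combine to l, and the value of [apar] turns the constants into
    b. This identifies b ln n / delta with the normalisation in (a). *)
Lemma typical_length g l : 0 < g < 1 -> 0 < l ->
  del (apar g) (bpar g) l * (Rpower (1 - g) (- / g) * Rpower l (/ g)) = bpar g * l.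
Proof.
move=> hg l0.
have b0 : 0 < bpar g by apply: Rdiv_lt_0_compat; lra.
have a0 : 0 < apar g by apply: Rmult_lt_0_compat; [lra|exact: exp_pos].
rewrite -[bpar g * l]exp_ln; last exact: Rmult_lt_0_compat.
rewrite /del /Rpower -!exp_plus; congr exp.
rewrite ln_mult // ln_div // /apar ln_mult; [|lra|exact: exp_pos].
rewrite /Rpower ln_exp {2}/bpar ln_div; [|lra|lra].
by rewrite /bpar; field; lra.
Qed.

(** [theta] is given only through a power series near 0; both series represent [Gfun] on a common
    interval, where coefficients are unique. *)
Lemma theta_coefficients g (theta t : nat -> R) r : 0 < g < 1 -> 0 < r ->
  (forall x, Rabs x < r -> Pser (fun m => theta m.+1) x (Gfun g x)) ->
  (forall x, Rabs x < 1 -> rser (fun n => t n * x ^ n) (gen (apar g) (bpar g) x)) ->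
  forall m, theta m.+1 = Apar g * t m.
Proof.
move=> hg r0 h ht m.
have ht' x : Rabs x < 1 -> is_pseries (fun n => Apar g * t n) x (Gfun g x).
  move=> x1; apply/is_pseries_R/rser_is_series.
  have -> : Gfun g x = Apar g * gen (apar g) (bpar g) x by rewrite /Gfun /gen /cpar; ring.
  apply: (lim_ext (rserM (Apar g) (ht x x1))) => N; apply: eq_bigr => n _; ring.
have h' x : Rabs x < r -> is_pseries (fun m => theta m.+1) x (Gfun g x).
  by move=> xr; apply/is_pseries_Reals/h.
pose y := Rmin r 1 / 2.
have m0 : 0 < Rmin r 1 by apply: Rmin_pos; lra.
have m1 := Rmin_l r 1; have m2 := Rmin_r r 1.
have y0 : 0 < y by rewrite /y; lra.
have yy : Rabs y = y by rewrite Rabs_pos_eq; lra.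
apply: (PSeries_ext_recip (fun m => theta m.+1) (fun n => Apar g * t n)).
- by apply: (CV_radius_pos y0 (h' y _)); rewrite yy /y; lra.
- by apply: (CV_radius_pos y0 (ht' y _)); rewrite yy /y; lra.
exists (mkposreal _ m0) => x; rewrite /ball /= /AbsRing_ball /= /abs /minus /plus /opp /= Ropp_0 Rplus_0_r => hx.
rewrite (is_pseries_unique _ _ _ (h' x ltac:(lra))).
by rewrite (is_pseries_unique _ _ _ (ht' x ltac:(lra))).
Qed.

Close Scope R_scope.

Theorem theorem4p2 (g : R) (theta : nat -> R) :
  (0 < g < 1)%R ->
  (* theta_n = [z^{n-1}] G(z): the power series sum_m theta_{m+1} z^m represents G near 0 *)
  (exists r : R, (0 < r)%R /\
     forall x : R, (Rabs x < r)%R -> Pser (fun m => theta m.+1) x (Gfun g x)) ->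
  (* (a) L_1 / (log N)^{1/g} -> (1-g)^{-1/g} in distribution (N = n.+1) *)
  ((forall x : R, (x < Rpower (1 - g) (- / g))%R ->
      Un_cv (fun n => Prob theta (fun s : {perm 'I_n.+1} =>
         if Rle_dec (INR (L1 s) / Rpower (ln (INR n.+1)) (/ g)) x then true else false))
        0%R) /\
   (forall x : R, (Rpower (1 - g) (- / g) < x)%R ->
      Un_cv (fun n => Prob theta (fun s : {perm 'I_n.+1} =>
         if Rle_dec (INR (L1 s) / Rpower (ln (INR n.+1)) (/ g)) x then true else false))
        1%R)) /\
  (* (b) finite-dimensional distributions of (R_1, R_2, ...) converge to
     independent Poisson(theta_j / j) *)
  (forall (k : nat) (m : nat -> nat),
     Un_cv (fun n => Prob theta (fun s : {perm 'I_n.+1} =>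
                all (fun j => Rcyc j s == m j) (iota 1 k)))
       (foldr (fun j acc => (poisson_pmf (theta j / INR j) (m j) * acc)%R) 1%R
          (iota 1 k))).
Proof.
Local Open Scope R_scope.
move=> hg [r [r0 hr]].
have b0 : 0 < bpar g by apply: Rdiv_lt_0_compat; lra.
have a0 : 0 < apar g by apply: Rmult_lt_0_compat; [lra|exact: exp_pos].
have A0 : 0 < Apar g.
  apply: Rmult_lt_0_compat; last exact: exp_pos.
  by apply: sqrt_lt_R0; apply: Rmult_lt_0_compat; have := PI_RGT_0; lra.
have [t ht] := row_lim a0 b0.
have thetaE := theta_coefficients hg r0 hr (fun x => rser_t a0 b0 ht (x := x)).
have tpos n : 0 < t n := t_gt0 a0 b0 ht n.
have theta_pos j : 0 < theta j.+1 by rewrite thetaE; exact: Rmult_lt_0_compat.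
have theta_mono j : theta j.+1 <= theta j.+2.
  by rewrite !thetaE; apply: Rmult_le_compat_l; [lra|exact: (t_incr a0 b0 ht)].
have theta_unb B : exists j, B < theta j.+1.
  have [j hj] := t_unbounded a0 b0 ht (B / Apar g); exists j; rewrite thetaE.
  have -> : B = Apar g * (B / Apar g) by field; lra.
  exact: Rmult_lt_compat_l.
have [N hN] := t_log_concave a0 b0 ht.
have theta_lc j : (N < j)%N -> theta j * theta j.+2 <= theta j.+1 ^ 2.
  case: j => // j Nj; rewrite !thetaE Rpow_mult_distr.
  have -> : Apar g * t j * (Apar g * t j.+2) = Apar g ^ 2 * (t j * t j.+2) by ring.
  by apply: Rmult_le_compat_l; [exact: pow2_ge_0|exact: hN].
have theta_ser x : 0 <= x < 1 -> rser (fun k => theta k.+1 * x ^ k) (Apar g * gen (apar g) (bpar g) x).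
  move=> hx; apply: (lim_ext (rserM (Apar g) (rser_t_nonneg a0 b0 ht hx))) => M.
  by apply: eq_bigr => k _; rewrite thetaE; ring.
have theta_sum : summable_inside theta.
  move=> x hx; exists (Apar g * gen (apar g) (bpar g) x) => M.
  apply: (rser_le (f := fun k => theta k.+1 * x ^ k)) (theta_ser x hx) => k.
  by apply: Rmult_le_pos; [exact/Rlt_le|apply: pow_le; lra].
have [Z [J [C [Z0 Zpos Zlc Ztheta ZC]]]] :=
  log_concave_modification theta_pos theta_mono theta_unb theta_lc theta_sum.
have Zunb B : exists n, forall j, (n <= j)%N -> B < Z j.
  have [j0 hj0] := theta_unb B; exists (maxn J j0.+1) => j hj; rewrite Ztheta; last by lia.
  apply: Rlt_le_trans hj0 _; have /subnK <- : (j0.+1 <= j)%N by lia.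
  elim: (j - j0.+1)%N => [|d IH]; first by rewrite add0n; lra.
  by apply: Rle_trans IH _; rewrite addSn addnS; exact: theta_mono.
have Zsum : summable_inside Z.
  move=> x hx; have [B hB] := theta_sum x hx; exists (C * B) => M.
  have C0 : 0 < C by have := ZC 0%N; have := Zpos 1%N; have := theta_pos 0%N => *; nra.
  apply: Rle_trans (Rmult_le_compat_l _ _ _ (Rlt_le _ _ C0) (hB M)).
  rewrite rsumMl; apply: rsum_le => k; rewrite -Rmult_assoc.
  by apply: Rmult_le_compat_r; [apply: pow_le; lra|exact: ZC].
pose p := hn Z.
have ppos n : 0 < p n by apply: hn_gt0.
have pmono : forall n, p n <= p n.+1 := hn_nondecreasing Z0 Zpos Zlc Zunb.
have pratio : forall x, x < 1 -> exists n0, forall n, (n0 <= n)%N -> x * p n.+1 <= p n.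
  by move=> x; exact: (hn_ratio_to_one Z0 Zpos Zlc Zsum).
have pZ : tends p Z 1.
  by apply: (lim_ext (is_lim_seq_const 1)) => n; rewrite /p /Rdiv Rinv_r //; have := ppos n; rewrite /p; lra.
have hE : exists E, 0 < E /\ tends p theta E.
  have agree j : (J < j)%N -> Z j = theta j by move=> h; apply: Ztheta; exact: ltnW.
  have h := tends_change ppos pmono pratio agree pZ.
  by eexists; split; [|exact: h]; rewrite Rmult_1_r; exact: exp_pos.
have [E [E0 thetaZ]] := hE.
pose k0 := Rpower (1 - g) (- / g).
have k00 : 0 < k0 by exact: exp_pos.
have [n1 hn1] := ev_nat (ev_ge 1).
(* In units of 1/delta the event becomes delta L_1 <= kap b ln N with kap = x / k0 and N = n + 1,
   the form used by [chernoff_vanish]. *)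
have event n k x : (n1 <= n)%N ->
  INR k / Rpower (ln (INR n.+1)) (/ g) <= x <->
  del (apar g) (bpar g) (ln (INR n.+1)) * INR k <= x / k0 * bpar g * ln (INR n.+1).
  move=> hn; have l1 := hn1 n hn; set l := ln _ in l1 *.
  have P0 : 0 < Rpower l (/ g) by exact: exp_pos.
  have d0 := del_gt0 (apar g) (bpar g) l; set d := del _ _ _ in d0 *.
  have -> : x / k0 * bpar g * l = d * (x * Rpower l (/ g)).
    rewrite Rmult_assoc -(typical_length hg (l := l)); last lra.
    by rewrite -/d -/k0; field; lra.
  have e : INR k = INR k / Rpower l (/ g) * Rpower l (/ g) by field; lra.
  split=> h.
    by apply: Rmult_le_compat_l; [lra|rewrite e; apply: Rmult_le_compat_r; lra].
  apply: (Rmult_le_reg_r (Rpower l (/ g))) => //; rewrite -e.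
  exact: (Rmult_le_reg_l d).
pose below (x : R) (n k : nat) := if Rle_dec (INR k / Rpower (ln (INR n.+1)) (/ g)) x then true else false.
have chern kap lam P := @chernoff_vanish _ _ _ _ _ _ _ a0 b0 A0 theta_pos theta_ser Z0 Zpos Zlc Ztheta E0 thetaZ kap lam P.
split; [split|].
- move=> x hx; apply/is_lim_seq_Reals.
  (* The maximum with 1/2 keeps [kap] positive even when x is not. *)
  pose kap := Rmax (1 / 2) (x / k0).
  have xE : x / k0 * k0 = x by field; lra.
  have xk : x / k0 < 1 by apply: (Rmult_lt_reg_r k0) => //; rewrite xE Rmult_1_l.
  have hk : 0 < kap < 1.
    by split; [apply: Rlt_le_trans (Rmax_l _ _); lra|apply: Rmax_lub_lt; lra].
  have [lam [lam1 gap]] := gap_below b0 hk.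
  apply: (chern kap lam (below x)) => //; [lra|lra|lra|].
  exists n1 => n k hn; rewrite /below; case: Rle_dec => // h _.
  have {}h := (event n k x hn).1 h; have l1 := hn1 n hn.
  have : x / k0 * (bpar g * ln (INR n.+1)) <= kap * (bpar g * ln (INR n.+1)).
    by apply: Rmult_le_compat_r; [apply: Rmult_le_pos; lra|exact: Rmax_r].
  by move=> h2; rewrite -[X in _ <= X](Rmult_0_r (lam - 1)); apply: Rmult_le_compat_l; lra.
- move=> x hx; apply/is_lim_seq_Reals.
  have xE : x / k0 * k0 = x by field; lra.
  have xk : 1 < x / k0 by apply: (Rmult_lt_reg_r k0) => //; rewrite xE Rmult_1_l.
  have [lam [lam0 lam1 gap]] := gap_above b0 xk.
  have h0 : is_lim_seq (fun n => Prob theta (fun s : {perm 'I_n.+1} => ~~ below x n (L1 s))) 0.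
    apply: (chern (x / k0) lam (fun n k => ~~ below x n k)) => //; [lra|lra|].
    exists n1 => n k hn; rewrite /below; case: Rle_dec => // h _.
    have {}h : x / k0 * bpar g * ln (INR n.+1) < del (apar g) (bpar g) (ln (INR n.+1)) * INR k.
      by apply: Rnot_le_lt => h1; apply: h; apply/event.
    by nra.
  have h1 := is_lim_seq_minus' _ _ _ _ (is_lim_seq_const 1) h0; rewrite Rminus_0_r in h1.
  by apply: (lim_ext h1) => n; rewrite -(Prob_L1_compl n (below x n) theta_pos).
move=> k m; apply/is_lim_seq_Reals.
have h := @poisson_limit p ppos pmono pratio theta E k m E0 thetaZ.
(* [poisson_limit] runs over sizes n, the statement over sizes n + 1. *)
exact: (is_lim_seq_incr_1 _ _).1 h.
Qed.
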